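(* Let $p>3$ be a prime. If $p\equiv1\pmod4$ and $p=x^2+4y^2$ with $x,y\in\mathbb Z$, then $$\sum_{k=0}^{p-1}\frac{\binom{2k}k^3}{64^k(2k-1)}\equiv-2x^2+p+\frac{p^2}{4x^2}\pmod{p^3}.$$ If $p\equiv3\pmod4$, then $$\sum_{k=0}^{p-1}\frac{\binom{2k}k^3}{64^k(2k-1)}\equiv-\frac14\big(2+p^2E_{p-3}\big)\frac{(p+1)^2}{2^{p-1}}\binom{(p-1)/2}{(p-3)/4}^2+\frac{p^2}{2\binom{(p-1)/2}{(p-3)/4}^2}\pmod{p^3}.$$
   Context: Congruences modulo $p^3$ are between rational numbers whose denominators are not divisible by $p$. The Euler numbers $\{E_n\}$ are given by $E_{2n-1}=0$, $E_0=1$, $E_{2n}=-\sum_{k=1}^n\binom{2n}{2k}E_{2n-2k}$ for $n=1,2,3,\ldots$. *)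

(* Defs.v *)
From mathcomp Require Import all_boot all_order all_algebra.

Set Implicit Arguments.
Unset Strict Implicit.
Unset Printing Implicit Defensive.

Import Order.TTheory GRing.Theory Num.Theory.

Local Open Scope ring_scope.

Definition pintegral (p : nat) (a : rat) : bool := ~~ (p%:Z %| denq a)%Z.

(* Congruence of rationals modulo p ^ e, for p prime: both sides are required
   to be p-integral, and p ^ e divides the numerator of the difference. *)
Definition eqmodq (p e : nat) (a b : rat) : Prop :=
  [/\ pintegral p a, pintegral p b & ((p ^ e)%N%:Z %| numq (a - b))%Z].

(* [:: E_{2n}; E_{2n-2}; ...; E_0], so that in the recursive step the entry of
   index k - 1 is E_{2n-2k}; see [euler_even] and [euler_odd] below. *)
Fixpoint euler_even_seq (n : nat) : seq int :=
  if n is m.+1 then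
    let s := euler_even_seq m in
    - (\sum_(1 <= k < n.+1) ('C(n.*2, k.*2))%:Z * s`_k.-1) :: s
  else [:: 1].

Definition euler (n : nat) : int :=
  if odd n then 0 else (euler_even_seq n./2)`_0.

Lemma nth_euler_even_seq n i :
  (i <= n)%N -> (euler_even_seq n)`_i = (euler_even_seq (n - i))`_0.
Proof.
elim: n i => [|n IHn] [|i] //= lein.
by rewrite IHn // subSS.
Qed.

Lemma euler0 : euler 0 = 1.
Proof. by []. Qed.

Lemma euler_odd n : (0 < n)%N -> euler (n.*2 - 1) = 0.
Proof. by case: n => // n _; rewrite /euler doubleS subn1 /= odd_double. Qed.

Lemma euler_even n : (0 < n)%N ->
  euler n.*2 =
  - \sum_(1 <= k < n.+1) ('C(n.*2, k.*2))%:Z * euler (n.*2 - k.*2).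
Proof.
case: n => // n _; rewrite {1}/euler odd_double doubleK /=; congr (- _).
apply: eq_big_nat => -[|k] // /andP[_ lekn].
by rewrite nth_euler_even_seq // -doubleB subSS /euler odd_double doubleK.
Qed.

(* Main.v *)
Require Import Defs.
From mathcomp Require Import all_boot all_order all_algebra.
From mathcomp Require Import finfield ring lra zify.

(** Put [p = 2n + 1], [b_k = C(2k, k) / 4^k] and
    [a_k(x) = (-x)_k (x + 1)_k / k!^2].  As [p] divides [C(2k, k)] for
    [n < k < p], and [2k - 1 = p] at [k = n + 1], the sum is
    [sum_(k <= n) b_k^3 / (2k - 1) + p^2 (-1)^n] mod [p^3].  Moreover
    [a_k(n) = b_k^2 (1 - p^2 sum_(j < k) 1 / (2j + 1)^2)] mod [p^3], so replacing
    [b_k^2] by [a_k(n)] yields [W(n) = sum_k a_k(n) b_k / (2k - 1)], which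
    contiguity relations in [x] evaluate exactly, up to [p^2] times a correction
    needed only mod [p].  Over [F_p] this correction is the derivative at [0] of
    the polynomial [f] of degree at most [n] with [f((2N + 1)^2) = W(N)] for
    [N <= n]; [f] is explicit in terms of the squares of the polynomials with
    roots [(4i + 1)^2], resp. [(4i + 3)^2], so that [f'(0)] involves the sum of
    [1 / (4i + 1)^2] or [1 / (4i + 3)^2].

    If [p = 4q + 3], that sum is [E_(p-3) / 4] mod [p].

    If [p = 4q + 1], one has to relate [b_q] mod [p^3] to [x].  The Jacobi sum
    [alpha] of a quartic and the quadratic Teichmueller character mod [p^4]
    satisfies [alpha^2 - 2 A alpha + p = 0] with [p = A^2 + B^2] and [A] odd, so
    that [A^2 = x^2].  Lowering one exponent by one multiplies such a Jacobi sum
    by a quotient of sums [J(chi, omega)], and each of these expands into the sum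
    of [(-1)^k C(p^3, k)] over a residue class mod [p - 1].  Their values mod
    [p^4] telescope (an elementary substitute for the Gross-Koblitz formula) to
    [alpha = - b_q (1 + p^2 sum_(i < q) 1 / (4i + 3)^2)] mod [p^3]. *)

Set Implicit Arguments.
Unset Strict Implicit.
Unset Printing Implicit Defensive.

Import Order.TTheory GRing.Theory Num.Theory.

Local Open Scope ring_scope.

(** * Congruences between p-integral rationals *)

(** Why a derivative at 0: as a polynomial in y = (2x + 1)^2, a_k(x) equals b_k^2 at y = 0, and x =
    n corresponds to y = p^2. Replacing b_k^2 by a_k(n) moves y from 0 to p^2 and costs p^2 times
    the derivative at 0. The contiguity relations evaluate W only at natural arguments, but modulo p
    the n + 1 points (2N + 1)^2 with N <= n are distinct, so these values determine a polynomial of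
    degree at most n and hence its derivative at 0.

    Why modulo p^4: every relation between the Jacobi sums contains factors J(chi, omega), which are
    p times a unit. Cancelling p leaves a congruence modulo p^3.

    Why the quadratic equation suffices: its roots are alpha and p / alpha, so 4 x^2 = (alpha + p /
    alpha)^2, whatever the sign of A. Modulo p^3 the second root is - p / b_q; the cross term of the
    square cancels the summand p of the theorem, and its last square combines with p^2 / (4 x^2). *)

Section PIntegral.

Variables (p : nat) (p_pr : prime p).

Lemma dvdz_nat (m n : nat) : (m%:Z %| n%:Z)%Z = (m %| n)%N.
Proof. by []. Qed.

(** The reduced denominator divides every other denominator of the same fraction, so integrality can
    be read off any representation. *)
Lemma pintegral_frac (n d : int) : ~~ (p%:Z %| d)%Z ->
  pintegral p (n%:~R / d%:~R).
Proof.
move=> pd; have d0 : d != 0 by apply: contraNneq pd => ->; rewrite dvdz0.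
rewrite /pintegral; apply: contra pd => pq.
have eqn : numq (n%:~R / d%:~R) * d = n * denq (n%:~R / d%:~R).
  apply/eqP; rewrite -(eqr_int rat) !rmorphM /= numqE.
  by rewrite mulrAC divfK ?intr_eq0.
have cop : coprimez (denq (n%:~R / d%:~R)) (numq (n%:~R / d%:~R)).
  by rewrite /coprimez gcdzC; exact: coprime_num_den.
have : (denq (n%:~R / d%:~R) %| d)%Z.
  by rewrite -(Gauss_dvdzr _ cop) eqn dvdz_mull.
exact: dvdz_trans.
Qed.

Lemma pintegralP (a : rat) : pintegral p a <->
  exists n d : int, ~~ (p%:Z %| d)%Z /\ a = n%:~R / d%:~R.
Proof.
split=> [pa|[n [d [pd ->]]]]; last exact: pintegral_frac.
by exists (numq a), (denq a); rewrite divq_num_den.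
Qed.

Lemma Euclid_dvdzM (m n : int) :
  (p%:Z %| m * n)%Z = (p%:Z %| m)%Z || (p%:Z %| n)%Z.
Proof. by rewrite !dvdzE abszM /= Euclid_dvdM. Qed.

Lemma ndvdz_neq0 (d : int) : ~~ (p%:Z %| d)%Z -> d%:~R != 0 :> rat.
Proof. by rewrite intr_eq0; apply: contraNneq => ->; rewrite dvdz0. Qed.

Lemma pintegral_int (n : int) : pintegral p n%:~R.
Proof.
by rewrite /pintegral denq_int dvdzE /= dvdn1; case: eqP p_pr => // ->.
Qed.

Lemma pintegral_nat (n : nat) : pintegral p n%:R.
Proof. exact: pintegral_int n. Qed.

Lemma pintegral0 : pintegral p 0. Proof. exact: pintegral_nat 0. Qed.
Lemma pintegral1 : pintegral p 1. Proof. exact: pintegral_nat 1. Qed.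

Lemma pintegralM a b : pintegral p a -> pintegral p b -> pintegral p (a * b).
Proof.
move=> /pintegralP [n [d [pd ->]]] /pintegralP [m [e [pe ->]]].
rewrite mulf_div -!intrM; apply: pintegral_frac.
by rewrite Euclid_dvdzM negb_or pd.
Qed.

Lemma pintegralD a b : pintegral p a -> pintegral p b -> pintegral p (a + b).
Proof.
move=> /pintegralP [n [d [pd ->]]] /pintegralP [m [e [pe ->]]].
rewrite addf_div ?ndvdz_neq0 // -!intrM -intrD; apply: pintegral_frac.
by rewrite Euclid_dvdzM negb_or pd.
Qed.

Lemma pintegralN a : pintegral p a -> pintegral p (- a).
Proof. by rewrite /pintegral denqN. Qed.

Lemma pintegralB a b : pintegral p a -> pintegral p b -> pintegral p (a - b).
Proof. by move=> pa pb; apply: pintegralD => //; apply: pintegralN. Qed.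

Lemma pintegralX a n : pintegral p a -> pintegral p (a ^+ n).
Proof.
move=> pa; elim: n => [|n IHn]; first by rewrite expr0; apply: pintegral1.
by rewrite exprS; apply: pintegralM.
Qed.

Lemma pintegral_sum I (r : seq I) (P : pred I) F :
  (forall i, P i -> pintegral p (F i)) -> pintegral p (\sum_(i <- r | P i) F i).
Proof.
by move=> pF; apply: (big_ind (pintegral p)) => //; [apply: pintegral0|apply: pintegralD].
Qed.

Lemma pintegral_prod I (r : seq I) (P : pred I) F :
  (forall i, P i -> pintegral p (F i)) -> pintegral p (\prod_(i <- r | P i) F i).
Proof.
by move=> pF; apply: (big_ind (pintegral p)) => //; [apply: pintegral1|apply: pintegralM].
Qed.

Lemma pintegralV_int (d : int) : ~~ (p%:Z %| d)%Z -> pintegral p d%:~R^-1.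
Proof. by move=> pd; rewrite -div1r -[1]/(1%:~R); apply: pintegral_frac. Qed.

Lemma pintegralV (n : nat) : ~~ (p %| n)%N -> pintegral p n%:R^-1.
Proof. exact: (@pintegralV_int n). Qed.

(** An explicit p-integral quotient replaces the numerator of [eqmodq]: a congruence is then proved
    by exhibiting [c] and closing an identity with [ring] or [field]. *)
Definition cong (e : nat) (a b : rat) : Prop :=
  exists2 c, pintegral p c & a = b + p%:R ^+ e * c.

Lemma congP e a b c : pintegral p c -> a - b = p%:R ^+ e * c -> cong e a b.
Proof. by move=> pc eab; exists c => //; rewrite -eab addrC subrK. Qed.

Lemma cong_refl e a : cong e a a.
Proof. by exists 0; [apply: pintegral0|rewrite mulr0 addr0]. Qed.

Lemma cong_eq e a b : a = b -> cong e a b.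
Proof. by move=> ->; apply: cong_refl. Qed.

Lemma cong_sym e a b : cong e a b -> cong e b a.
Proof.
by case=> c pc ->; exists (- c); [apply: pintegralN|rewrite mulrN addrK].
Qed.

Lemma cong_trans e b a c : cong e a b -> cong e b c -> cong e a c.
Proof.
case=> x px -> [y py ->]; exists (x + y); first exact: pintegralD.
by ring.
Qed.

Lemma congD e a b c d : cong e a b -> cong e c d -> cong e (a + c) (b + d).
Proof.
case=> x px -> [y py ->]; exists (x + y); first exact: pintegralD.
by ring.
Qed.

Lemma congN e a b : cong e a b -> cong e (- a) (- b).
Proof.
by case=> x px ->; exists (- x); [apply: pintegralN|rewrite opprD mulrN].
Qed.

Lemma congB e a b c d : cong e a b -> cong e c d -> cong e (a - c) (b - d).
Proof. by move=> h1 h2; apply: congD => //; apply: congN. Qed.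

Lemma congMl e c a b : pintegral p c -> cong e a b -> cong e (c * a) (c * b).
Proof.
by move=> pc [x px ->]; exists (c * x); [apply: pintegralM|rewrite mulrDr mulrCA].
Qed.

Lemma congMr e c a b : pintegral p c -> cong e a b -> cong e (a * c) (b * c).
Proof. by move=> pc ab; rewrite ![_ * c]mulrC; apply: congMl. Qed.

Lemma congM e a b c d : pintegral p b -> pintegral p c ->
  cong e a b -> cong e c d -> cong e (a * c) (b * d).
Proof.
move=> pb pc ab cd; apply: (cong_trans (b := b * c)); first exact: congMr.
exact: congMl.
Qed.

Lemma cong_pint e a b : cong e a b -> pintegral p b -> pintegral p a.
Proof.
case=> c pc -> pb; apply: pintegralD => //; apply: pintegralM => //.
exact/pintegralX/pintegral_nat.
Qed.

Lemma congX e n a b : pintegral p b -> cong e a b -> cong e (a ^+ n) (b ^+ n).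
Proof.
move=> pb ab; elim: n => [|n IHn]; first by rewrite !expr0; apply: cong_refl.
rewrite !exprS; apply: congM => //.
exact/pintegralX/(cong_pint ab).
Qed.

Lemma cong_sum e I (r : seq I) (P : pred I) F G :
  (forall i, P i -> cong e (F i) (G i)) ->
  cong e (\sum_(i <- r | P i) F i) (\sum_(i <- r | P i) G i).
Proof.
by move=> FG; apply: (big_ind2 (cong e)) => //; [apply: cong_refl|move=> *; apply: congD].
Qed.

Lemma cong_prod e I (r : seq I) (P : pred I) F G :
  (forall i, P i -> pintegral p (G i)) ->
  (forall i, P i -> cong e (F i) (G i)) ->
  cong e (\prod_(i <- r | P i) F i) (\prod_(i <- r | P i) G i).
Proof.
move=> pG FG.
suff [] : pintegral p (\prod_(i <- r | P i) G i) /\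
  cong e (\prod_(i <- r | P i) F i) (\prod_(i <- r | P i) G i) by [].
apply: (big_rec2 (fun x y => pintegral p x /\ cong e y x)) => [|i x y Pi [px xy]].
  by split; [apply: pintegral1|apply: cong_refl].
split; first by apply: pintegralM => //; apply: pG.
by apply: congM => //; [apply: pG|apply: (cong_pint xy)|apply: FG].
Qed.

Lemma prime_natq_neq0 : p%:R != 0 :> rat.
Proof. by rewrite pnatr_eq0 -lt0n prime_gt0. Qed.

Lemma congMp e k a b : cong e a b -> cong (k + e) (p%:R ^+ k * a) (p%:R ^+ k * b).
Proof. by case=> c pc ->; exists c => //; rewrite mulrDr mulrA exprD. Qed.

Lemma congMp_inv e k a b :
  cong (k + e) (p%:R ^+ k * a) (p%:R ^+ k * b) -> cong e a b.
Proof.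
case=> c pc eab; exists c => //.
by apply: (mulfI (expf_neq0 k prime_natq_neq0)); rewrite eab mulrDr mulrA exprD.
Qed.

Lemma cong_leq e f a b : (e <= f)%N -> cong f a b -> cong e a b.
Proof.
move=> /subnKC <- [c pc ->]; exists (p%:R ^+ (f - e) * c).
  by apply: pintegralM => //; apply/pintegralX/pintegral_nat.
by rewrite mulrA exprD.
Qed.

(** With the quotient written as n / d, p^e divides the numerator of the difference times d, and p^e
    is coprime to d. *)
Lemma eqmodq_cong e a b : pintegral p b -> cong e a b -> eqmodq p e a b.
Proof.
move=> pb ab; have pa := cong_pint ab pb; split => //.
case: ab => c /pintegralP [n [d [pd ->]]] ->.
rewrite addrAC subrr add0r; set x := _ * _.
have d0 := ndvdz_neq0 pd.
have eqn : numq x * d = (p ^ e)%:Z * n * denq x.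
  apply/eqP; rewrite -(eqr_int rat) !rmorphM /= numqE.
  rewrite -[((p ^ e)%:Z)%:~R]/((p ^ e)%:R) natrX /x.
  by apply/eqP; field.
have cop : coprimez (p ^ e)%N%:Z d.
  rewrite /coprimez /gcdz /= -[X in _ == X]/(Posz 1); apply/eqP; congr Posz.
  by apply/eqP; apply: coprimeXl; rewrite prime_coprime.
by rewrite -(Gauss_dvdzl _ cop) eqn -mulrA dvdz_mulr.
Qed.

Lemma int_Fp_eq0 (d : int) : (d%:~R == 0 :> 'F_p) = (p%:Z %| d)%Z.
Proof. by rewrite (dvdz_pcharf (pchar_Fp p_pr)). Qed.

Lemma nat_Fp_eq0 (d : nat) : (d%:R == 0 :> 'F_p) = (p %| d)%N.
Proof. exact: (int_Fp_eq0 d). Qed.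

Local Notation red := (@ratr 'F_p).

(** [ratr] into ['F_p] divides the images of numerator and denominator. It respects sums and
    products only on p-integral rationals (it sends 1 / p to 0), so every rule below carries
    integrality hypotheses. *)
Lemma red_frac (n d : int) : ~~ (p%:Z %| d)%Z ->
  red (n%:~R / d%:~R) = n%:~R / d%:~R.
Proof.
move=> pd; have d0 := ndvdz_neq0 pd.
have := pintegral_frac n pd; rewrite /pintegral /ratr.
set a := n%:~R / d%:~R => pa.
apply/eqP; rewrite eqr_div ?int_Fp_eq0 // -!intrM; apply/eqP; congr (_%:~R).
apply/eqP; rewrite -(eqr_int rat) !rmorphM /= numqE /a.
by rewrite mulrAC divfK.
Qed.

Lemma redM a b : pintegral p a -> pintegral p b -> red (a * b) = red a * red b.
Proof.
move=> /pintegralP [n [d [pd ->]]] /pintegralP [m [e [pe ->]]].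
rewrite mulf_div -!intrM !red_frac ?Euclid_dvdzM ?negb_or ?pd //.
by rewrite mulf_div !intrM.
Qed.

Lemma redD a b : pintegral p a -> pintegral p b -> red (a + b) = red a + red b.
Proof.
move=> /pintegralP [n [d [pd ->]]] /pintegralP [m [e [pe ->]]].
rewrite addf_div ?ndvdz_neq0 // -!intrM -intrD.
rewrite !red_frac ?Euclid_dvdzM ?negb_or ?pd //.
by rewrite addf_div ?int_Fp_eq0 // -!intrM -intrD.
Qed.

Lemma red_nat n : red n%:R = n%:R.
Proof. exact: ratr_nat. Qed.

Lemma redN a : pintegral p a -> red (- a) = - red a.
Proof.
move=> pa; apply/eqP; rewrite -addr_eq0 -redD ?pintegralN // addNr.
by rewrite (red_nat 0).
Qed.

Lemma redB a b : pintegral p a -> pintegral p b -> red (a - b) = red a - red b.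
Proof. by move=> pa pb; rewrite redD ?redN ?pintegralN. Qed.

Lemma redX a n : pintegral p a -> red (a ^+ n) = red a ^+ n.
Proof.
move=> pa; elim: n => [|n IHn]; first by rewrite !expr0 (red_nat 1).
by rewrite !exprS redM ?IHn ?pintegralX.
Qed.

Lemma redV n : ~~ (p %| n)%N -> red n%:R^-1 = n%:R^-1.
Proof.
move=> pn; have := red_frac 1 (d := n) pn.
by rewrite !div1r.
Qed.

Lemma red_sum I (r : seq I) (P : pred I) F :
  (forall i, P i -> pintegral p (F i)) ->
  red (\sum_(i <- r | P i) F i) = \sum_(i <- r | P i) red (F i).
Proof.
move=> pF; apply: (proj2 (A := pintegral p (\sum_(i <- r | P i) F i))).
apply: (big_rec2 (fun x y => pintegral p x /\ red x = y)) => [|i x y Pi [px xy]].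
  by rewrite (red_nat 0); split=> //; apply: pintegral0.
by rewrite redD ?xy ?pF //; split=> //; apply: pintegralD => //; apply: pF.
Qed.

Lemma cong1_red a b : pintegral p a -> pintegral p b ->
  cong 1 a b <-> red a = red b.
Proof.
move=> pa pb; split=> [[c pc ->]|eab].
  rewrite redD ?redM ?redX ?red_nat ?pintegralM ?pintegralX ?pintegral_nat //.
  have /eqP -> : p%:R == 0 :> 'F_p by rewrite nat_Fp_eq0.
  by rewrite expr1 mul0r addr0.
have: red (a - b) = 0 by rewrite redB // eab subrr.
have /pintegralP [n [d [pd eq_ab]]] : pintegral p (a - b) by apply: pintegralB.
rewrite eq_ab red_frac // => /eqP; rewrite mulf_eq0 invr_eq0 !int_Fp_eq0.
rewrite (negPf pd) orbF => /dvdzP [m em].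
apply: (congP (c := m%:~R / d%:~R)); first by apply: pintegral_frac.
by rewrite eq_ab em intrM expr1; ring.
Qed.

End PIntegral.

(* Purely syntactic: trying to close such goals by conversion on rationals can
   take very long. *)
Ltac pint := match goal with
  | H : is_true (pintegral ?p ?x) |- is_true (pintegral ?p ?x) => exact H
  | Hp : is_true (prime ?p) |- is_true (pintegral ?p ?x) =>
    match x with
    | _ + _ => apply (pintegralD Hp); pint
    | - _ => apply pintegralN; pint
    | _ * _ => apply (pintegralM Hp); pint
    | _ ^+ _ => apply (pintegralX Hp); pint
    | 1 => exact (pintegral1 Hp)
    | 0 => exact (pintegral0 Hp)
    | _%:R => exact (pintegral_nat Hp _)
    | _%:~R => exact (pintegral_int Hp _)
    end
  end.

Ltac congs := match goal with
  | H : cong ?p ?e ?x ?y |- cong ?p ?e ?x ?y => exact H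
  | Hp : is_true (prime ?p) |- cong ?p ?e ?x ?x => exact (cong_refl Hp e x)
  | Hp : is_true (prime ?p) |- cong ?p ?e (_ + _) (_ + _) => apply (congD Hp); congs
  | Hp : is_true (prime ?p) |- cong ?p ?e (- _) (- _) => apply congN; congs
  | Hp : is_true (prime ?p) |- cong ?p ?e (_ * _) (_ * _) =>
      apply (congM Hp); [pint|pint|congs|congs]
  | Hp : is_true (prime ?p) |- cong ?p ?e (_ ^+ _) (_ ^+ _) => apply (congX Hp); [pint|congs]
  end.

(** * Contiguous Watson sums *)

Lemma bin2nnS k : (k.+1 * 'C(2 * k.+1, k.+1) = 2 * (2 * k + 1) * 'C(2 * k, k))%N.
Proof.
have e1 := mul_bin_diag (2 * k.+1) k; have e2 := mul_bin_down (2 * k).+1 k.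
rewrite (_ : (2 * k.+1).-1 = (2 * k).+1) in e1; last by lia.
rewrite (_ : ((2 * k).+1 - k)%N = k.+1) /= in e2; last by lia.
apply/eqP; rewrite -(eqn_pmul2l (ltn0Sn k)) -e1; apply/eqP.
by rewrite mulnCA -mulnA -e2; lia.
Qed.

Section Watson.

Variable F : fieldType.

Definition cbin (k : nat) : F := 'C(2 * k, k)%:R / 4%:R ^+ k.

(* (-x)_k (x + 1)_k / k!^2 in Pochhammer notation. *)
Definition acoef (x : F) (k : nat) : F :=
  \prod_(j < k) (- (x - j%:R) * (x + j%:R + 1) / (j.+1%:R ^+ 2)).

Lemma acoef0 x : acoef x 0 = 1. Proof. by rewrite /acoef big_ord0. Qed.

Lemma acoefS x k :
  acoef x k.+1 = acoef x k * (- (x - k%:R) * (x + k%:R + 1) / (k.+1%:R ^+ 2)).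
Proof. by rewrite /acoef big_ord_recr. Qed.

Lemma cbin0 : cbin 0 = 1.
Proof. by rewrite /cbin bin0 expr0 divr1. Qed.

(** [K] is the last summation index. Invertibility of the integers up to 2K holds over [rat] for
    every [K] and over ['F_p] for [K] = n, so both fields share these recurrences. *)
Variable K : nat.
Hypothesis Knz : forall i, (0 < i <= 2 * K)%N -> i%:R != 0 :> F.

Lemma two_neq0 : (0 < K)%N -> 2%:R != 0 :> F.
Proof. by move=> K0; apply: Knz; lia. Qed.

Lemma natS_neq0 k : (k < K)%N -> 1 + k%:R != 0 :> F.
Proof. by move=> kK; rewrite nat1r; apply: Knz; lia. Qed.

Lemma cbinS k : (k < K)%N ->
  cbin k.+1 = cbin k * (2 * k%:R + 1) / (2 * (1 + k%:R)).
Proof.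
move=> kK; have K0 : (0 < K)%N by lia.
have two0 := two_neq0 K0; have k0 := natS_neq0 kK.
have e := congr1 (fun n : nat => n%:R : F) (bin2nnS k).
move: e; rewrite !natrM natrD natrM -[k.+1%:R]nat1r => e.
have e' : 'C(2 * k.+1, k.+1)%:R = 2 * (2 * k%:R + 1) * 'C(2 * k, k)%:R / (1 + k%:R) :> F.
  by rewrite -e; field.
rewrite /cbin e' exprS.
have four0 : 4%:R != 0 :> F by rewrite (natrM _ 2 2) mulf_neq0.
by field; rewrite k0 two0 expf_neq0.
Qed.

(** From (-x-1)_(k+1) = -(x+1) (-x)_k and (x+1) (x+2)_(k+1) = (x+1)_k (x+k+1) (x+k+2). The common
    factor x + 1 cancels, so no value of x is excluded. *)
Lemma acoef_shift_up x k : (k < K)%N -> acoef (x + 1) k.+1 =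
  - acoef x k * (x + k%:R + 1) * (x + k%:R + 2) / (1 + k%:R) ^+ 2.
Proof.
elim: k => [|k IHk] kK.
  by rewrite acoefS !acoef0; field; rewrite oner_neq0.
rewrite acoefS IHk; last lia.
rewrite (acoefS x) -!(nat1r k.+1) -!(nat1r k).
by have n1 := natS_neq0 (ltnW kK); have := natS_neq0 kK; rewrite -nat1r => n2; field; rewrite n1 n2.
Qed.

Lemma acoef_shift_down x k : (k < K)%N -> acoef (x - 1) k.+1 =
  - acoef x k * (x - k%:R) * (x - k%:R - 1) / (1 + k%:R) ^+ 2.
Proof.
elim: k => [|k IHk] kK.
  by rewrite acoefS !acoef0; field; rewrite oner_neq0.
rewrite acoefS IHk; last lia.
rewrite (acoefS x) -!(nat1r k.+1) -!(nat1r k).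
by have n1 := natS_neq0 (ltnW kK); have := natS_neq0 kK; rewrite -nat1r => n2; field; rewrite n1 n2.
Qed.

(** Creative telescoping: by the shift lemmas each new summand is a rational multiple of a_k(x) b_k,
    and the right-hand side is the certificate. At k = K it is the boundary term whose vanishing
    gives [watson_rec]. *)
Lemma watson_telescope x k : (k <= K)%N ->
  \sum_(j < k.+1) ((x + 1) ^+ 2 * acoef (x + 1) j - x ^+ 2 * acoef (x - 1) j) * cbin j
  = (2 * k%:R + 1) * (2 * x + 1) * acoef x k * cbin k.
Proof.
elim: k => [|k IHk] kK.
  by rewrite big_ord_recl big_ord0 /= !acoef0 cbin0; ring.
rewrite big_ord_recr /= IHk; last lia.
rewrite acoef_shift_up // acoef_shift_down // acoefS cbinS // -!(nat1r k).
have n1 := natS_neq0 kK; have K0 : (0 < K)%N by lia.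
have two0 := two_neq0 K0.
by field; rewrite n1 two0.
Qed.

(** The multipliers of the three shifts are those for which the sum telescopes; the weight 1 / (2j -
    1) is thereby traded for unweighted sums at x - 1, x and x + 1. *)
Lemma watson_contiguous x k : (k <= K)%N ->
  \sum_(j < k.+1) cbin j * (acoef x j / (2 * j%:R - 1)
      + (2 * x ^+ 2 + 2 * x + 1) * acoef x j
      + x ^+ 2 * acoef (x - 1) j + (x + 1) ^+ 2 * acoef (x + 1) j)
  = (2 * x + 1) ^+ 2 * acoef x k * cbin k.
Proof.
elim: k => [|k IHk] kK.
  rewrite big_ord_recl big_ord0 /= !acoef0 cbin0 mulr0 add0r invrN1; ring.
rewrite big_ord_recr /= IHk; last lia.
rewrite acoef_shift_up // acoef_shift_down // acoefS cbinS // -!(nat1r k).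
have n1 := natS_neq0 kK; have K0 : (0 < K)%N by lia.
have two0 := two_neq0 K0.
have n2 : 2 * (1 + k%:R) - 1 != 0 :> F.
  have -> : 2 * (1 + k%:R) - 1 = (2 * k + 1)%:R :> F by rewrite natrD natrM; ring.
  by apply: Knz; lia.
by field; rewrite n1 two0 n2.
Qed.

(** At a natural number N <= [K] this is 3F2(-N, N+1, 1/2; 1, 1; 1), a terminating case of Watson's
    summation. *)
Definition watson (x : F) : F := \sum_(j < K.+1) acoef x j * cbin j.
Definition watson1 (x : F) : F :=
  \sum_(j < K.+1) acoef x j * cbin j / (2 * j%:R - 1).

Lemma watson_rec x : (2 * x + 1) * acoef x K = 0 ->
  (x + 1) ^+ 2 * watson (x + 1) = x ^+ 2 * watson (x - 1).
Proof.
move=> xK; have := watson_telescope x (leqnn K).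
rewrite -(mulrA (_ + 1)) xK mulr0 mul0r => /eqP e; apply/eqP.
rewrite -subr_eq0 -{}[X in _ == X](eqP e); apply/eqP.
rewrite /watson !mulr_sumr -sumrB; apply: eq_bigr => j _; ring.
Qed.

Lemma watson1E x : (2 * x + 1) * acoef x K = 0 ->
  watson1 x = - ((2 * x ^+ 2 + 2 * x + 1) * watson x
      + x ^+ 2 * watson (x - 1) + (x + 1) ^+ 2 * watson (x + 1)).
Proof.
move=> xK; have := watson_contiguous x (leqnn K).
rewrite expr2 -(mulrA (_ + 1)) xK mulr0 mul0r => e.
apply/eqP; rewrite -addr_eq0 -{}[X in _ == X]e; apply/eqP.
rewrite /watson1 /watson !mulr_sumr -!big_split; apply: eq_bigr => j _ /=.
by rewrite -[_ / (_ - 1)]mulrA; ring.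
Qed.

Hypothesis K_gt0 : (0 < K)%N.
(** [M] bounds the arguments at which the boundary terms vanish. Over [rat] this is met with [K] = n
    + 1 and [M] = n, because a_(n+1)(N) = 0; over ['F_p] with [K] = [M] = n, where at N = n it is
    the factor 2n + 1 = p that vanishes. *)
Variable M : nat.
Hypothesis M_ltK : (M < 2 * K)%N.
Hypothesis aM : forall N, (N <= M)%N -> (2 * N%:R + 1) * acoef N%:R K = 0.

Lemma acoef_nat_eq0 N k : (N < k)%N -> acoef N%:R k = 0.
Proof.
move=> Nk; rewrite /acoef (bigD1 (Ordinal Nk)) //= subrr.
by rewrite oppr0 !mul0r.
Qed.

(** The recurrence has step two, so each parity is governed by its first value: W(0) = 1 here, and
    W(1) = 1 - 2 / 2 = 0 for [watson_odd]. *)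
Lemma watson_even r : (2 * r <= M.+1)%N -> watson (2 * r)%:R = cbin r ^+ 2.
Proof.
elim: r => [|r IHr] rM.
  rewrite /watson big_ord_recl big1 /= => [|i _]; first by rewrite acoef0 cbin0; ring.
  by rewrite acoef_nat_eq0 // mul0r.
have rK : (r < K)%N by lia.
have /aM/watson_rec : (2 * r + 1 <= M)%N by lia.
have -> : (2 * r + 1)%:R - 1 = (2 * r)%:R :> F by rewrite natrD addrK.
rewrite IHr; last lia.
have -> : (2 * r + 1)%:R + 1 = (2 * r.+1)%:R :> F by rewrite natr1; congr _%:R; lia.
have r0 : (2 * r.+1)%:R != 0 :> F by apply: Knz; lia.
move=> e; apply: (mulfI (expf_neq0 2 r0)); rewrite e cbinS //.
have n1 := natS_neq0 rK; have two0 := two_neq0 K_gt0.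
rewrite natrD !natrM -(nat1r r); by field; rewrite n1 two0.
Qed.

Lemma watson_odd r : (2 * r + 1 <= M.+1)%N -> watson (2 * r + 1)%:R = 0.
Proof.
elim: r => [|r IHr] rM.
  rewrite /watson big_ord_recl; case: K K_gt0 Knz => // K' _ Knz'.
  rewrite big_ord_recl big1 /= => [|i _].
    have two0 : 2%:R != 0 :> F by apply: Knz'; lia.
    rewrite acoefS !acoef0 /cbin /=.
    have -> : 'C(2 * (bump 0 0), bump 0 0) = 2%N by [].
    rewrite bin0 /bump /=; field.
    by rewrite (natrM _ 2 2) mulf_neq0 ?oner_neq0.
  by rewrite acoef_nat_eq0 // mul0r.
have /aM/watson_rec : (2 * r + 2 <= M)%N by lia.
have -> : (2 * r + 2)%:R - 1 = (2 * r + 1)%:R :> F by rewrite !natrD; ring.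
rewrite IHr ?mulr0; last lia.
have -> : (2 * r + 2)%:R + 1 = (2 * r.+1 + 1)%:R :> F by rewrite natr1; congr _%:R; lia.
have r0 : (2 * r.+1 + 1)%:R != 0 :> F by apply: Knz; lia.
by move/eqP; rewrite mulf_eq0 (negPf (expf_neq0 2 r0)) => /eqP.
Qed.

Lemma watson1_even r : (2 * r <= M)%N ->
  watson1 (2 * r)%:R = - ((4 * r%:R + 1) ^+ 2 + 1) / 2 * cbin r ^+ 2.
Proof.
move=> rM; rewrite watson1E ?aM // watson_even; last lia.
have -> : (2 * r)%:R + 1 = (2 * r + 1)%:R :> F by rewrite natrD.
rewrite watson_odd; last lia.
(* For r = 0 the neighbour is -1, to which [watson_odd] does not apply; there the prefactor
   vanishes. *)
have -> : (2 * r)%:R ^+ 2 * watson ((2 * r)%:R - 1) = 0.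
  case: r rM => [|r] rM; first by rewrite muln0 expr0n mul0r.
  have -> : (2 * r.+1)%:R - 1 = (2 * r + 1)%:R :> F.
    by rewrite (_ : 2 * r.+1 = 2 * r + 1 + 1)%N ?(natrD _ _ 1) ?addrK; last lia.
  by rewrite watson_odd ?mulr0; last lia.
have two0 := two_neq0 K_gt0.
by rewrite natrM; field.
Qed.

Lemma watson1_odd r : (2 * r + 1 <= M)%N ->
  watson1 (2 * r + 1)%:R = - 2 * (2 * r%:R + 1) ^+ 2 * cbin r ^+ 2.
Proof.
move=> rM; rewrite watson1E ?aM // watson_odd ?watson_rec ?aM //; last lia.
have -> : (2 * r + 1)%:R - 1 = (2 * r)%:R :> F by rewrite natrD addrK.
rewrite watson_even; last lia.
have -> : (2 * r + 1)%:R = 2 * r%:R + 1 :> F by rewrite natrD natrM.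
by ring.
Qed.

End Watson.

(** * Interpolation over the prime field *)

Lemma telescope_prod (R : comPzRingType) (g : nat -> R) q :
  (\prod_(i < q) g i.+1) * g 0%N = (\prod_(i < q) g i) * g q.
Proof.
have := big_ord_recl q (fun i : 'I_q.+1 => g i) : \prod_(i < q.+1) g i = _.
by rewrite big_ord_recr /= => ->; rewrite mulrC.
Qed.

Lemma size_sub_monic (R : nzRingType) (A B : {poly R}) m :
  A \is monic -> B \is monic -> size A = m.+1 -> size B = m.+1 ->
  (size (A - B)%R <= m)%N.
Proof.
move=> /monicP mA /monicP mB sA sB; apply/leq_sizeP => j mj; rewrite coefB.
move: mA mB; rewrite !lead_coefE sA sB /= => mA mB.
case: (ltngtP m j) mj => // [mj _|<- _]; last by rewrite mA mB subrr.
by rewrite !nth_default ?subrr ?sA ?sB.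
Qed.

Section RootProduct.

Variables (F : fieldType) (c : nat -> F).

Definition root_prod q : {poly F} := \prod_(i < q) ('X - (c i)%:P).

Lemma root_prod_monic q : root_prod q \is monic.
Proof. by apply: monic_prod => i _; apply: monicXsubC. Qed.

Lemma size_root_prod q : size (root_prod q) = q.+1.
Proof. by rewrite size_prod_XsubC /index_enum -enumT size_enum_ord. Qed.

Lemma root_prodE q x : (root_prod q).[x] = \prod_(i < q) (x - c i).
Proof. by rewrite horner_prod; apply: eq_bigr => i _; rewrite !hornerE. Qed.

Lemma root_prod_eq0 q i : (i < q)%N -> (root_prod q).[c i] = 0.
Proof.
by move=> iq; rewrite root_prodE (bigD1 (Ordinal iq)) //= subrr mul0r.
Qed.

(** Logarithmic derivative at 0. *)
Lemma deriv_root_prod0 q : (forall i, (i < q)%N -> c i != 0) ->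
  (root_prod q)^`().[0] = - (root_prod q).[0] * \sum_(i < q) (c i)^-1.
Proof.
elim: q => [|q IHq] c0.
  by rewrite /root_prod !big_ord0 derivC hornerC mulr0.
rewrite /root_prod big_ord_recr /= -/(root_prod q) derivM derivXsubC big_ord_recr /=.
rewrite !hornerE IHq => [|i iq]; last by rewrite c0 // ltnW.
by field; rewrite c0.
Qed.

End RootProduct.

Section Interpolation.

Variables (F : fieldType) (n : nat).
Hypothesis nz : forall i, (0 < i <= 2 * n)%N -> i%:R != 0 :> F.
Hypothesis n_gt0 : (0 < n)%N.
Hypothesis pF0 : 2 * n%:R + 1 = 0 :> F.
Hypothesis wilson : ((2 * n)`!)%:R = -1 :> F.
Hypothesis fermat2 : (2%:R ^+ n) ^+ 2 = 1 :> F.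

Local Notation b := (cbin F).
Local Notation two_nz := (two_neq0 nz n_gt0).

(* Chosen so that its value at (2 x + 1)^2 is [acoef x k]. *)
Definition trunc_fact (k : nat) : {poly F} :=
  \prod_(j < k) ((4 * j.+1%:R ^+ 2)^-1 *: (((2 * j%:R + 1) ^+ 2)%:P - 'X)).

Definition trunc_poly : {poly F} :=
  \sum_(k < n.+1) (b k / (2 * k%:R - 1)) *: trunc_fact k.

Lemma trunc_factS k : trunc_fact k.+1 =
  trunc_fact k * ((4 * k.+1%:R ^+ 2)^-1 *: (((2 * k%:R + 1) ^+ 2)%:P - 'X)).
Proof. by rewrite /trunc_fact big_ord_recr. Qed.

Lemma four_nz : 4%:R != 0 :> F.
Proof. by rewrite (natrM _ 2 2) mulf_neq0 ?two_nz. Qed.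

(** Because (2x + 1)^2 - (2j + 1)^2 = 4 (x - j) (x + j + 1). *)
Lemma trunc_factE x k : (k <= n)%N -> (trunc_fact k).[(2 * x + 1) ^+ 2] = acoef x k.
Proof.
elim: k => [|k IHk] kn; first by rewrite acoef0 /trunc_fact big_ord0 hornerC.
rewrite trunc_factS acoefS hornerM IHk; last lia.
rewrite !hornerE -!(nat1r k) /=.
by have := natS_neq0 nz kn => k0; have := four_nz => f0; field; rewrite k0 f0.
Qed.

Lemma trunc_polyE x : trunc_poly.[(2 * x + 1) ^+ 2] = watson1 n x.
Proof.
rewrite /trunc_poly horner_sum; apply: eq_bigr => k _.
by rewrite hornerZ trunc_factE -1?ltnS //; ring.
Qed.

(** The factors at 0 are the squares of (2j + 1) / (2j + 2), the ratio of consecutive b_j. *)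
Lemma trunc_fact0 k : (k <= n)%N -> (trunc_fact k).[0] = b k ^+ 2.
Proof.
elim: k => [|k IHk] kn; first by rewrite cbin0 expr1n /trunc_fact big_ord0 hornerC.
rewrite trunc_factS hornerM IHk ?(cbinS nz) //; last lia.
rewrite !hornerE -!(nat1r k) /=.
have k0 := natS_neq0 nz kn; have f0 := four_nz; have t0 := two_nz.
by field; rewrite k0 f0 t0.
Qed.

Lemma odd_nz k : (k < n)%N -> 2 * k%:R + 1 != 0 :> F.
Proof. by move=> kn; rewrite -natrM natr1; apply: nz; lia. Qed.

Lemma deriv_trunc_fact0 k : (k <= n)%N -> (trunc_fact k)^`().[0] =
  - b k ^+ 2 * \sum_(j < k) (2 * j%:R + 1) ^- 2.
Proof.
elim: k => [|k IHk] kn.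
  by rewrite /trunc_fact !big_ord0 derivC hornerC mulr0.
rewrite trunc_factS derivM hornerD !hornerM IHk ?trunc_fact0 ?(cbinS nz) //; try lia.
rewrite derivZ derivB derivC derivX big_ord_recr /= !hornerE -!(nat1r k) /=.
have k0 := natS_neq0 nz kn; have f0 := four_nz; have t0 := two_nz.
by have o0 := odd_nz kn; field; rewrite k0 f0 t0 o0.
Qed.

(** Over [rat] this is the coefficient of p^2 when the a_k(n) in W(n) are expanded; over ['F_p] it
    is a derivative that interpolation can compute. *)
Definition dsum : F :=
  - \sum_(k < n.+1) b k ^+ 3 / (2 * k%:R - 1) * \sum_(j < k) (2 * j%:R + 1) ^- 2.

Lemma deriv_trunc_poly0 : trunc_poly^`().[0] = dsum.
Proof.
rewrite /trunc_poly raddf_sum horner_sum /dsum -sumrN; apply: eq_bigr => k _.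
rewrite /= derivZ hornerZ deriv_trunc_fact0 -1?ltnS //.
by ring.
Qed.

Lemma size_trunc_fact k : (size (trunc_fact k) <= k.+1)%N.
Proof.
elim: k => [|k IHk]; first by rewrite /trunc_fact big_ord0 size_poly1.
rewrite trunc_factS; apply: leq_trans (size_polyMleq _ _) _.
set A := size (trunc_fact k) in IHk *.
have : (size ((4 * k.+1%:R ^+ 2)^-1 *: (((2 * k%:R + 1) ^+ 2)%:P - 'X : {poly F}))%R <= 2)%N.
  apply: leq_trans (size_scale_leq _ _) _.
  apply: leq_trans (size_polyD _ _) _.
  by rewrite size_polyN size_polyX geq_max size_polyC; case: (_ != 0).
by move: (size _) => B; lia.
Qed.

Lemma size_trunc_poly : (size trunc_poly <= n.+1)%N.
Proof.
apply: leq_trans (size_sum _ _ _) _; apply/bigmax_leqP => k _.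
apply: leq_trans (size_scale_leq _ _) _.
by apply: leq_trans (size_trunc_fact _) _; rewrite ltnS -ltnS.
Qed.

Definition node (N : nat) : F := (2 * N%:R + 1) ^+ 2.

(** The difference of two nodes is 4 (N - N') (N + N' + 1), and both brackets lie between 1 and 2n
    when N' < N <= n. *)
Lemma node_uniq : uniq [seq node N | N <- iota 0 n.+1].
Proof.
rewrite map_inj_in_uniq ?iota_uniq // => N N'; rewrite !mem_iota !add0n => lN lN'.
wlog : N N' lN lN' / (N' <= N)%N => [hw e|leN e].
  by have [/hw->|/ltnW/hw->] := leqP N' N.
apply/eqP; rewrite eqn_leq leN andbT leqNgt; apply/negP => ltN.
have : (4 * ((N - N') * (N + N' + 1)))%:R == 0 :> F.
  rewrite !natrM natrB // !natrD; apply/eqP.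
  by transitivity (node N - node N'); [rewrite /node; ring|rewrite e subrr].
apply/negP; rewrite !natrM !mulf_neq0 ?four_nz //; apply: nz; lia.
Qed.

Lemma interpolation (A : {poly F}) : (size A <= n.+1)%N ->
  (forall N, (N <= n)%N -> A.[node N] = watson1 n N%:R) -> A^`().[0] = dsum.
Proof.
move=> sA hA; rewrite -deriv_trunc_poly0; congr (_^`().[0]).
apply/eqP; rewrite -subr_eq0; apply: contraT => nz0.
have sB : (size (A - trunc_poly)%R <= n.+1)%N.
  by apply: leq_trans (size_polyD _ _) _; rewrite size_polyN geq_max sA size_trunc_poly.
have := max_poly_roots nz0 _ node_uniq; rewrite size_map size_iota ltnNge sB.
apply; apply/allP => x /mapP [N]; rewrite mem_iota add0n => lN ->.
rewrite /root !hornerE hA -1?ltnS //.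
by rewrite /node trunc_polyE subrr.
Qed.

Lemma acoef_last N : (N <= n)%N -> (2 * N%:R + 1) * acoef N%:R n = 0 :> F.
Proof.
rewrite leq_eqVlt => /orP [/eqP ->|Nn]; first by rewrite pF0 mul0r.
by rewrite acoef_nat_eq0 ?mulr0.
Qed.

Lemma half_fact_sqr : (n`!%:R) ^+ 2 = - (-1) ^+ n :> F.
Proof.
have e : ((2 * n)`!)%:R = (-1) ^+ n * n`!%:R ^+ 2 :> F.
  rewrite mul2n -addnn.
  (* Modulo p = 2n + 1 the factor n + j is -(n + 1 - j); exchanging them one at a time folds the
     upper half of (2n)! onto the lower half. *)
  have gen m : (m <= n)%N -> ((n + m)`!)%:R * (n - m)`!%:R = (-1) ^+ m * n`!%:R ^+ 2 :> F.
    elim: m => [|m IHm] mn; first by rewrite addn0 subn0; ring.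
    have := IHm (ltnW mn); rewrite (_ : n - m = (n - m.+1).+1)%N; last lia.
    rewrite addnS !factS !natrM (exprS _ m) -mulrA => IH.
    rewrite -(mulrA (-1)) -IH.
    have -> : (n + m).+1%:R = - (n - m.+1).+1%:R :> F.
      apply/eqP; rewrite -addr_eq0 -natrD.
      by rewrite (_ : ((n + m).+1 + _)%N = (2 * n).+1) ?mulrSr ?natrM ?pF0 //; lia.
    by ring.
  by rewrite -(gen n (leqnn n)) subnn fact0 mulr1.
have s1 : (-1) ^+ n * (-1) ^+ n = 1 :> F by rewrite -expr2 sqrr_sign.
move: wilson; rewrite e => e'.
transitivity ((-1) ^+ n * ((-1) ^+ n * n`!%:R ^+ 2) : F); first by rewrite mulrA s1 mul1r.
by rewrite e' mulrN1.
Qed.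

Lemma even_prod m : \prod_(i < m) ((4 * i%:R + 2) * (4 * i%:R + 4)) =
  2 ^+ (2 * m) * ((2 * m)`!)%:R :> F.
Proof.
elim: m => [|m IHm]; first by rewrite big_ord0 muln0 mul1r.
rewrite big_ord_recr /= IHm (_ : 2 * m.+1 = (2 * m).+2)%N; last lia.
rewrite !factS !exprS !natrM -!(nat1r (_.+1)) -!(nat1r (2 * m)) natrM; ring.
Qed.

(** Square the identity (2n)! = 2^n n! (1 3 5 ... (2n-1)) and insert Wilson, Fermat and
    [half_fact_sqr]. *)
Lemma odd_prod_sqr : (\prod_(i < n) (2 * i%:R + 1)) ^+ 2 = - (-1) ^+ n :> F.
Proof.
have gen m : (\prod_(i < m) (2 * i%:R + 1)) * (2 ^+ m * m`!%:R) = ((2 * m)`!)%:R :> F.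
  elim: m => [|m IHm]; first by rewrite big_ord0 !mul1r.
  rewrite big_ord_recr /= (_ : 2 * m.+1 = (2 * m).+2)%N; last lia.
  rewrite !factS !exprS !natrM -IHm -!(nat1r (_.+1)) -!(nat1r (2 * m)) -!(nat1r m) natrM; ring.
have /(congr1 (fun x => x ^+ 2)) := gen n.
rewrite wilson !exprMn fermat2 mul1r half_fact_sqr => e.
have s1 : (-1) ^+ n * (-1) ^+ n = 1 :> F by rewrite -expr2 sqrr_sign.
move: e; set x := (\prod_(i < n) _) ^+ 2 => e.
transitivity ((-1) ^+ n * (-1) ^+ n * x); first by rewrite s1 mul1r.
by transitivity (- (-1) ^+ n * (x * - (-1) ^+ n)); [ring|rewrite e; ring].
Qed.

(** Subtracting it from a monic polynomial of degree n + 1 keeps the values at the nodes and lowers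
    the degree to n, as [interpolation] requires. *)
Definition nodes_poly : {poly F} := root_prod node n.+1.

Lemma deriv_nodes_poly0 : nodes_poly^`().[0] = -1.
Proof.
rewrite /nodes_poly /root_prod big_ord_recr /= -/(root_prod node n).
(* The last node is p^2 = 0, so only the product over the other nodes survives in the derivative. *)
rewrite derivM derivXsubC !hornerE /= /node pF0 expr0n oppr0 mulr0 add0r.
rewrite root_prodE.
transitivity ((-1) ^+ n * (\prod_(i < n) (2 * i%:R + 1)) ^+ 2 : F).
  rewrite -prodrXl -[in (-1) ^+ n](card_ord n) -prodr_const -big_split /=.
  by apply: eq_bigr => i _; rewrite sub0r mulN1r.
by rewrite odd_prod_sqr mulrN -expr2 sqrr_sign.
Qed.

Definition c1 (i : nat) : F := (4 * i%:R + 1) ^+ 2.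
Definition c3 (i : nat) : F := (4 * i%:R + 3) ^+ 2.

(** Each difference (4r + 1)^2 - (4i + 3)^2 splits into two linear factors running through
    progressions of step 4; r -> r + 1 shifts both by one place, so only end factors change. The
    cross-multiplied form avoids dividing by them. *)
Lemma c3_prod_shift q r :
  (root_prod c3 q).[c1 r.+1] * ((4 * r%:R + 2 - 4 * q%:R) * (4 * r%:R + 4)) =
  (root_prod c3 q).[c1 r] * ((4 * r%:R + 2) * (4 * r%:R + 4 + 4 * q%:R)).
Proof.
have e1 := telescope_prod (fun i => 4 * r%:R + 2 - 4 * i%:R : F) q.
have e2 := telescope_prod (fun i => 4 * r%:R + 4 + 4 * i%:R : F) q.
rewrite !root_prodE.
have E1 : \prod_(i < q) (c1 r - c3 i) =
  (\prod_(i < q) (4 * r%:R + 2 - 4 * i.+1%:R)) * (\prod_(i < q) (4 * r%:R + 4 + 4 * i%:R)).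
  by rewrite -big_split; apply: eq_bigr => i _; rewrite /c1 /c3 -(nat1r i) /=; ring.
have E2 : \prod_(i < q) (c1 r.+1 - c3 i) =
  (\prod_(i < q) (4 * r%:R + 2 - 4 * i%:R)) * (\prod_(i < q) (4 * r%:R + 4 + 4 * i.+1%:R)).
  by rewrite -big_split; apply: eq_bigr => i _; rewrite /c1 /c3 -(nat1r i) -(nat1r r) /=; ring.
rewrite E1 E2; move: e1 e2; rewrite mulr0 subr0 addr0.
set A := \prod_(i < q) _; set B := \prod_(i < q) _; set C := \prod_(i < q) _.
set D := \prod_(i < q) _ => e1 e2.
transitivity ((B * (4 * r%:R + 2 - 4 * q%:R)) * (C * (4 * r%:R + 4))); first by ring.
by rewrite -e1 e2; ring.
Qed.

Lemma c1_prod_shift q r :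
  (root_prod c1 q).[c3 r.+1] * ((4 * r%:R + 6 - 4 * q%:R) * (4 * r%:R + 4)) =
  (root_prod c1 q).[c3 r] * ((4 * r%:R + 6) * (4 * r%:R + 4 + 4 * q%:R)).
Proof.
have e1 := telescope_prod (fun i => 4 * r%:R + 6 - 4 * i%:R : F) q.
have e2 := telescope_prod (fun i => 4 * r%:R + 4 + 4 * i%:R : F) q.
rewrite !root_prodE.
have E1 : \prod_(i < q) (c3 r - c1 i) =
  (\prod_(i < q) (4 * r%:R + 6 - 4 * i.+1%:R)) * (\prod_(i < q) (4 * r%:R + 4 + 4 * i%:R)).
  by rewrite -big_split; apply: eq_bigr => i _; rewrite /c1 /c3 -(nat1r i) /=; ring.
have E2 : \prod_(i < q) (c3 r.+1 - c1 i) =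
  (\prod_(i < q) (4 * r%:R + 6 - 4 * i%:R)) * (\prod_(i < q) (4 * r%:R + 4 + 4 * i.+1%:R)).
  by rewrite -big_split; apply: eq_bigr => i _; rewrite /c1 /c3 -(nat1r i) -(nat1r r) /=; ring.
rewrite E1 E2; move: e1 e2; rewrite mulr0 subr0 addr0.
set A := \prod_(i < q) _; set B := \prod_(i < q) _; set C := \prod_(i < q) _.
set D := \prod_(i < q) _ => e1 e2.
transitivity ((B * (4 * r%:R + 6 - 4 * q%:R)) * (C * (4 * r%:R + 4))); first by ring.
by rewrite -e1 e2; ring.
Qed.

Lemma c3_prod_base q :
  (root_prod c3 q).[c1 0] = (-1) ^+ q * (2 ^+ (2 * q) * ((2 * q)`!)%:R).
Proof.
rewrite -even_prod root_prodE -[in (-1) ^+ q](card_ord q) -prodr_const -big_split /=.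
by apply: eq_bigr => i _; rewrite /c1 /c3; ring.
Qed.

Lemma c1_prod_base q : (root_prod c1 q).[c3 0] * (4 * q%:R - 2) =
  - 2 * (-1) ^+ q * (2 ^+ (2 * q) * ((2 * q)`!)%:R).
Proof.
have e1 := telescope_prod (fun i => 4 * i%:R - 2 : F) q.
rewrite root_prodE -even_prod big_split /=.
have E1 : \prod_(i < q) (c3 0 - c1 i) = (-1) ^+ q *
  ((\prod_(i < q) (4 * i%:R - 2)) * (\prod_(i < q) (4 * i%:R + 4))).
  rewrite -[in (-1) ^+ q](card_ord q) -prodr_const -!big_split /=.
  by apply: eq_bigr => i _; rewrite /c1 /c3; ring.
have E2 : \prod_(i < q) (4 * i%:R + 2 : F) = \prod_(i < q) (4 * i.+1%:R - 2).
  by apply: eq_bigr => i _; rewrite -(nat1r i); ring.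
rewrite E1 E2; move: e1; rewrite mulr0 sub0r.
set A := \prod_(i < q) _; set B := \prod_(i < q) _; set C := \prod_(i < q) _ => e1.
transitivity ((-1) ^+ q * C * (B * (4 * q%:R - 2))); first by ring.
by rewrite -e1; ring.
Qed.

Lemma node_even r : node (2 * r) = c1 r.
Proof. by rewrite /node /c1 natrM; ring. Qed.

Lemma node_odd r : node (2 * r + 1) = c3 r.
Proof. by rewrite /node /c3 natrD natrM; ring. Qed.

Lemma prod_pairs (g : nat -> F) m :
  \prod_(i < 2 * m) g i = \prod_(i < m) (g (2 * i)%N * g (2 * i + 1)%N).
Proof.
elim: m => [|m IHm]; first by rewrite muln0 !big_ord0.
rewrite (_ : 2 * m.+1 = (2 * m).+2)%N; last lia.
by rewrite !big_ord_recr /= IHm addn1 mulrA.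
Qed.

Lemma prod_node : \prod_(i < n) node i = - (-1) ^+ n.
Proof. by rewrite prodrXl odd_prod_sqr. Qed.

Lemma c31_prod0 q : (root_prod c3 q).[0] * (root_prod c1 q).[0] =
  \prod_(i < 2 * q) node i.
Proof.
rewrite !root_prodE prod_pairs -big_split; apply: eq_bigr => i _ /=.
by rewrite node_even node_odd; ring.
Qed.

Lemma interpolant_eq0 N : (N <= n)%N -> nodes_poly.[node N] = 0.
Proof. by move=> Nn; apply: root_prod_eq0. Qed.

Lemma watson1_trunc_even r : (2 * r <= n)%N ->
  watson1 n (2 * r)%:R = - (c1 r + 1) / 2 * b r ^+ 2.
Proof. by move=> rn; apply: (watson1_even nz n_gt0 (M := n)); [lia|exact: acoef_last|]. Qed.

Lemma watson1_trunc_odd r : (2 * r + 1 <= n)%N ->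
  watson1 n (2 * r + 1)%:R = - 2 * (2 * r%:R + 1) ^+ 2 * b r ^+ 2.
Proof. by move=> rn; apply: (watson1_odd nz n_gt0 (M := n)); [lia|exact: acoef_last|]. Qed.

(** * The explicit interpolant for p = 4q + 1 *)

Section Even.

Variable q : nat.
Hypothesis nE : n = (2 * q)%N.

Lemma q4_even : 4 * q%:R = -1 :> F.
Proof. by apply/eqP; rewrite -addr_eq0 -pF0 nE natrM; apply/eqP; ring. Qed.

(** With 4q = -1 the end factors 4r + 3 cancel and the ratio of consecutive values is (4r + 2) / (4r
    + 4), that of the b_r. This is why the square of this polynomial interpolates the b_r^2 of the
    even nodes. *)
Lemma c3_prod_even r : (r <= q)%N ->
  (root_prod c3 q).[c1 r] = (root_prod c3 q).[c1 0] * b r.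
Proof.
elim: r => [|r IHr] rq; first by rewrite cbin0 mulr1.
have := c3_prod_shift q r; rewrite (IHr (ltnW rq)) q4_even (cbinS nz); last lia.
have r0 : 1 + r%:R != 0 :> F by apply: (natS_neq0 nz); lia.
have r3 : 4 * r%:R + 3 != 0 :> F by rewrite -natrM -natrD; apply: nz; lia.
have := four_nz; have := two_nz => t0 f0 e.
apply: (mulIf (mulf_neq0 r3 (mulf_neq0 f0 r0))).
transitivity ((root_prod c3 q).[c1 r.+1] * ((4 * r%:R + 2 - -1) * (4 * r%:R + 4))); first by ring.
by rewrite e; field; rewrite r0 t0.
Qed.

Lemma c1_prod_even r : (r < q)%N -> (4 * r%:R + 3) * (root_prod c1 q).[c3 r] =
  3 * (root_prod c1 q).[c3 0] * (2 * r%:R + 1) * b r.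
Proof.
elim: r => [|r IHr] rq; first by rewrite cbin0; ring.
have := c1_prod_shift q r; rewrite q4_even (cbinS nz); last lia.
have r0 : 1 + r%:R != 0 :> F by apply: (natS_neq0 nz); lia.
have := four_nz; have := two_nz => t0 f0 e.
apply: (mulIf (mulf_neq0 f0 r0)).
transitivity ((root_prod c1 q).[c3 r.+1] * ((4 * r%:R + 6 - -1) * (4 * r%:R + 4))).
  by rewrite -(nat1r r); ring.
rewrite e; transitivity (((4 * r%:R + 3) * (root_prod c1 q).[c3 r]) * (4 * r%:R + 6)); first by ring.
by rewrite (IHr (ltnW rq)) -(nat1r r); field; rewrite r0 t0.
Qed.

Lemma pow_fact_sqr_even : (2 ^+ (2 * q) * ((2 * q)`!)%:R) ^+ 2 = -1 :> F.
Proof.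
by rewrite -nE exprMn fermat2 half_fact_sqr nE exprM sqrrN !expr1n mul1r.
Qed.

Lemma dsum_even : dsum = - (1 / 2) * b q ^+ 2 * (1 - 2 * \sum_(i < q) (c3 i)^-1)
  - 1 / (2 * b q ^+ 2) + 1.
Proof.
have t0 := two_nz.
set X := root_prod c3 q; set Y := root_prod c1 q.
have sgn : ((-1) ^+ q) ^+ 2 = 1 :> F by rewrite exprAC sqrrN !expr1n.
have X1 : X.[c1 0] ^+ 2 = -1.
  by rewrite c3_prod_base exprMn sgn mul1r pow_fact_sqr_even.
have Y1 : (3 * Y.[c3 0]) ^+ 2 = - 4.
  have := c1_prod_base q; rewrite q4_even -/Y => /(congr1 (fun x => x ^+ 2)).
  rewrite !exprMn sgn -!exprMn pow_fact_sqr_even => e.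
  by transitivity ((Y.[c3 0] * (-1 - 2)) ^+ 2); [ring|rewrite e; ring].
(* The last node has even index, so the value of X at 0 is a value at a node; that of Y then follows
   from the product of all nonzero nodes. *)
have c1q : c1 q = 0 by rewrite /c1 q4_even addNr expr0n.
have X0 : X.[0] ^+ 2 = - b q ^+ 2.
  by rewrite -c1q c3_prod_even // exprMn X1 mulN1r.
have XY : (X.[0] * Y.[0]) ^+ 2 = 1.
  by rewrite c31_prod0 -nE prod_node nE exprM sqrrN !expr1n sqrrN expr1n.
have b0 : b q != 0.
  apply/eqP => b0; move: XY; rewrite exprMn X0 b0 expr0n oppr0 mul0r => /eqP.
  by rewrite eq_sym oner_eq0.
have Y0 : Y.[0] ^+ 2 = - (b q ^+ 2)^-1.
  have bb0 : - b q ^+ 2 != 0 by rewrite oppr_eq0 expf_neq0.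
  by apply: (mulfI bb0); rewrite -X0 -exprMn XY X0; field.
(* Y vanishes at the even nodes c1 r with r < q, and its coefficient 'X at the remaining one; X
   vanishes at the odd nodes. So each summand matches W on one parity and is 0 on the other. Both
   products are monic of degree n + 1. *)
pose A := 2^-1 *: (((('X + 1%:P) * X ^+ 2) - nodes_poly) + ('X * Y ^+ 2 - nodes_poly)).
rewrite -(interpolation (A := A)); last 2 first.
- rewrite /A; apply: leq_trans (size_scale_leq _ _) _.
  apply: leq_trans (size_polyD _ _) _; rewrite geq_max; apply/andP.
  have sM := size_root_prod node n.+1.
  have mX : 'X + 1%:P \is @monic F.
    by rewrite -[1%:P]opprK -polyCN; apply: monicXsubC.
  have sX : size ('X + 1%:P : {poly F}) = 2%N.
    by rewrite -[1%:P]opprK -polyCN size_XsubC.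
  split; apply: size_sub_monic => //; try exact: root_prod_monic.
  + by rewrite monicMl // monic_exp // root_prod_monic.
  + rewrite size_monicM // ?monic_neq0 ?monic_exp ?root_prod_monic // sX.
    by rewrite expr2 size_monicM ?monic_neq0 ?root_prod_monic // !size_root_prod; lia.
  + by rewrite monicMl ?monicX // monic_exp // root_prod_monic.
  + rewrite size_monicM ?monicX // ?monic_neq0 ?monic_exp ?root_prod_monic // size_polyX.
    by rewrite expr2 size_monicM ?monic_neq0 ?root_prod_monic // !size_root_prod; lia.
- move=> N Nn.
  have AE u : nodes_poly.[u] = 0 ->
    A.[u] = 2^-1 * ((u + 1) * X.[u] ^+ 2 + u * Y.[u] ^+ 2).
    by move=> Mu; rewrite /A !hornerE Mu /=; ring.
  rewrite {}AE ?interpolant_eq0 //.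
  have [r [Nr|Nr]] : exists r, (N = 2 * r \/ N = 2 * r + 1)%N.
    by exists (N %/ 2)%N; lia.
  + rewrite Nr node_even watson1_trunc_even; last lia.
    have -> : X.[c1 r] ^+ 2 = - b r ^+ 2.
      by rewrite c3_prod_even ?(exprMn 2 X.[c1 0]) ?X1 ?mulN1r //; lia.
    have [rq|rq] := ltnP r q.
      by rewrite (root_prod_eq0 _ rq) expr0n mulr0 addr0; field.
    have -> : r = q by lia.
    by rewrite c1q; field.
  + rewrite Nr node_odd watson1_trunc_odd; last lia.
    have rq : (r < q)%N by lia.
    rewrite (root_prod_eq0 _ rq) expr0n mulr0 add0r.
    transitivity (2^-1 * ((4 * r%:R + 3) * Y.[c3 r]) ^+ 2); first by rewrite /c3; ring.
    rewrite (c1_prod_even rq) -/Y.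
    transitivity (2^-1 * ((3 * Y.[c3 0]) ^+ 2 * (2 * r%:R + 1) ^+ 2 * b r ^+ 2)); first by ring.
    by rewrite Y1; field.
set S := \sum_(i < q) _.
(* The final 2 comes from the two subtracted copies of [nodes_poly], each with derivative -1 at
   0. *)
have -> : A^`().[0] = 2^-1 * (X.[0] ^+ 2 * (1 - 2 * S) + Y.[0] ^+ 2 + 2).
  rewrite /A derivZ derivD !derivB !derivM derivD derivX derivC.
  rewrite !hornerE deriv_nodes_poly0 (@deriv_root_prod0 F c3) => [|i iq].
    by rewrite -/X -/S /=; ring.
  by rewrite expf_neq0 // -natrM -natrD nz //; lia.
by rewrite X0 Y0; field; rewrite b0 t0.
Qed.

End Even.

(** * The explicit interpolant for p = 4q + 3 *)

Section Odd.

Variable q : nat.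
Hypothesis nE : n = (2 * q + 1)%N.

Lemma q4_odd : 4 * q%:R = -3 :> F.
Proof. by apply/eqP; rewrite -addr_eq0 -pF0 nE natrD natrM; apply/eqP; ring. Qed.

Lemma q4S_odd : 4 * q.+1%:R = 1 :> F.
Proof. by rewrite -(nat1r q) mulrDr q4_odd; ring. Qed.

Lemma c3_prod_odd r : (r <= q)%N -> (4 * r%:R + 1) * (root_prod c3 q).[c1 r] =
  (root_prod c3 q).[c1 0] * b r.
Proof.
elim: r => [|r IHr] rq; first by rewrite cbin0; ring.
have := c3_prod_shift q r; rewrite q4_odd (cbinS nz); last lia.
have r0 : 1 + r%:R != 0 :> F by apply: (natS_neq0 nz); lia.
have := four_nz; have := two_nz => t0 f0 e.
apply: (mulIf (mulf_neq0 f0 r0)).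
transitivity ((root_prod c3 q).[c1 r.+1] * ((4 * r%:R + 2 - -3) * (4 * r%:R + 4))).
  by rewrite -(nat1r r); ring.
rewrite e; transitivity (((4 * r%:R + 1) * (root_prod c3 q).[c1 r]) * (4 * r%:R + 2)); first by ring.
by rewrite (IHr (ltnW rq)); field; rewrite r0 t0.
Qed.

Lemma c1_prod_odd r : (r <= q)%N -> (root_prod c1 q.+1).[c3 r] =
  (root_prod c1 q.+1).[c3 0] * (2 * r%:R + 1) * b r.
Proof.
elim: r => [|r IHr] rq; first by rewrite cbin0; ring.
have := c1_prod_shift q.+1 r; rewrite q4S_odd (cbinS nz); last lia.
have r0 : 1 + r%:R != 0 :> F by apply: (natS_neq0 nz); lia.
have r5 : 4 * r%:R + 5 != 0 :> F by rewrite -natrM -natrD; apply: nz; lia.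
have := four_nz; have := two_nz => t0 f0 e.
apply: (mulIf (mulf_neq0 r5 (mulf_neq0 f0 r0))).
transitivity ((root_prod c1 q.+1).[c3 r.+1] * ((4 * r%:R + 6 - 1) * (4 * r%:R + 4))); first by ring.
rewrite e (IHr (ltnW rq)) -(nat1r r).
by field; rewrite r0 t0.
Qed.

Lemma dsum_odd : dsum = - 1 / (2 * b q ^+ 2)
  + b q ^+ 2 * \sum_(i < q.+1) (c1 i)^-1 - 1.
Proof.
have t0 := two_nz.
set X := root_prod c3 q; set Y := root_prod c1 q.+1.
have sgn m : ((-1) ^+ m) ^+ 2 = 1 :> F by rewrite exprAC sqrrN !expr1n.
have half : 2 * (2 * q%:R + 1) = -1 :> F.
  by transitivity (4 * q%:R + 2 : F); [ring|rewrite q4_odd; ring].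
have fact_n : (2 ^+ n * (n`!)%:R) ^+ 2 = 1 :> F.
  rewrite exprMn fermat2 half_fact_sqr nE addn1 (exprS _ (2 * q)) exprM sqrrN !expr1n; ring.
have X1 : X.[c1 0] ^+ 2 = 1.
  rewrite c3_prod_base exprMn sgn mul1r -[RHS]fact_n nE addn1 factS (exprS _ (2 * q)) natrM -(nat1r (2 * q)) natrM.
  transitivity ((2 * (2 * q%:R + 1)) ^+ 2 * (2 ^+ (2 * q) * ((2 * q)`!)%:R) ^+ 2 : F).
    by rewrite half; ring.
  by ring.
have Y1 : Y.[c3 0] ^+ 2 = 4.
  have := c1_prod_base q.+1; rewrite q4S_odd -/Y => /(congr1 (fun x => x ^+ 2)).
  rewrite (_ : 2 * q.+1 = n.+1)%N; last lia.
  rewrite factS (exprS _ n) natrM => e.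
  transitivity ((Y.[c3 0] * (1 - 2)) ^+ 2); first by ring.
  rewrite e; transitivity (4 * ((-1) ^+ q.+1) ^+ 2 * (2 * n.+1%:R) ^+ 2 * (2 ^+ n * n`!%:R) ^+ 2 : F).
    by ring.
  rewrite sgn fact_n -(nat1r n) nE natrD natrM.
  transitivity (4 * (2 + 2 * (2 * q%:R + 1)) ^+ 2 : F); first by ring.
  by rewrite half; ring.
have c3q : c3 q = 0 by rewrite /c3 q4_odd addNr expr0n.
have Y0 : Y.[0] ^+ 2 = b q ^+ 2.
  rewrite -c3q c1_prod_odd //.
  transitivity (Y.[c3 0] ^+ 2 * (2 * q%:R + 1) ^+ 2 * b q ^+ 2); first by ring.
  rewrite Y1; transitivity ((2 * (2 * q%:R + 1)) ^+ 2 * b q ^+ 2); first by ring.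
  by rewrite half; ring.
have XY : (X.[0] * Y.[0]) ^+ 2 = 1.
  rewrite /Y /root_prod big_ord_recr /= -/(root_prod c1 q) hornerM mulrA c31_prod0 !hornerE /= ?sub0r ?add0r.
  rewrite -node_even mulrN sqrrN.
  have -> : \prod_(i < 2 * q) node i * node (2 * q) = \prod_(i < n) node i.
    by rewrite nE addn1 big_ord_recr.
  by rewrite prod_node sqrrN sgn.
have b0 : b q != 0.
  apply/eqP => b0; move: XY; rewrite exprMn Y0 b0 expr0n mulr0 => /eqP.
  by rewrite eq_sym oner_eq0.
have X0 : X.[0] ^+ 2 = (b q ^+ 2)^-1.
  have bb0 : b q ^+ 2 != 0 by rewrite expf_neq0.
  by apply: (mulIf bb0); rewrite -Y0 -exprMn XY Y0 mulVf.
(* Now 0 is the odd node c3 q, so the extra factor 'X accompanies X, whose roots omit c3 q, while Y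
   vanishes at every even node. *)
pose A := - 2^-1 *: ((('X + 1%:P) * ('X * X ^+ 2) - nodes_poly) + (Y ^+ 2 - nodes_poly)).
rewrite -(interpolation (A := A)); last 2 first.
- rewrite /A; apply: leq_trans (size_scale_leq _ _) _.
  apply: leq_trans (size_polyD _ _) _; rewrite geq_max; apply/andP.
  have sM := size_root_prod node n.+1.
  have mX : 'X + 1%:P \is @monic F.
    by rewrite -[1%:P]opprK -polyCN; apply: monicXsubC.
  have sX : size ('X + 1%:P : {poly F}) = 2%N.
    by rewrite -[1%:P]opprK -polyCN size_XsubC.
  have mX2 : X ^+ 2 \is monic by rewrite monic_exp // root_prod_monic.
  have mY2 : Y ^+ 2 \is monic by rewrite monic_exp // root_prod_monic.
  have mXX2 : 'X * X ^+ 2 \is monic by rewrite monicMl ?monicX.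
  split; apply: size_sub_monic => //; try exact: root_prod_monic.
  + by rewrite monicMl.
  + rewrite size_monicM ?monic_neq0 // sX size_monicM ?monicX ?monic_neq0 // size_polyX.
    by rewrite expr2 size_monicM ?monic_neq0 ?root_prod_monic // !size_root_prod; lia.
  + by rewrite expr2 size_monicM ?monic_neq0 ?root_prod_monic // !size_root_prod; lia.
- move=> N Nn.
  have AE u : nodes_poly.[u] = 0 ->
    A.[u] = - 2^-1 * ((u + 1) * (u * X.[u] ^+ 2) + Y.[u] ^+ 2).
    by move=> Mu; rewrite /A !hornerE Mu /=; ring.
  rewrite {}AE ?interpolant_eq0 //.
  have [r [Nr|Nr]] : exists r, (N = 2 * r \/ N = 2 * r + 1)%N.
    by exists (N %/ 2)%N; lia.
  + rewrite Nr node_even watson1_trunc_even; last lia.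
    have rq : (r <= q)%N by lia.
    transitivity (- 2^-1 * ((c1 r + 1) * ((4 * r%:R + 1) * X.[c1 r]) ^+ 2 + Y.[c1 r] ^+ 2)).
      by rewrite /c1; ring.
    rewrite (c3_prod_odd rq) -/X root_prod_eq0 //.
    transitivity (- 2^-1 * (c1 r + 1) * X.[c1 0] ^+ 2 * b r ^+ 2); first by ring.
    by rewrite X1; field.
  + rewrite Nr node_odd watson1_trunc_odd; last lia.
    have rq : (r <= q)%N by lia.
    have -> : c3 r * X.[c3 r] ^+ 2 = 0.
      have [rq'|rq'] := ltnP r q; first by rewrite (root_prod_eq0 _ rq') expr0n mulr0.
      by rewrite (_ : r = q) ?c3q ?mul0r //; lia.
    rewrite (c1_prod_odd rq) -/Y.
    transitivity (- 2^-1 * (Y.[c3 0] ^+ 2 * (2 * r%:R + 1) ^+ 2 * b r ^+ 2)); first by ring.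
    by rewrite Y1; field.
set S := \sum_(i < q.+1) _.
have -> : A^`().[0] = - 2^-1 * (X.[0] ^+ 2 - 2 * S * Y.[0] ^+ 2 + 2).
  rewrite /A derivZ derivD !derivB !derivM derivD derivX derivC.
  rewrite !hornerE deriv_nodes_poly0 (@deriv_root_prod0 F c1) => [|i iq].
    by rewrite -/Y -/S /=; ring.
  by rewrite expf_neq0 // -natrM natr1 nz //; lia.
by rewrite X0 Y0; field; rewrite b0 t0.
Qed.

End Odd.

End Interpolation.

(** * Reduction of the sum modulo the cube of p *)

Lemma cbin_neq0 q : cbin rat q != 0.
Proof.
rewrite /cbin mulf_neq0 // ?invr_eq0 ?expf_neq0 // pnatr_eq0 -lt0n bin_gt0; lia.
Qed.

Section TruncatedSum.

Variables (p : nat) (p_pr : prime p) (n : nat).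
Hypothesis pE : p = (2 * n + 1)%N.
Hypothesis n_gt1 : (1 < n)%N.

Local Notation F := 'F_p.
Local Notation red := (@ratr 'F_p).
Local Notation b := (cbin rat).

Lemma ndvd_small k : (0 < k < p)%N -> ~~ (p %| k)%N.
Proof. by move=> /andP [k0 kp]; apply/negP => /(dvdn_leq k0); lia. Qed.

Lemma rat_nz (m : nat) i : (0 < i <= m)%N -> i%:R != 0 :> rat.
Proof. by move=> /andP [i0 _]; rewrite pnatr_eq0; lia. Qed.

Lemma Fp_nz i : (0 < i <= 2 * n)%N -> i%:R != 0 :> F.
Proof. by move=> hi; rewrite nat_Fp_eq0 // ndvd_small //; lia. Qed.

Lemma Fp_char : 2 * n%:R + 1 = 0 :> F.
Proof. by apply/eqP; rewrite -natrM natr1 nat_Fp_eq0 // pE addn1. Qed.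

Lemma Fp_wilson : ((2 * n)`!)%:R = -1 :> F.
Proof.
apply/eqP; rewrite -addr_eq0 natr1 nat_Fp_eq0 //.
by have := Wilson (prime_gt1 p_pr); rewrite p_pr {2}pE addn1 /= => <-.
Qed.

Lemma Fp_fermat (x : F) : x != 0 -> x ^+ (2 * n) = 1.
Proof.
move=> x0; apply: (mulfI x0); rewrite -exprS mulr1.
by have := expf_card x; rewrite card_Fp // [X in _ ^+ X]pE addn1.
Qed.

Lemma Fp_fermat2 : (2%:R ^+ n) ^+ 2 = 1 :> F.
Proof. by rewrite -exprM mulnC Fp_fermat // Fp_nz //; lia. Qed.

Lemma p_ndvd2 : ~~ (p %| 2)%N. Proof. by apply: ndvd_small; lia. Qed.
Lemma p_ndvd4 : ~~ (p %| 4)%N. Proof. by apply: ndvd_small; lia. Qed.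

Lemma pintegral_cbin k : pintegral p (b k).
Proof.
rewrite /cbin -exprVn; apply: pintegralM => //; first exact: pintegral_nat.
by apply: pintegralX => //; apply: pintegralV => //; apply: p_ndvd4.
Qed.

Lemma red_cbin k : red (b k) = cbin F k.
Proof.
have i4 : pintegral p 4^-1 by apply: pintegralV => //; apply: p_ndvd4.
rewrite /cbin -!exprVn redM ?redX ?red_nat ?pintegralX ?pintegral_nat //.
by rewrite (redV p_pr p_ndvd4).
Qed.

Lemma subr1_int k : 2 * k%:R - 1 = (2 * k%:Z - 1)%:~R :> rat.
Proof. by rewrite intrB intrM. Qed.

Lemma ndvd_2k1 k : (k <= n)%N -> ~~ (p%:Z %| 2 * k%:Z - 1)%Z.
Proof.
case: k => [|k] kn; first by rewrite mulr0 sub0r dvdzE abszN dvdn1; lia.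
have -> : 2 * k.+1%:Z - 1 = (2 * k + 1)%N%:Z by lia.
by rewrite dvdz_nat ndvd_small //; lia.
Qed.

Lemma pintegral_2k1V k : (k <= n)%N -> pintegral p (2 * k%:R - 1)^-1.
Proof. by move=> kn; rewrite subr1_int; apply: pintegralV_int => //; apply: ndvd_2k1. Qed.

Lemma red_2k1V k : (k <= n)%N -> red (2 * k%:R - 1)^-1 = (2 * k%:R - 1)^-1.
Proof.
move=> kn; rewrite subr1_int -div1r (red_frac p_pr 1 (ndvd_2k1 kn)) div1r.
by rewrite intrB intrM.
Qed.

Lemma pintegral_oddV j : (j < n)%N -> pintegral p (2 * j%:R + 1)^-1.
Proof.
move=> jn; rewrite -natrM natr1; apply: pintegralV => //.
by apply: ndvd_small; lia.
Qed.

Lemma red_oddV j : (j < n)%N -> red (2 * j%:R + 1)^-1 = (2 * j%:R + 1)^-1.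
Proof.
move=> jn; rewrite -natrM natr1 redV //; last by apply: ndvd_small; lia.
by rewrite -[in RHS]natrM [in RHS]natr1.
Qed.

Lemma pintegral_odd_sum k : (k <= n)%N ->
  pintegral p (\sum_(j < k) (2 * j%:R + 1) ^- 2).
Proof.
move=> kn; apply: pintegral_sum => // j _; rewrite -exprVn; apply: pintegralX => //.
by apply: pintegral_oddV; have := ltn_ord j; lia.
Qed.

Lemma pintegral_dsum : pintegral p (dsum rat n).
Proof.
apply: pintegralN; apply: pintegral_sum => // k _; have := ltn_ord k; rewrite ltnS => kn.
apply: pintegralM => //; last exact: pintegral_odd_sum.
apply: pintegralM => //; last exact: pintegral_2k1V.
exact/pintegralX/pintegral_cbin.
Qed.

Lemma red_dsum : red (dsum rat n) = dsum F n.
Proof.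
have ib k := pintegral_cbin k.
have i2 (k : 'I_n.+1) : pintegral p (2 * k%:R - 1)^-1.
  by apply: pintegral_2k1V; rewrite -ltnS.
have i3 (k : 'I_n.+1) : pintegral p (\sum_(j < k) (2 * j%:R + 1) ^- 2).
  by apply: pintegral_odd_sum; rewrite -ltnS.
have i4 (k : 'I_n.+1) : pintegral p (b k ^+ 3 / (2 * k%:R - 1) * \sum_(j < k) (2 * j%:R + 1) ^- 2).
  by apply: pintegralM => //; apply: pintegralM => //; apply: pintegralX.
rewrite /dsum redN ?pintegral_sum // red_sum //; congr (- _).
apply: eq_bigr => k _; have ib3 : pintegral p (b k ^+ 3) by apply: pintegralX.
rewrite redM //; last by apply: pintegralM.
rewrite (redM p_pr ib3) // redX // red_cbin.
rewrite red_2k1V -1?ltnS //; congr (_ * _).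
have jn (j : 'I_k) : (j < n)%N by have := ltn_ord k; have := ltn_ord j; lia.
rewrite red_sum // => [|j _]; last by rewrite -exprVn pintegralX ?pintegral_oddV.
by apply: eq_bigr => j _; rewrite -!exprVn redX ?red_oddV // pintegral_oddV.
Qed.

Definition half_sum : rat := \sum_(k < n.+1) b k ^+ 3 / (2 * k%:R - 1).

(** Since p = 2n + 1, the factors of a_k(n) are ((2j + 1)^2 - p^2) / (4 (j + 1)^2); what is dropped
    is of order p^4. *)
Lemma acoef_cong k : (k <= n)%N -> cong p 3 (acoef n%:R k)
  (b k ^+ 2 * (1 - p%:R ^+ 2 * \sum_(j < k) (2 * j%:R + 1) ^- 2)).
Proof.
have rnz : forall i, (0 < i <= 2 * n)%N -> i%:R != 0 :> rat by apply: rat_nz.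
elim: k => [|k IHk] kn.
  by rewrite acoef0 cbin0 big_ord0; apply: cong_eq => //; ring.
rewrite acoefS big_ord_recr /= (cbinS rnz) //.
have ih := IHk (ltnW kn); set S := \sum_(j < k) _ in ih *.
have iS : pintegral p S by apply: pintegral_odd_sum; lia.
have pR : p%:R = 2 * n%:R + 1 :> rat by rewrite pE natrD natrM.
have k0 : 1 + k%:R != 0 :> rat by rewrite nat1r pnatr_eq0.
have o0 : 2 * k%:R + 1 != 0 :> rat by rewrite -natrM natr1 pnatr_eq0.
have -> : - (n%:R - k%:R) * (n%:R + k%:R + 1) / k.+1%:R ^+ 2 =
  ((2 * k%:R + 1) ^+ 2 - p%:R ^+ 2) * (4^-1 * (k.+1%:R^-1) ^+ 2) :> rat.
  by rewrite pR -(nat1r k); field; rewrite k0.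
have i4 : pintegral p (4^-1 * (k.+1%:R^-1) ^+ 2).
  apply: pintegralM => //; first by apply: pintegralV => //; apply: p_ndvd4.
  by apply: pintegralX => //; apply: pintegralV => //; apply: ndvd_small; lia.
have iP : pintegral p (((2 * k%:R + 1) ^+ 2 - p%:R ^+ 2) * (4^-1 * (k.+1%:R^-1) ^+ 2)).
  apply: pintegralM => //; apply: pintegralB => //; last exact/pintegralX/pintegral_nat.
  by rewrite -natrM natr1; apply/pintegralX/pintegral_nat.
apply: (cong_trans p_pr (congMr p_pr iP ih)).
have iB := pintegral_cbin k.
apply: (congP (c := b k ^+ 2 * (4^-1 * (k.+1%:R^-1) ^+ 2) * p%:R * S)).
  apply: pintegralM => //; apply: pintegralM => //; last exact: pintegral_nat.
  by apply: pintegralM => //; apply: pintegralX.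
by rewrite -(nat1r k); field; rewrite k0 o0.
Qed.

Lemma watson1_cong : cong p 3 (watson1 n n%:R) (half_sum + p%:R ^+ 2 * dsum rat n).
Proof.
rewrite /half_sum /dsum mulrN mulr_sumr -sumrB /watson1; apply: cong_sum => // k _.
have kn : (k <= n)%N by rewrite -ltnS.
apply: (@cong_trans _ p_pr _ (b k ^+ 2 * (1 - p%:R ^+ 2 * \sum_(j < k) (2 * j%:R + 1) ^- 2) * b k / (2 * k%:R - 1))).
  apply: congMr => //; first exact: pintegral_2k1V.
  by apply: congMr => //; [apply: pintegral_cbin|apply: acoef_cong].
by apply: cong_eq => //; ring.
Qed.

(** Over [rat] the factor 2n + 1 does not vanish. Summing up to n + 1 adds a zero term and makes the
    boundary term vanish at N = n. *)
Lemma watson1_extend : watson1 n.+1 n%:R = watson1 n n%:R :> rat.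
Proof.
by rewrite /watson1 big_ord_recr /= acoef_nat_eq0 // !mul0r addr0.
Qed.

Lemma watson1_closed_even q : n = (2 * q)%N ->
  watson1 n n%:R = - (p%:R ^+ 2 + 1) / 2 * b q ^+ 2 :> rat.
Proof.
move=> nE; rewrite -watson1_extend {2}nE.
have aM N : (N <= n)%N -> (2 * N%:R + 1) * acoef N%:R n.+1 = 0 :> rat.
  by move=> Nn; rewrite acoef_nat_eq0 ?mulr0.
rewrite (watson1_even (@rat_nz (2 * n.+1)) (ltn0Sn n) _ aM); try lia.
have -> : p%:R = 4 * q%:R + 1 :> rat by rewrite pE nE natrD !natrM; ring.
by field.
Qed.

Lemma watson1_closed_odd q : n = (2 * q + 1)%N ->
  watson1 n n%:R = - 2 * n%:R ^+ 2 * b q ^+ 2 :> rat.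
Proof.
move=> nE; rewrite -watson1_extend {2}nE.
have aM N : (N <= n)%N -> (2 * N%:R + 1) * acoef N%:R n.+1 = 0 :> rat.
  by move=> Nn; rewrite acoef_nat_eq0 ?mulr0.
rewrite (watson1_odd (@rat_nz (2 * n.+1)) (ltn0Sn n) _ aM); try lia.
have -> : n%:R = 2 * q%:R + 1 :> rat by rewrite nE natrD natrM.
by ring.
Qed.

(** Divide Wilson's (2n)! = -1 by n!^2 = -(-1)^n, and use 4^n = 1. *)
Lemma red_cbin_half : red (b n) = (-1) ^+ n.
Proof.
have f4 : 4%:R ^+ n = 1 :> F by rewrite (natrX _ 2 2) -exprM mulnC exprM Fp_fermat2.
rewrite red_cbin /cbin f4 divr1.
have := congr1 (fun m => m%:R : F) (bin_fact (leq_addr n n)).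
rewrite addnK addnn -mul2n Fp_wilson !natrM => e.
have sq := half_fact_sqr (ltnW n_gt1) Fp_char Fp_wilson.
have s1 : (-1) ^+ n * (-1) ^+ n = 1 :> F by rewrite -expr2 sqrr_sign.
transitivity ((-1) ^+ n * (-1) ^+ n * 'C(2 * n, n)%:R : F); first by rewrite s1 mul1r.
transitivity (- (-1) ^+ n * ('C(2 * n, n)%:R * (n`!%:R * n`!%:R)) : F).
  by rewrite -[n`!%:R * _]expr2 sq; ring.
by rewrite e mulrN1 opprK.
Qed.

Lemma ndvd_fact k : (k < p)%N -> ~~ (p %| k`!)%N.
Proof.
elim: k => [|k IHk] kp; first by rewrite dvdn1; lia.
by rewrite factS Euclid_dvdM // negb_or IHk ?ndvd_small //; lia.
Qed.

Lemma dvdn_bin2nn k : (n < k < p)%N -> (p %| 'C(2 * k, k))%N.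
Proof.
move=> /andP [nk kp]; have := bin_fact (leq_addr k k); rewrite addnK addnn -mul2n => e.
have : (p %| (2 * k)`!)%N by rewrite dvdn_fact // prime_gt0 //; lia.
by rewrite -e !Euclid_dvdM // (negPf (ndvd_fact kp)) !orbF.
Qed.

Definition sun_term (k : nat) : rat :=
  ('C(2 * k, k))%:R ^+ 3 / (64 ^+ k * (2 * k%:R - 1)).

Lemma sun_termE k : sun_term k = b k ^+ 3 / (2 * k%:R - 1).
Proof.
have e : 64 ^+ k = (4 ^+ k) ^+ 3 :> rat.
  by rewrite -exprM mulnC exprM; congr (_ ^+ k); ring.
by rewrite /sun_term /cbin e expr_div_n invfM mulrA.
Qed.

Lemma sun_sum_cong :
  cong p 3 (\sum_(0 <= k < p) sun_term k) (half_sum + p%:R ^+ 2 * (-1) ^+ n).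
Proof.
have rnz : forall i, (0 < i <= 2 * n.+1)%N -> i%:R != 0 :> rat by apply: rat_nz.
rewrite (big_cat_nat (n := n.+1)) //=; last by lia.
rewrite big_mkord; apply: congD => //.
  by apply: cong_eq => //; apply: eq_bigr => k _; rewrite sun_termE.
rewrite big_ltn; last by lia.
rewrite -[X in cong p 3 _ X]addr0; apply: congD => //.
  have pR : 2 * n.+1%:R - 1 = p%:R :> rat by rewrite pE natrD natrM -(nat1r n); ring.
  (* The cube of this has p^3, of which the denominator 2(n + 1) - 1 = p takes one factor: p^2
     survives. *)
  have bS : b n.+1 = p%:R * b n / (p + 1)%:R.
    have n0 : 1 + n%:R != 0 :> rat by rewrite nat1r pnatr_eq0.
    have pR2 : p%:R = 2 * n%:R + 1 :> rat by rewrite pE natrD natrM.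
    have -> : (p + 1)%:R = 2 * (1 + n%:R) :> rat by rewrite natrD pR2; ring.
    by rewrite (cbinS rnz) // pR2; field; rewrite n0.
  have p0 := prime_natq_neq0 p_pr.
  have p10 : (p + 1)%:R != 0 :> rat by rewrite pnatr_eq0 addn1.
  have -> : sun_term n.+1 = p%:R ^+ 2 * (b n ^+ 3 * (p + 1)%:R^-1 ^+ 3).
    by rewrite sun_termE pR bS; field; rewrite p0 -(natrD _ p 1) p10.
  apply: (@congMp _ 1 2).
  have p1 : ~~ (p %| p + 1)%N by rewrite dvdn_addr // dvdn1; lia.
  have i1 : pintegral p (p + 1)%:R^-1 by apply: pintegralV.
  have ib := pintegral_cbin n.
  have im : pintegral p (-1) by apply/pintegralN/pintegral1.
  have iA : pintegral p (b n ^+ 3) by apply: pintegralX.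
  have iB : pintegral p ((p + 1)%:R^-1 ^+ 3) by apply: pintegralX.
  apply/(cong1_red p_pr (pintegralM p_pr iA iB) (pintegralX p_pr n im)).
  rewrite (redM p_pr iA iB) !redX // redV // red_cbin_half natrD.
  rewrite (redN p_pr (pintegral1 p_pr)) (red_nat p 1).
  have /eqP -> : p%:R == 0 :> F by rewrite nat_Fp_eq0.
  by rewrite add0r invr1 expr1n mulr1 -exprM mulnC exprM [(-1) ^+ 3]exprS sqrrN expr1n mulr1.
apply: (@cong_trans _ p_pr _ (\sum_(n.+2 <= k < p) 0)); last by rewrite big1 //; apply: cong_refl.
rewrite big_seq [X in cong p 3 _ X]big_seq; apply: cong_sum => // k.
rewrite mem_index_iota => /andP [nk kp].
have /dvdnP [m em] : (p %| 'C(2 * k, k))%N by apply: dvdn_bin2nn; lia.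
apply: (congP (c := m%:R ^+ 3 * (64^-1 ^+ k * (2 * k - 1)%:R^-1))).
  apply: pintegralM => //; first exact/pintegralX/pintegral_nat.
  apply: pintegralM => //.
    apply: pintegralX => //; apply: pintegralV => //.
    by rewrite (_ : 64 = 2 ^ 6)%N // Euclid_dvdX // negb_and p_ndvd2.
  (* For n + 2 <= k < p, 2k - 1 lies strictly between p and 2p. *)
  apply: pintegralV => //; apply/negP => /dvdnP [[|[|j]] ej]; try lia.
have -> : (2 * k - 1)%:R = 2 * k%:R - 1 :> rat by rewrite natrB ?natrM //; lia.
by rewrite /sun_term em natrM exprVn invfM subr0 exprMn; ring.
Qed.

Lemma sun_sum_watson :
  cong p 3 (\sum_(0 <= k < p) sun_term k)
    (watson1 n n%:R - p%:R ^+ 2 * dsum rat n + p%:R ^+ 2 * (-1) ^+ n).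
Proof.
apply: (cong_trans p_pr sun_sum_cong); apply: congD => //; last exact: cong_refl.
apply: (@cong_trans _ p_pr _ (half_sum + p%:R ^+ 2 * dsum rat n - p%:R ^+ 2 * dsum rat n)).
  by apply: cong_eq => //; ring.
by apply: congB => //; [apply/cong_sym/watson1_cong|apply: cong_refl].
Qed.

Lemma pintegral_cbinV q : (2 * q < p)%N -> pintegral p (b q)^-1.
Proof.
move=> qp; rewrite /cbin invfM invrK; apply: pintegralM => //; last exact/pintegralX/pintegral_nat.
apply: pintegralV => //; have := bin_fact (leq_addr q q); rewrite addnK addnn -mul2n => e.
by have := ndvd_fact qp; rewrite -e Euclid_dvdM // negb_or => /andP [].
Qed.

Lemma red_cbinV q : (2 * q < p)%N -> red (b q)^-1 = (cbin F q)^-1.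
Proof.
move=> qp; have ib := pintegral_cbin q; have iV := pintegral_cbinV qp.
have e : red (b q) * red (b q)^-1 = 1.
  by rewrite -redM // divff ?cbin_neq0 // (red_nat p 1).
have b0 : red (b q) != 0.
  by apply: contraTneq (oner_neq0 F) => b0; rewrite -e b0 mul0r eqxx.
by apply: (mulfI b0); rewrite e red_cbin divff // -red_cbin.
Qed.

Lemma pintegral_sqrV m : (0 < m < p)%N -> pintegral p (m%:R ^+ 2)^-1.
Proof.
by move=> mp; rewrite -exprVn; apply: pintegralX => //; apply: pintegralV => //; apply: ndvd_small.
Qed.

Lemma red_sqrV m : (0 < m < p)%N -> red (m%:R ^+ 2)^-1 = (m%:R ^+ 2)^-1.
Proof.
move=> mp; rewrite -!exprVn redX //; first by rewrite redV // ndvd_small.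
by apply: pintegralV => //; apply: ndvd_small.
Qed.

Lemma c1E (R : fieldType) i : c1 R i = (4 * i + 1)%:R ^+ 2.
Proof. by rewrite /c1 natrD natrM. Qed.

Lemma c3E (R : fieldType) i : c3 R i = (4 * i + 3)%:R ^+ 2.
Proof. by rewrite /c3 natrD natrM. Qed.

Lemma pintegral_half : pintegral p 2^-1.
Proof. by apply: pintegralV => //; apply: p_ndvd2. Qed.

(** The p^2 b_q^2 / 2 of W(n) cancels against that of [dsum_even], and the constant 1 there against
    (-1)^n. *)
Lemma sun_sum_even q : n = (2 * q)%N ->
  cong p 3 (\sum_(0 <= k < p) sun_term k)
    (- (1 / 2) * b q ^+ 2 * (1 + 2 * p%:R ^+ 2 * \sum_(i < q) (c3 rat i)^-1)
     + p%:R ^+ 2 / (2 * b q ^+ 2)).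
Proof.
move=> nE; set s := \sum_(i < q) _.
have i3 (i : 'I_q) : (0 < 4 * i + 3 < p)%N by have := ltn_ord i; lia.
have is3 : pintegral p s.
  by apply: pintegral_sum => // i _; rewrite c3E pintegral_sqrV.
have red_s : red s = \sum_(i < q) (c3 F i)^-1.
  rewrite red_sum // => [|i _]; last by rewrite c3E pintegral_sqrV.
  by apply: eq_bigr => i _; rewrite !c3E red_sqrV.
have ib := pintegral_cbin q; have q2p : (2 * q < p)%N by lia.
have ibV := pintegral_cbinV q2p.
have ih := pintegral_half.
have i1 := pintegral1 p_pr; have i2 := pintegral_nat p_pr 2.
(* t1 - t2 + 1 is the value in [dsum_even], over [rat] and with inverses as factors so that
   integrality is visible. *)
pose t1 := - 2^-1 * b q ^+ 2 * (1 - 2 * s); pose t2 := 2^-1 * (b q)^-1 ^+ 2.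
have it0 : pintegral p (1 - 2 * s) by apply: pintegralB => //; apply: pintegralM.
have ib2 : pintegral p (b q ^+ 2) by apply: pintegralX.
have ibV2 : pintegral p ((b q)^-1 ^+ 2) by apply: pintegralX.
have ihN : pintegral p (- 2^-1) by apply: pintegralN.
have ihb : pintegral p (- 2^-1 * b q ^+ 2) by apply: pintegralM.
have it1 : pintegral p t1 by apply: pintegralM.
have it2 : pintegral p t2 by apply: pintegralM.
have it12 : pintegral p (t1 - t2) by apply: pintegralB.
have it : pintegral p (t1 - t2 + 1) by apply: pintegralD.
have dE : cong p 1 (dsum rat n) (t1 - t2 + 1).
  apply/(cong1_red p_pr pintegral_dsum it).
  rewrite red_dsum (dsum_even Fp_nz (ltnW n_gt1) Fp_char Fp_wilson Fp_fermat2 nE).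
  rewrite (redD p_pr it12 i1) (redB p_pr it1 it2).
  rewrite (redM p_pr ihb it0) (redM p_pr ihN ib2) (redN p_pr ih) (redB p_pr i1 (pintegralM p_pr i2 is3)).
  rewrite (redM p_pr i2 is3) (redM p_pr ih ibV2) (redX p_pr 2 ib) (redX p_pr 2 ibV) (red_cbin q) (red_cbinV q2p).
  rewrite red_s (red_nat p 1) (red_nat p 2) (redV p_pr p_ndvd2).
  by rewrite !div1r exprVn invfM.
apply: (cong_trans p_pr sun_sum_watson); rewrite (watson1_closed_even nE).
have /(congMp (e := 1) 2) dE2 := dE.
apply: (cong_trans p_pr (congD p_pr (congB p_pr (cong_refl p_pr _ _) dE2) (cong_refl p_pr _ _))).
have b0 := cbin_neq0 q.
by apply: cong_eq => //; rewrite /t1 /t2 nE exprM sqrrN !expr1n; field; rewrite b0.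
Qed.

Lemma sun_sum_odd q : n = (2 * q + 1)%N ->
  cong p 3 (\sum_(0 <= k < p) sun_term k)
    (- 2 * n%:R ^+ 2 * b q ^+ 2 + p%:R ^+ 2 / (2 * b q ^+ 2)
     - p%:R ^+ 2 * b q ^+ 2 * \sum_(i < q.+1) (c1 rat i)^-1).
Proof.
move=> nE; set s := \sum_(i < q.+1) _.
have i1' (i : 'I_q.+1) : (0 < 4 * i + 1 < p)%N by have := ltn_ord i; lia.
have is1 : pintegral p s.
  by apply: pintegral_sum => // i _; rewrite c1E pintegral_sqrV.
have red_s : red s = \sum_(i < q.+1) (c1 F i)^-1.
  rewrite red_sum // => [|i _]; last by rewrite c1E pintegral_sqrV.
  by apply: eq_bigr => i _; rewrite !c1E red_sqrV.
have ib := pintegral_cbin q; have q2p : (2 * q < p)%N by lia.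
have ibV := pintegral_cbinV q2p.
have ih := pintegral_half; have i1 := pintegral1 p_pr.
have ib2 : pintegral p (b q ^+ 2) by apply: pintegralX.
have ibV2 : pintegral p ((b q)^-1 ^+ 2) by apply: pintegralX.
have ihN : pintegral p (- 2^-1) by apply: pintegralN.
have it1 : pintegral p (- 2^-1 * (b q)^-1 ^+ 2) by apply: pintegralM.
have it2 : pintegral p (b q ^+ 2 * s) by apply: pintegralM.
have it12 : pintegral p (- 2^-1 * (b q)^-1 ^+ 2 + b q ^+ 2 * s) by apply: pintegralD.
have it : pintegral p (- 2^-1 * (b q)^-1 ^+ 2 + b q ^+ 2 * s - 1) by apply: pintegralB.
have dE : cong p 1 (dsum rat n) (- 2^-1 * (b q)^-1 ^+ 2 + b q ^+ 2 * s - 1).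
  apply/(cong1_red p_pr pintegral_dsum it).
  rewrite red_dsum (dsum_odd Fp_nz (ltnW n_gt1) Fp_char Fp_wilson Fp_fermat2 nE).
  rewrite (redB p_pr it12 i1) (redD p_pr it1 it2) (redM p_pr ib2 is1) (redM p_pr ihN ibV2).
  rewrite (redN p_pr ih) (redX p_pr 2 ib) (redX p_pr 2 ibV) (red_cbin q) (red_cbinV q2p).
  rewrite red_s (red_nat p 1) (redV p_pr p_ndvd2).
  by rewrite invfM exprVn mulN1r mulNr.
apply: (cong_trans p_pr sun_sum_watson); rewrite (watson1_closed_odd nE).
have /(congMp (e := 1) 2) dE2 := dE.
apply: (cong_trans p_pr (congD p_pr (congB p_pr (cong_refl p_pr _ _) dE2) (cong_refl p_pr _ _))).
have b0 := cbin_neq0 q.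
have sg : (-1) ^+ n = -1 :> rat by rewrite nE addn1 (exprS _ (2 * q)) exprM sqrrN !expr1n mulr1.
by apply: cong_eq => //; rewrite sg; field; rewrite b0.
Qed.

End TruncatedSum.

(** * Euler numbers and the case p = 3 mod 4 *)

Lemma sum_Fp (V : nmodType) p (f : 'F_p -> V) : prime p ->
  \sum_(k < p) f k%:R = \sum_(x : 'F_p) f x.
Proof.
move=> p_pr.
rewrite -(big_mkord predT (fun k => f k%:R)).
rewrite -{1}(Fp_cast p_pr) big_mkord.
by apply: eq_bigr => x _; rewrite natr_Zp.
Qed.

(** By x -> -x. The sum may include 0, whose inverse is 0. *)
Lemma sum_FpV p : prime p -> (2 < p)%N -> \sum_(x : 'F_p) x^-1 = 0.
Proof.
move=> p_pr p2; set s := \sum_x _.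
have e : s = - s.
  rewrite {1}/s (reindex_inj (inv_inj (@opprK 'F_p))) -sumrN.
  by apply: eq_bigr => x _; rewrite invrN.
have : 2 * s = 0 by rewrite mulr_natl mulr2n {1}e addNr.
move/eqP; rewrite mulf_eq0 => /orP [|/eqP //].
by rewrite nat_Fp_eq0 // => /(dvdn_leq (ltn0Sn 1)); rewrite leqNgt p2.
Qed.

(** Scaling x by 2 divides the sum by 4, and 4 - 1 = 3 is invertible. *)
Lemma sum_FpV2 p : prime p -> (3 < p)%N -> \sum_(x : 'F_p) x ^- 2 = 0.
Proof.
move=> p_pr p3; set s := \sum_x _.
have nz2 : 2 != 0 :> 'F_p.
  by rewrite nat_Fp_eq0 //; apply/negP => /(dvdn_leq (ltn0Sn 1)); rewrite leqNgt; lia.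
have nz3 : 3 != 0 :> 'F_p.
  by rewrite nat_Fp_eq0 //; apply/negP => /(dvdn_leq (ltn0Sn 2)); rewrite leqNgt; lia.
have e : s = 2 ^- 2 * s.
  rewrite {1}/s (reindex_inj (mulfI nz2)) mulr_sumr.
  by apply: eq_bigr => x _; rewrite exprMn invfM.
have : 3 * s = 0.
  transitivity (2 ^+ 2 * s - s); first by ring.
  by rewrite {1}e mulrA divff ?expf_neq0 // mul1r subrr.
by move/eqP; rewrite mulf_eq0 (negPf nz3) => /eqP.
Qed.

Lemma sum_pairs (V : nmodType) (g : nat -> V) m :
  \sum_(i < 2 * m) g i = \sum_(i < m) (g (2 * i)%N + g (2 * i + 1)%N).
Proof.
elim: m => [|m IHm]; first by rewrite muln0 !big_ord0.
rewrite (_ : 2 * m.+1 = (2 * m).+2)%N; last lia.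
by rewrite !big_ord_recr /= IHm addn1 addrA.
Qed.

Lemma sum_pairsS (V : nmodType) (g : nat -> V) P m : P = (2 * m + 1)%N ->
  \sum_(i < P) g i = g 0%N + \sum_(i < m) (g (2 * i + 1)%N + g (2 * i + 2)%N).
Proof.
move=> ->; rewrite addn1 big_ord_recl (sum_pairs (fun i => g i.+1)).
by congr (_ + _); apply: eq_bigr => i _; rewrite addn1 addn2.
Qed.

Lemma binomial_even (R : comPzRingType) (y : R) r :
  (y + 1) ^+ (2 * r) + (y - 1) ^+ (2 * r) =
  \sum_(k < r.+1) ('C(2 * r, 2 * k))%:R * (2 * y ^+ (2 * r - 2 * k)).
Proof.
rewrite !exprDn -big_split /=.
pose g i : R := ('C(2 * r, i))%:R * ((1 + (-1) ^+ i) * y ^+ (2 * r - i)).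
transitivity (\sum_(i < (2 * r).+1) g i).
  by apply: eq_bigr => i _; rewrite expr1n mulr1 -mulrnDl -mulr_natl /g; ring.
rewrite [in LHS]big_ord_recr /= sum_pairs big_ord_recr /=; congr (_ + _).
  apply: eq_bigr => i _; rewrite /g addn1 (exprS _ (2 * i)) exprM sqrrN !expr1n; ring.
by rewrite /g exprM sqrrN !expr1n.
Qed.

Section Euler.

Variables (F : fieldType) (n q : nat).
Hypothesis nE : n = (2 * q + 1)%N.
Hypothesis pF0 : 2 * n%:R + 1 = 0 :> F.

Definition alt_sum (m : nat) : F := \sum_(i < n) (-1) ^+ i * (2 * (2 * i%:R + 1) ^+ m).

Lemma alt_sum0 : alt_sum 0 = 2.
Proof.
rewrite /alt_sum nE addn1 big_ord_recr /= (sum_pairs (fun i => (-1) ^+ i * (2 * (2 * i%:R + 1) ^+ 0))).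
rewrite big1 ?exprM ?sqrrN ?expr1n => [|i _]; first by ring.
by rewrite addn1 (exprS _ (2 * i)) exprM sqrrN !expr1n; ring.
Qed.

(* By the even part of the binomial formula the left-hand side is a sum over i of
   t_i - t_(i+1), where t_i = (-1)^i (2 i)^(2 r). *)
Lemma alt_sum_rec r : (0 < r)%N ->
  \sum_(k < r.+1) ('C(2 * r, 2 * k))%:R * alt_sum (2 * r - 2 * k) = 1.
Proof.
move=> r0; rewrite /alt_sum.
transitivity (\sum_(i < n) (-1) ^+ i * ((2 * i%:R + 1 + 1) ^+ (2 * r) + (2 * i%:R + 1 - 1) ^+ (2 * r)) : F).
  under eq_bigr => k _ do rewrite mulr_sumr.
  rewrite exchange_big; apply: eq_bigr => i _; rewrite binomial_even mulr_sumr.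
  by apply: eq_bigr => k _; ring.
have tel m : \sum_(i < m) (-1) ^+ i * ((2 * i%:R + 1 + 1) ^+ (2 * r) + (2 * i%:R + 1 - 1) ^+ (2 * r)) =
    - (-1) ^+ m * (2 * m%:R) ^+ (2 * r) :> F.
  elim: m => [|m IHm]; first by rewrite big_ord0 mulr0 expr0n muln_eq0 /= (gtn_eqF r0) mulr0.
  rewrite big_ord_recr /= IHm addrK (exprS _ m) -(nat1r m).
  have -> : 2 * (1 + m%:R) = 2 * m%:R + 1 + 1 :> F by ring.
  by ring.
have n2 : 2 * n%:R = -1 :> F by apply/eqP; rewrite -addr_eq0 pF0.
have sg : (-1) ^+ n = -1 :> F by rewrite nE addn1 (exprS _ (2 * q)) exprM sqrrN !expr1n mulr1.
by rewrite tel n2 sg exprM sqrrN !expr1n opprK mulr1.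
Qed.

(** [alt_sum 0] is 2 where E_0 is 1, and the recurrence of [alt_sum] ends in 1 where that of the
    Euler numbers ends in 0. The two discrepancies compensate for r > 0. *)
Lemma euler_alt_sum r : (0 < r)%N -> (euler (2 * r))%:~R = alt_sum (2 * r).
Proof.
elim/ltn_ind: r => r IH r0.
have := alt_sum_rec r0; pose A k := ('C(2 * r, 2 * k))%:R * alt_sum (2 * r - 2 * k).
rewrite -(big_mkord predT A) big_ltn // big_nat_recr //= {1 3}/A.
rewrite muln0 bin0 subn0 subnn binn alt_sum0 mul1r => recA.
have recE : (euler (2 * r))%:~R = - (\sum_(1 <= k < r) A k + 1).
  rewrite mul2n euler_even // rmorphN rmorph_sum big_nat_recr //=.
  rewrite subnn binn /= mul1r; congr (- (_ + _)).
  rewrite !big_seq; apply: eq_bigr => k; rewrite mem_index_iota => /andP [k1 kr].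
  by rewrite -!mul2n rmorphM /= /A -mulnBr IH //; lia.
rewrite recE; apply/eqP; rewrite eq_sym -subr_eq0 opprK; apply/eqP.
by transitivity (alt_sum (2 * r) + (\sum_(1 <= k < r) A k + 1 * 2) - 1); [ring|rewrite recA; ring].
Qed.

End Euler.

(** By Fermat, (2i+1)^(p-3) = (2i+1)^(-2), so E_(p-3) is twice an alternating sum of inverse odd
    squares. The sum without signs is 0, so the terms of even index alone count twice. *)
Lemma euler_Fp p q : prime p -> (3 < p)%N -> p = (4 * q + 3)%N ->
  (euler (p - 3))%:~R = 4 * \sum_(i < q.+1) (c1 'F_p i)^-1 :> 'F_p.
Proof.
move=> p_pr p3 pq; pose n := (2 * q + 1)%N.
have pE : p = (2 * n + 1)%N by rewrite /n; lia.
have n1 : (1 < n)%N by lia.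
have pF0 := Fp_char p_pr pE.
have pm : (p - 3 = 2 * (2 * q))%N by lia.
rewrite pm (euler_alt_sum (erefl n) pF0); last by lia.
have inv2 (x : 'F_p) : x != 0 -> x ^+ (2 * (2 * q)) = x ^- 2.
  move=> x0; apply: (mulIf (expf_neq0 2 x0)); rewrite mulVf ?expf_neq0 // -exprD.
  by rewrite -(Fp_fermat p_pr pE x0); congr (_ ^+ _); rewrite /n; lia.
have onz (i : 'I_n) : 2 * i%:R + 1 != 0 :> 'F_p.
  by apply: (odd_nz (n := n)) => // [j hj|]; [apply: (Fp_nz p_pr pE)|lia].
pose g i : 'F_p := (2 * i%:R + 1) ^- 2.
(* Reflecting i sends the odd residue 2i + 1 to the negative of an even one: odd and even residues
   contribute equally to the vanishing sum of all x^(-2). *)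
have sum0 : \sum_(i < n) g i = 0.
  have U : \sum_(i < n) g i = \sum_(i < n) (2 * (1 + i%:R)) ^- 2.
    rewrite (reindex_inj rev_ord_inj) /=; apply: eq_bigr => i _.
    rewrite /g natrB //.
    have -> : 2 * (n%:R - i.+1%:R) + 1 = - (2 * (1 + i%:R)) :> 'F_p.
      by apply/eqP; rewrite -addr_eq0 -pF0 -(nat1r i); apply/eqP; ring.
    by rewrite sqrrN.
  have all0 := sum_FpV2 p_pr p3; rewrite -(sum_Fp _ p_pr) /= in all0.
  have eall : \sum_(k < p) (k%:R : 'F_p) ^- 2 = \sum_(i < n) (2 * (1 + i%:R)) ^- 2 + \sum_(i < n) g i.
    rewrite (sum_pairsS (fun k => k%:R ^- 2) pE) expr0n invr0 add0r -big_split.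
    apply: eq_bigr => i _; rewrite addrC /g /=.
    by rewrite (natrD _ (2 * i) 1) (natrD _ (2 * i) 2) natrM; congr (_ ^- 2 + _); ring.
  move: all0; rewrite eall -U => all0.
  have t0 : 2%:R != 0 :> 'F_p by apply: (Fp_nz p_pr pE); lia.
  by apply: (mulfI t0); rewrite mulr0 -[RHS]all0; ring.
rewrite /alt_sum.
transitivity (2 * \sum_(i < n) (-1) ^+ i * g i).
  by rewrite mulr_sumr; apply: eq_bigr => i _; rewrite inv2 // /g; ring.
have split_n (h : nat -> 'F_p) : \sum_(i < n) h i = \sum_(i < q) (h (2 * i)%N + h (2 * i + 1)%N) + h (2 * q)%N.
  by rewrite /n addn1 big_ord_recr /= sum_pairs.
move: sum0; rewrite (split_n g) (split_n (fun i => (-1) ^+ i * g i)) /=.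
have g1 i : g (2 * i)%N = (c1 'F_p i)^-1 by rewrite /g -/(node _ _) node_even.
have -> : \sum_(i < q) ((-1) ^+ (2 * i) * g (2 * i)%N + (-1) ^+ (2 * i + 1) * g (2 * i + 1)%N) =
    \sum_(i < q) (g (2 * i)%N - g (2 * i + 1)%N).
  by apply: eq_bigr => i _; rewrite addn1 (exprS _ (2 * i)) exprM sqrrN !expr1n; ring.
rewrite exprM sqrrN !expr1n mul1r sumrB big_split /= big_ord_recr /= -g1.
have -> : \sum_(i < q) (c1 'F_p i)^-1 = \sum_(i < q) g (2 * i)%N.
  by apply: eq_bigr => i _; rewrite g1.
set s1 := \sum_(i < q) _; set s3 := \sum_(i < q) _ => e.
transitivity (2 * (s1 + g (2 * q)%N - s3) + 2 * (s1 + s3 + g (2 * q)%N)); last by ring.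
by rewrite e; ring.
Qed.

Lemma bin_oddE q : (q.+1 * 'C(2 * q + 1, q) = (2 * q + 1) * 'C(2 * q, q))%N.
Proof.
have := mul_bin_down (2 * q + 1) q; rewrite addn1 /= => ->.
by congr (_ * _)%N; lia.
Qed.

(** Modulo p one has 4 (q + 1) = 1, 4 n^2 = 1 and 4 * 16^q = 2^(2n) = 1. This lets the binomial of
    the theorem replace b_q wherever p^2 stands in front. *)
Lemma bin_odd_sqr_Fp p q : prime p -> (3 < p)%N -> p = (4 * q + 3)%N ->
  'C(2 * q + 1, q)%:R ^+ 2 = cbin 'F_p q ^+ 2.
Proof.
move=> p_pr p3 pq; pose n := (2 * q + 1)%N.
have pE : p = (2 * n + 1)%N by rewrite /n; lia.
have n1 : (1 < n)%N by lia.
have n2q : (n * 2 = 2 * (1 + q * 2))%N by rewrite /n; lia.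
have t0 : 2%:R != 0 :> 'F_p by apply: (Fp_nz p_pr pE); lia.
have pF0 := Fp_char p_pr pE.
have four_n : 4 * n%:R ^+ 2 = 1 :> 'F_p.
  transitivity ((2 * n%:R + 1) * (2 * n%:R - 1) + 1 : 'F_p); first by ring.
  by rewrite pF0 mul0r add0r.
set C := 'C(2 * q + 1, q).
have eC := congr1 (fun m => m%:R : 'F_p) (bin_oddE q).
rewrite /= !natrM -(nat1r q) -/n -/C in eC.
have nq : n%:R = 2 * q%:R + 1 :> 'F_p by rewrite /n natrD natrM.
have q4 : 4 * (1 + q%:R) = 1 :> 'F_p.
  by transitivity (2 * n%:R + 1 + 1 : 'F_p); [rewrite nq; ring|rewrite pF0 add0r].
have eC2 : C%:R ^+ 2 = 4 * 'C(2 * q, q)%:R ^+ 2 :> 'F_p.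
  transitivity ((4 * (1 + q%:R)) ^+ 2 * C%:R ^+ 2 : 'F_p); first by rewrite q4; ring.
  transitivity (16 * ((1 + q%:R) * C%:R) ^+ 2 : 'F_p); first by ring.
  rewrite eC; transitivity (4 * (4 * n%:R ^+ 2) * 'C(2 * q, q)%:R ^+ 2 : 'F_p); first by ring.
  by rewrite four_n; ring.
have f0 : 4 ^+ q != 0 :> 'F_p by rewrite expf_neq0 // (natrM _ 2 2) mulf_neq0.
have e4 : 2 ^+ 2 = 4 :> 'F_p by ring.
have f1 : 4 * (4 ^+ q) ^+ 2 = 1 :> 'F_p.
  rewrite -[RHS](Fp_fermat2 p_pr pE n1) -!exprM n2q.
  by rewrite [in RHS]exprM e4 (exprD _ 1) expr1 exprM.
rewrite eC2 /cbin expr_div_n; apply: (mulIf (expf_neq0 2 f0)).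
rewrite (divfK (expf_neq0 2 f0)).
by transitivity (4 * (4 ^+ q) ^+ 2 * 'C(2 * q, q)%:R ^+ 2 : 'F_p); [ring|rewrite f1 mul1r].
Qed.

Lemma sun_sum_3mod4 p q : prime p -> (3 < p)%N -> p = (4 * q + 3)%N ->
  eqmodq p 3 (\sum_(0 <= k < p) sun_term k)
    (- (1 / 4) * (2 + p%:R ^+ 2 * (euler (p - 3))%:~R)
         * ((p%:R + 1) ^+ 2 / 2 ^+ (p - 1))
         * ('C(2 * q + 1, q))%:R ^+ 2
       + p%:R ^+ 2 / (2 * ('C(2 * q + 1, q))%:R ^+ 2)).
Proof.
move=> p_pr p3 pq; pose n := (2 * q + 1)%N.
have pE : p = (2 * n + 1)%N by rewrite /n; lia.
have n1 : (1 < n)%N by lia.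
have i1' (i : 'I_q.+1) : (0 < 4 * i + 1 < p)%N by have := ltn_ord i; lia.
rewrite -/n; set C := 'C(n, q); set E := euler (p - 3).
have eC : (q.+1 * C = n * 'C(2 * q, q))%N := bin_oddE q.
have C_nd : ~~ (p %| C)%N.
  have : (C %| n`!)%N by rewrite -(bin_fact (_ : q <= n)%N) ?dvdn_mulr //; lia.
  move=> Cn; apply: contra (ndvd_fact p_pr pE n1 (_ : n < p)%N); last by lia.
  by move=> pC; apply: dvdn_trans Cn.
have C0 : C%:R != 0 :> rat by rewrite pnatr_eq0; apply: contraNneq C_nd => ->; rewrite dvdn0.
pose b := cbin rat q.
have b0 : b != 0 by exact: cbin_neq0.
(* The leading term needs an exact identity: p + 1 = 4 (q + 1) and 2^(p-1) = 4 * 16^q explain the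
   factor (p + 1)^2 / 2^(p-1). *)
have eb : (p%:R + 1) ^+ 2 / 2 ^+ (p - 1) * C%:R ^+ 2 = 4 * n%:R ^+ 2 * b ^+ 2.
  have := congr1 (fun m => m%:R : rat) eC; rewrite !natrM -(nat1r q) => eC'.
  have -> : p%:R + 1 = 4 * (1 + q%:R) :> rat by rewrite pq natrD natrM; ring.
  have -> : 2 ^+ (p - 1) = 4 * (4 ^+ q) ^+ 2 :> rat.
    have -> : (p - 1 = 2 * (1 + 2 * q))%N by lia.
    have e4 : 2 ^+ 2 = 4 :> rat by ring.
    by rewrite exprM e4 (exprD _ 1) expr1 (mulnC 2 q) exprM.
  have f0 : 4 ^+ q != 0 :> rat by rewrite expf_neq0.
  transitivity (4 * ((1 + q%:R) * C%:R) ^+ 2 / (4 ^+ q) ^+ 2 : rat); first by field; rewrite f0.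
  by rewrite eC' /b /cbin; field; rewrite f0.
have -> : - (1 / 4) * (2 + p%:R ^+ 2 * E%:~R) * ((p%:R + 1) ^+ 2 / 2 ^+ (p - 1)) * C%:R ^+ 2
      + p%:R ^+ 2 / (2 * C%:R ^+ 2) =
    - 2 * n%:R ^+ 2 * b ^+ 2 + p%:R ^+ 2 * (2^-1 * C%:R^-1 ^+ 2 - E%:~R * n%:R ^+ 2 * b ^+ 2) :> rat.
  by rewrite -[X in X + _]mulrA eb; field; rewrite C0.
have ib : pintegral p b := pintegral_cbin p_pr pE n1 q.
have q2p : (2 * q < p)%N by lia.
have ibV : pintegral p b^-1 := pintegral_cbinV p_pr pE n1 q2p.
have ih := pintegral_half p_pr pE n1.
have iC := pintegralV C_nd.
have iE := pintegral_int p_pr E.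
have inn := pintegral_nat p_pr n.
have iC2 := pintegralX p_pr 2 iC; have in2 := pintegralX p_pr 2 inn.
have ib2 := pintegralX p_pr 2 ib; have ibV2 := pintegralX p_pr 2 ibV.
have iEn := pintegralM p_pr iE in2; have iEnb := pintegralM p_pr iEn ib2.
have ihC := pintegralM p_pr ih iC2; have ihb := pintegralM p_pr ih ibV2.
have ip2 := pintegralX p_pr 2 (pintegral_nat p_pr p).
have im2 := pintegralN (pintegral_nat p_pr 2).
have it := pintegralB p_pr ihC iEnb.
apply: (eqmodq_cong p_pr).
  exact (pintegralD p_pr (pintegralM p_pr (pintegralM p_pr im2 in2) ib2) (pintegralM p_pr ip2 it)).
apply: (cong_trans p_pr (sun_sum_odd p_pr pE n1 (erefl n))).
set s := \sum_(i < q.+1) _.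
have is1 : pintegral p s.
  by apply: pintegral_sum => // i _; rewrite c1E (pintegral_sqrV p_pr pE n1).
have red_s : (ratr s : 'F_p) = \sum_(i < q.+1) (c1 'F_p i)^-1.
  rewrite red_sum // => [|i _]; last by rewrite c1E (pintegral_sqrV p_pr pE n1).
  by apply: eq_bigr => i _; rewrite !c1E (red_sqrV p_pr pE n1).
have ibs := pintegralM p_pr ib2 is1.
rewrite -/b; have -> : - 2 * n%:R ^+ 2 * b ^+ 2 + p%:R ^+ 2 / (2 * b ^+ 2) - p%:R ^+ 2 * b ^+ 2 * s =
  - 2 * n%:R ^+ 2 * b ^+ 2 + p%:R ^+ 2 * (2^-1 * b^-1 ^+ 2 - b ^+ 2 * s) by field; rewrite b0.
apply: congD => //; first exact: cong_refl.
apply: (@congMp _ 1 2).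
apply/(cong1_red p_pr (pintegralB p_pr ihb ibs) it).
rewrite (redB p_pr ihb ibs) (redB p_pr ihC iEnb) (redM p_pr ih ibV2) (redM p_pr ih iC2).
rewrite (redM p_pr ib2 is1) (redM p_pr iEn ib2) (redM p_pr iE in2).
rewrite (redX p_pr 2 ib) (redX p_pr 2 ibV) (redX p_pr 2 iC) (redX p_pr 2 inn).
rewrite (red_cbin p_pr pE n1) (red_cbinV p_pr pE n1 q2p) (redV p_pr C_nd) red_nat.
rewrite red_s ratr_int (euler_Fp p_pr p3 pq); set S := \sum_(i < q.+1) _.
have pF0 := Fp_char p_pr pE.
have four_n : 4 * n%:R ^+ 2 = 1 :> 'F_p.
  transitivity ((2 * n%:R + 1) * (2 * n%:R - 1) + 1 : 'F_p); first by ring.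
  by rewrite pF0 mul0r add0r.
have C2 := bin_odd_sqr_Fp p_pr p3 pq; rewrite -/C in C2.
have CV : (C%:R : 'F_p)^-1 ^+ 2 = (cbin 'F_p q)^-1 ^+ 2 by rewrite !exprVn C2.
have eS : 4 * S * n%:R ^+ 2 * cbin 'F_p q ^+ 2 = cbin 'F_p q ^+ 2 * S.
  by transitivity (4 * n%:R ^+ 2 * (cbin 'F_p q ^+ 2 * S)); [ring|rewrite four_n mul1r].
by rewrite CV eS.
Qed.

(** * Jacobi sums of Teichmueller characters *)

Lemma taylor2 (R : comPzRingType) (y a : R) m :
  exists w, (y + a) ^+ m = y ^+ m + m%:R * y ^+ m.-1 * a + a ^+ 2 * w.
Proof.
elim: m => [|m [w IHm]]; first by exists 0; rewrite !expr0; ring.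
case: m IHm => [|m] IHm; first by exists 0; rewrite !expr1 expr0; ring.
exists (y * w + m.+1%:R * y ^+ m + a * w).
by rewrite exprS IHm !exprS /= -!(nat1r m.+1); ring.
Qed.

Lemma conj_norm (R : comPzRingType) (a i b : R) :
  (a - i * b) * (a + i * b) = a ^+ 2 - i ^+ 2 * b ^+ 2.
Proof. by ring. Qed.

Lemma conj_quadratic (R : comPzRingType) (a i b : R) :
  (a - i * b) ^+ 2 - 2 * a * (a - i * b) + (a - i * b) * (a + i * b) = 0.
Proof. by ring. Qed.

Section Teichmuller.

Variables (p : nat) (p_pr : prime p).
Hypothesis p_gt3 : (3 < p)%N.

Local Notation F := 'F_p.
Local Notation R := ('Z_(expn p 4)).

Lemma p4_gt1 : (1 < p ^ 4)%N.
Proof. by rewrite -(exp1n 4) ltn_exp2r // prime_gt1. Qed.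

Lemma Zp4_char : p%:R ^+ 4 = 0 :> R.
Proof. by rewrite -natrX; apply: pchar_Zp p4_gt1. Qed.

Definition modp (x y : R) := exists z, x = y + p%:R * z.

(** Raising to the power p gains a factor p: the linear Taylor term acquires p, the others already
    contain p^(2k). *)
Lemma modp_pow k (x y z : R) : (0 < k)%N -> x = y + p%:R ^+ k * z ->
  exists z', x ^+ p = y ^+ p + p%:R ^+ k.+1 * z'.
Proof.
move=> k0 ->; have [w ->] := taylor2 y (p%:R ^+ k * z) p.
exists (y ^+ p.-1 * z + p%:R ^+ k.-1 * z ^+ 2 * w).
have e : p%:R ^+ k = p%:R * p%:R ^+ k.-1 :> R by rewrite -exprS prednK.
by rewrite (exprS _ k) !e; ring.
Qed.

Lemma modp_lift x y : modp x y -> x ^+ (p ^ 3) = y ^+ (p ^ 3).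
Proof.
case=> z xy; have [z1 e1] := @modp_pow 1 _ _ _ isT (xy : x = y + p%:R ^+ 1 * z).
have [z2 e2] := @modp_pow 2 _ _ _ isT e1; have [z3 e3] := @modp_pow 3 _ _ _ isT e2.
have -> : (p ^ 3 = p * (p * p))%N by rewrite !expnS expn0 muln1.
by move: e3; rewrite Zp4_char mul0r addr0 -!exprM.
Qed.

Lemma modp_refl x : modp x x.
Proof. by exists 0; rewrite mulr0 addr0. Qed.

Lemma modp_trans y x z : modp x y -> modp y z -> modp x z.
Proof. by case=> a -> [b ->]; exists (a + b); ring. Qed.

Lemma modp_sym x y : modp x y -> modp y x.
Proof. by case=> a ->; exists (- a); ring. Qed.

Lemma modpB x y z t : modp x y -> modp z t -> modp (x - z) (y - t).
Proof. by case=> a -> [b ->]; exists (a - b); ring. Qed.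

Lemma modp_nat (a b : nat) : a = b %[mod p] -> modp a%:R b%:R.
Proof.
move=> ab; exists ((a %/ p)%:R - (b %/ p)%:R).
by rewrite {1}(divn_eq a p) {1}(divn_eq b p) !natrD !natrM ab; ring.
Qed.

Lemma modp_fermat (a : nat) k : modp (a%:R ^+ (p ^ k)) a%:R.
Proof.
rewrite -natrX; apply: modp_nat; elim: k => [|k IHk]; first by rewrite expn1.
by rewrite expnS mulnC expnM fermat_little.
Qed.

(* The Teichmueller lift is the limit of k^(p^m), and m = 3 suffices mod p^4. *)
Definition teich (x : F) : R := (x : nat)%:R ^+ (p ^ 3).

Lemma teich_nat (k : nat) : teich k%:R = k%:R ^+ (p ^ 3).
Proof.
apply: modp_lift; apply: modp_nat.
by rewrite val_Fp_nat // modn_mod.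
Qed.

Lemma teich_lift (k : nat) (r : R) : modp r k%:R -> teich k%:R = r ^+ (p ^ 3).
Proof. by move=> rk; rewrite teich_nat; apply/modp_lift/modp_sym. Qed.

Lemma FpE (x : F) : x = (x : nat)%:R.
Proof. by rewrite natr_Zp. Qed.

Lemma teichM x y : teich (x * y) = teich x * teich y.
Proof. by rewrite {1}(FpE x) {1}(FpE y) -natrM teich_nat natrM exprMn. Qed.

Lemma teich1 : teich 1 = 1.
Proof. by rewrite (teich_nat 1) expr1n. Qed.

Lemma p3_gt0 : (0 < p ^ 3)%N.
Proof. by rewrite expn_gt0 prime_gt0. Qed.

Lemma teich0 : teich 0 = 0.
Proof. by rewrite (teich_nat 0) expr0n; case: (p ^ 3)%N p3_gt0. Qed.

Lemma teichX x k : teich (x ^+ k) = teich x ^+ k.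
Proof.
elim: k => [|k IHk]; first by rewrite !expr0 teich1.
by rewrite !exprS teichM IHk.
Qed.

Lemma odd_p : odd p.
Proof. by case: (even_prime p_pr) => // p2; move: p_gt3; rewrite p2. Qed.

Lemma Fp_p0 : p%:R = 0 :> F.
Proof. by apply/eqP; rewrite nat_Fp_eq0. Qed.

Lemma teichN1 : teich (-1) = -1.
Proof.
have -> : -1 = (p - 1)%:R :> F by rewrite natrB ?prime_gt0 // Fp_p0 sub0r.
rewrite (@teich_lift _ (-1)) ?sqrrN.
  by rewrite -signr_odd oddX odd_p /= expr1.
by exists (-1); rewrite natrB ?prime_gt0 //; ring.
Qed.

Lemma teichN x : teich (- x) = - teich x.
Proof. by rewrite -mulN1r teichM teichN1 mulN1r. Qed.

(** 1 - [teich x] is a lift of 1 - x, and any lift may be raised to the power p^3. The polynomial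
    form in [teich x] is what later turns [jac_one] into a binomial sum. *)
Lemma teichB x : teich (1 - x) = (1 - teich x) ^+ (p ^ 3).
Proof.
have -> : 1 - x = (1 + (p - 1) * (x : nat))%:R.
  by rewrite natrD natrM natrB ?prime_gt0 // Fp_p0 {1}(FpE x); ring.
apply: teich_lift; apply: (@modp_trans (1 - (x : nat)%:R)).
  by apply: modpB; [apply: modp_refl|apply: modp_fermat].
by exists (- (x : nat)%:R); rewrite natrD natrM natrB ?prime_gt0 //; ring.
Qed.

Lemma Fp_frob (x : F) : x ^+ p = x.
Proof. by have := expf_card x; rewrite card_Fp. Qed.

Lemma Fp_unit (x : F) : x != 0 -> x ^+ (p - 1) = 1.
Proof.
move=> x0; apply: (mulfI x0); rewrite -exprS mulr1.
have := expf_card x; rewrite card_Fp // subn1 prednK ?prime_gt0 //.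
Qed.

Lemma teich_unit x : x != 0 -> teich x ^+ (p - 1) = 1.
Proof. by move=> x0; rewrite -teichX Fp_unit // teich1. Qed.

(** A positive exponent makes even the trivial character vanish at 0, whereas 0^0 = 1 would break
    the period. *)
Lemma teich_period x e : (0 < e)%N -> teich x ^+ (p - 1 + e) = teich x ^+ e.
Proof.
move=> e0; have [->|x0] := eqVneq x 0; last by rewrite exprD teich_unit // mul1r.
by rewrite teich0 !expr0n addn_eq0 (gtn_eqF e0) andbF.
Qed.

(** X^r - 1 has at most r roots. This serves in place of a primitive root. *)
Lemma exists_nonroot r : (0 < r < p - 1)%N -> exists2 y : F, y != 0 & y ^+ r != 1.
Proof.
move=> /andP [r0 rp].
case: (pickP (fun y : F => (y != 0) && (y ^+ r != 1))) => [y /andP [y0 yr]|H]; first by exists y.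
have sz : size ('X^r - 1%:P : {poly F}) = r.+1 by rewrite size_XnsubC.
have nz : ('X^r - 1%:P : {poly F}) != 0 by rewrite -size_poly_gt0 sz.
have := max_poly_roots nz (rs := [seq x <- enum F | x != 0]).
rewrite filter_uniq ?enum_uniq // sz => /(_ _ isT).
have -> : size [seq x <- enum F | x != 0] = (p - 1)%N.
  have := cardC1 (0 : F); rewrite card_Fp // => e.
  by rewrite subn1 -e cardE /enum_mem; congr size; rewrite -filter_predI; apply: eq_filter => x /=; rewrite !inE andbT.
move=> /(_ _) h; have: (p - 1 < r.+1)%N; last by lia.
apply: h; apply/allP => x; rewrite mem_filter => /andP [x0 _].
rewrite /root !hornerE subr_eq0.
by have := H x; rewrite /= x0 /= => /negbFE.
Qed.

Lemma Zp4_unit (k : nat) : ~~ (p %| k)%N -> (k%:R : R) \is a GRing.unit.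
Proof.
move=> pk; rewrite unitZpE ?p4_gt1 // coprimeXl //.
by rewrite prime_coprime.
Qed.

Lemma teich_sum k : (0 < k)%N ->
  \sum_x teich x ^+ k = if (p - 1 %| k)%N then (p - 1)%:R else 0.
Proof.
move=> k0; case: ifP => [/dvdnP [m em]|pk].
  rewrite (bigD1 0) //= teich0 expr0n (gtn_eqF k0) add0r.
  rewrite (eq_bigr (fun => 1)) => [|x x0]; last first.
    by rewrite em mulnC exprM teich_unit // expr1n.
  by rewrite sumr_const cardC1 card_Fp // subn1.
have [|y y0 yr] := @exists_nonroot (k %% (p - 1)).
  by rewrite lt0n -/(dvdn _ _) pk ltn_mod; lia.
(* The ring has zero divisors, so this factor must be a unit; it is one because it is nonzero modulo
   p. *)
have uy : teich y ^+ k - 1 \is a GRing.unit.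
  have y_gt0 : (0 < (y : nat))%N by rewrite lt0n.
  have -> : teich y ^+ k - 1 = ((y : nat) ^ (p ^ 3 * k) - 1)%:R.
    by rewrite natrB ?expn_gt0 ?y_gt0 // natrX exprM.
  apply: Zp4_unit; rewrite -nat_Fp_eq0 // natrB ?expn_gt0 ?y_gt0 // natrX -FpE exprM.
  have -> : y ^+ (p ^ 3) = y.
    by rewrite !expnS expn0 muln1 !exprM !Fp_frob.
  rewrite subr_eq0; apply: contra yr => /eqP e; apply/eqP; transitivity (y ^+ k); last exact: e.
  by rewrite {2}(divn_eq k (p - 1)) exprD mulnC exprM Fp_unit // expr1n mul1r.
apply: (mulrI uy); rewrite mulr0 mulrBl mul1r.
apply/eqP; rewrite subr_eq0; apply/eqP.
rewrite mulr_sumr [RHS](reindex_inj (mulfI y0)).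
by apply: eq_bigr => x _; rewrite teichM exprMn.
Qed.

Definition jacobi (a b : nat) : R := \sum_x teich x ^+ a * teich (1 - x) ^+ b.

(** Sum over x + y + z = 1. It is symmetric, and grouping two of its variables in different ways
    relates products of two-variable sums. *)
Definition jacobi3 (a b c : nat) : R :=
  \sum_x \sum_y teich x ^+ a * (teich y ^+ b * teich (1 - x - y) ^+ c).

Lemma reindex_oppD (s : F) (f : F -> R) : \sum_x f x = \sum_x f (s - x).
Proof.
have inj : injective (fun x : F => s - x) by move=> x y /addrI /oppr_inj.
exact: (reindex_inj inj).
Qed.

Lemma jacobiC a b : jacobi a b = jacobi b a.
Proof.
rewrite /jacobi (reindex_oppD 1); apply: eq_bigr => x _.
by rewrite mulrC opprB addrCA subrr addr0.
Qed.

Lemma jacobi3_swap a b c : jacobi3 a b c = jacobi3 b a c.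
Proof.
rewrite /jacobi3 exchange_big; apply: eq_bigr => x _; apply: eq_bigr => y _.
by rewrite mulrCA addrAC.
Qed.

Lemma jacobi3_last a b c : jacobi3 a b c = jacobi3 a c b.
Proof.
apply: eq_bigr => x _; rewrite (reindex_oppD (1 - x)); apply: eq_bigr => y _.
by rewrite opprB addrCA subrr addr0 [teich (_ - _) ^+ _ * _]mulrC.
Qed.

Lemma convolution s b c : s != 0 ->
  \sum_y teich y ^+ b * teich (s - y) ^+ c = teich s ^+ (b + c) * jacobi b c.
Proof.
move=> s0; rewrite (reindex_inj (mulfI s0)) mulr_sumr; apply: eq_bigr => y _.
have -> : s - s * y = s * (1 - y) by ring.
by rewrite !teichM !exprMn exprD; ring.
Qed.

Lemma convolution0 b c : (0 < b + c)%N ->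
  \sum_y teich y ^+ b * teich (0 - y) ^+ c = (-1) ^+ c * \sum_y teich y ^+ (b + c).
Proof.
move=> bc; rewrite mulr_sumr; apply: eq_bigr => y _.
by rewrite sub0r teichN (exprNn (teich y)) exprD mulrCA.
Qed.

Lemma jacobi3E a b c : (0 < b + c)%N -> ~~ (p - 1 %| b + c)%N ->
  jacobi3 a b c = jacobi b c * jacobi a (b + c).
Proof.
move=> bc0 bc; rewrite /jacobi3 {2}/jacobi mulr_sumr; apply: eq_bigr => x _.
rewrite -mulr_sumr; have [->|x1] := eqVneq (1 - x) 0.
  by rewrite convolution0 // teich_sum // (negPf bc) teich0 expr0n (gtn_eqF bc0) !mulr0.
by rewrite convolution // mulrA mulrC.
Qed.

Lemma teich_dvd x e : x != 0 -> (p - 1 %| e)%N -> teich x ^+ e = 1.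
Proof. by move=> x0 /dvdnP [m ->]; rewrite mulnC exprM teich_unit // expr1n. Qed.

(** When the exponents add up to the trivial one, x^b (1 - x)^c = (1/x - 1)^c, and y = 1/x misses
    only 0. *)
Lemma jacobi_trivial b c : (0 < b)%N -> (0 < c)%N -> (p - 1 %| b + c)%N ->
  ~~ (p - 1 %| c)%N -> jacobi b c = - (-1) ^+ c.
Proof.
move=> b0 c0 bc nc; rewrite /jacobi (reindex_inj (@invr_inj F)) (bigD1 0) //=.
rewrite invr0 teich0 expr0n (gtn_eqF b0) mul0r add0r.
transitivity (\sum_(y | y != 0) teich (y - 1) ^+ c).
  apply: eq_bigr => y y0; have -> : 1 - y^-1 = (y - 1) * y^-1 by field.
  by rewrite teichM exprMn mulrCA -exprD (@teich_dvd y^-1 (b + c)) ?invr_eq0 // mulr1.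
have : \sum_y teich (y - 1) ^+ c = 0.
  transitivity (\sum_y teich y ^+ c); last by rewrite teich_sum // (negPf nc).
  by rewrite [RHS](reindex_inj (@addIr F (-1))).
rewrite (bigD1 0) //= sub0r teichN1 addrC => /eqP; rewrite addr_eq0 => /eqP.
by [].
Qed.

(** The line x = 1 contributes (p - 1) (-1)^c; on each other line the inner sum is -(-1)^c, and the
    remaining sum of characters is -1. *)
Lemma jacobi3_trivial a b c : (0 < a)%N -> (0 < b)%N -> (0 < c)%N ->
  (p - 1 %| b + c)%N -> ~~ (p - 1 %| a)%N -> ~~ (p - 1 %| c)%N ->
  jacobi3 a b c = p%:R * (-1) ^+ c.
Proof.
move=> a0 b0 c0 bc na nc; rewrite /jacobi3.
have bc0 : (0 < b + c)%N by rewrite addn_gt0 b0.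
under eq_bigr => x _ do rewrite -mulr_sumr.
rewrite (bigD1 1) //= subrr convolution0 // teich_sum // bc teich1 expr1n mul1r.
have := teich_sum a0; rewrite (negPf na) (bigD1 1) //= teich1 expr1n => /eqP.
rewrite addrC addr_eq0 => /eqP sa.
rewrite (eq_bigr (fun x => teich x ^+ a * jacobi b c)) => [|x x1]; last first.
  have s0 : 1 - x != 0 by rewrite subr_eq0 eq_sym.
  by rewrite convolution // (@teich_dvd (1 - x) (b + c)) // mul1r.
by rewrite -mulr_suml sa jacobi_trivial // natrB ?prime_gt0 //; ring.
Qed.

Variable n : nat.
Hypothesis pE : p = (2 * n + 1)%N.

Lemma p1E : (p - 1 = 2 * n)%N.
Proof. by rewrite pE addnK. Qed.

Lemma ndvd_p1 k : (0 < k < p - 1)%N -> ~~ (p - 1 %| k)%N.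
Proof. by move=> /andP [k0 kp]; apply/negP => /(dvdn_leq k0); lia. Qed.

(** With omega the Teichmueller character, these are J(omega^n, omega^(-a)) and J(omega,
    omega^(-c)). The alpha of the overview is [jac_half q]. *)
Definition jac_half (a : nat) : R := jacobi n (p - 1 - a).
Definition jac_one (c : nat) : R := jacobi 1 (p - 1 - c).

Lemma jacobi_period a b : (0 < b)%N -> jacobi a (p - 1 + b) = jacobi a b.
Proof. by move=> b0; apply: eq_bigr => x _; rewrite teich_period. Qed.

(** Both sides are the triple sum with exponents 1, n, -a, grouped in two ways; -(a + n) and n - a
    agree modulo p - 1 = 2n. *)
Lemma jac_rec a : (1 < a < n)%N ->
  jac_half a * jac_one (a + n) = jac_half a.-1 * jac_one a.
Proof.
move=> /andP [a1 an].
have -> : jac_one (a + n) = jacobi 1 (n + (p - 1 - a)).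
  rewrite /jac_one (_ : n + (p - 1 - a) = p - 1 + (p - 1 - (a + n)))%N; last lia.
  by rewrite jacobi_period //; lia.
have -> : jac_half a.-1 = jacobi n (p - 1 - a + 1).
  by rewrite /jac_half; congr (jacobi _ _); lia.
rewrite /jac_half /jac_one -jacobi3E; try lia; last first.
  by rewrite (_ : n + (p - 1 - a) = p - 1 + (n - a))%N ?dvdn_addr ?ndvd_p1 //; lia.
rewrite [jacobi 1 (p - 1 - a)]jacobiC mulrC -jacobi3E; try lia; last first.
  by apply: ndvd_p1; lia.
by rewrite jacobi3_swap jacobi3_last.
Qed.

Lemma jac_rec1 : jac_half 1 * jac_one (1 + n) = - p%:R.
Proof.
have -> : jac_one (1 + n) = jacobi 1 (n + (p - 1 - 1)).
  rewrite /jac_one (_ : n + (p - 1 - 1) = p - 1 + (p - 1 - (1 + n)))%N; last lia.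
  by rewrite jacobi_period //; lia.
rewrite /jac_half -jacobi3E; try lia; last first.
  by rewrite (_ : n + (p - 1 - 1) = p - 1 + (n - 1))%N ?dvdn_addr ?ndvd_p1 //; lia.
rewrite jacobi3_swap jacobi3_trivial ?ndvd_p1 //; try lia; last first.
  by rewrite (_ : 1 + (p - 1 - 1) = p - 1)%N ?dvdnn //; lia.
rewrite (_ : p - 1 - 1 = 2 * (n - 1) + 1)%N; last lia.
by rewrite exprD exprM sqrrN !expr1n expr1 mul1r mulrN1.
Qed.

Variable q : nat.
Hypothesis nE : n = (2 * q)%N.

(** The triple (n, n, -q): grouping n with -q gives n - q = q, while n + n is trivial. *)
Lemma jac_conj : jac_half q * jacobi n q = p%:R.
Proof.
have -> : jacobi n q = jacobi n (n + (p - 1 - q)).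
  rewrite (_ : n + (p - 1 - q) = p - 1 + q)%N; last lia.
  by rewrite jacobi_period //; lia.
rewrite /jac_half -jacobi3E; try lia; last first.
  by rewrite (_ : n + (p - 1 - q) = p - 1 + q)%N ?dvdn_addr ?ndvd_p1 //; lia.
rewrite jacobi3_last jacobi3_swap jacobi3_trivial ?ndvd_p1 //; try lia; last first.
  by rewrite (_ : n + n = p - 1)%N //; lia.
by rewrite nE exprM sqrrN !expr1n mulr1.
Qed.

(** Integer-valued, so that the parts of the Jacobi sum are integers and congruences between them
    can be settled by size. *)
Definition sign_of (z : F) : int := (z == 1)%:Z - (z == -1)%:Z.

Lemma Fp_1N1 : (1 == -1 :> F) = false.
Proof.
apply/negbTE; rewrite -subr_eq0 opprK -(natrD _ 1 1) nat_Fp_eq0 //.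
by apply/negP => /(dvdn_leq (ltn0Sn 1)); lia.
Qed.

Lemma sign_of0 : sign_of 0 = 0.
Proof. by rewrite /sign_of eq_sym oner_eq0 eq_sym oppr_eq0 oner_eq0. Qed.

Lemma sign_of1 : sign_of 1 = 1.
Proof. by rewrite /sign_of eqxx Fp_1N1. Qed.

Lemma sign_ofN1 : sign_of (-1) = -1.
Proof. by rewrite /sign_of eqxx eq_sym Fp_1N1. Qed.

Lemma sqr_sign_of (z : F) : z ^+ 2 = 1 -> (z = 1 \/ z = -1).
Proof.
by move=> /eqP; rewrite sqrf_eq1 => /orP [] /eqP ->; [left|right].
Qed.

Lemma teich_sign (z : F) : z = 0 \/ z ^+ 2 = 1 -> teich z = (sign_of z)%:~R.
Proof.
case=> [->|/sqr_sign_of [] ->]; first by rewrite teich0 sign_of0.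
  by rewrite teich1 sign_of1.
by rewrite teichN1 sign_ofN1.
Qed.

Lemma sign_of_sqrN1 (z : F) : z ^+ 2 = -1 -> sign_of z = 0.
Proof.
rewrite /sign_of; case: eqP => [->|_]; first by rewrite expr1n => /eqP; rewrite Fp_1N1.
by case: eqP => [->|_] //; rewrite sqrrN expr1n => /eqP; rewrite Fp_1N1.
Qed.

Lemma sign_of_cases z : [\/ sign_of z = 0, sign_of z = 1 | sign_of z = -1].
Proof.
rewrite /sign_of; have [->|_] := eqVneq z 1; first by rewrite Fp_1N1; constructor 2.
by case: (z == -1); [constructor 3|constructor 1].
Qed.

Lemma q_gt0 : (0 < q)%N. Proof. by move: nE pE p_gt3; case: q => // -> ->. Qed.

Lemma pow_half x : x = 0 :> F \/ x ^+ n = 1 \/ x ^+ n = -1.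
Proof.
have [->|x0] := eqVneq x 0; [by left|right].
by apply: sqr_sign_of; rewrite -exprM mulnC -p1E Fp_unit.
Qed.

Lemma pow_half_sign x : x ^+ n = 0 \/ (x ^+ n) ^+ 2 = 1 :> F.
Proof.
have n0 : (0 < n)%N by rewrite nE muln_gt0 q_gt0.
case: (pow_half x) => [->|[->|->]]; first by left; rewrite expr0n (gtn_eqF n0).
  by right; rewrite expr1n.
by right; rewrite sqrrN expr1n.
Qed.

(** * Integral real and imaginary parts of the quartic Jacobi sum *)

Section Quartic.

Variable g : F.
Hypothesis gn : g ^+ n = -1.

Lemma g_neq0 : g != 0.
Proof.
apply/eqP => g0; have n0 : (0 < n)%N by rewrite nE muln_gt0 q_gt0.
by move/eqP: gn; rewrite g0 expr0n (gtn_eqF n0) eq_sym oppr_eq0 oner_eq0.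
Qed.

Lemma quartic_root : (teich g ^+ q) ^+ 2 = -1.
Proof. by rewrite -exprM mulnC -nE -teichX gn teichN1. Qed.

Lemma quartic_cases x : x != 0 ->
  [/\ x ^+ n = 1, (x ^+ q) ^+ 2 = 1 & sign_of ((x / g) ^+ q) = 0] \/
  [/\ x ^+ n = -1, sign_of (x ^+ q) = 0 & ((x / g) ^+ q) ^+ 2 = 1].
Proof.
move=> x0; have sq y : (y ^+ q) ^+ 2 = y ^+ n :> F by rewrite -exprM mulnC -nE.
have e : (x / g) ^+ n = - (x ^+ n) by rewrite exprMn exprVn gn invrN1 mulrN1.
case: (pow_half x) => [/eqP|[xn|xn]]; first by rewrite (negPf x0).
  by left; rewrite sq xn; split=> //; apply: sign_of_sqrN1; rewrite sq e xn.
by right; rewrite sq e xn opprK; split=> //; apply: sign_of_sqrN1; rewrite sq xn.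
Qed.

(** The quartic character is 1 or -1 on nonzero squares and i or -i on nonsquares, where i =
    [teich g ^+ q]. For a nonsquare x, x / g is a square, which makes the second sign the nonzero
    one. *)
Lemma teich_quartic x :
  teich x ^+ q = (sign_of (x ^+ q))%:~R + teich g ^+ q * (sign_of ((x / g) ^+ q))%:~R.
Proof.
have q0 := q_gt0.
have [->|x0] := eqVneq x 0.
  by rewrite mul0r expr0n (gtn_eqF q0) sign_of0 teich0 expr0n (gtn_eqF q0) mulr0 addr0.
rewrite -!teichX; case: (quartic_cases x0) => [[_ h ->]|[_ -> h]].
  by rewrite mulr0 addr0 teich_sign //; right.
by rewrite add0r -teich_sign; [rewrite -teichM -exprMn mulrC divfK ?g_neq0|right].
Qed.

Lemma sign_quartic_mul x : sign_of (x ^+ q) * sign_of ((x / g) ^+ q) = 0.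
Proof.
have q0 := q_gt0.
have [->|x0] := eqVneq x 0; first by rewrite expr0n (gtn_eqF q0) sign_of0 mul0r.
by case: (quartic_cases x0) => [[_ _ ->]|[_ -> _]]; rewrite ?mulr0 ?mul0r.
Qed.

Lemma sign_of_cube z : sign_of z ^+ 3 = sign_of z.
Proof. by case: (sign_of_cases z) => ->. Qed.

(** Cubing is complex conjugation on 0, 1, -1, i, -i. *)
Lemma teich_quartic3 x :
  teich x ^+ (3 * q) = (sign_of (x ^+ q))%:~R - teich g ^+ q * (sign_of ((x / g) ^+ q))%:~R.
Proof.
rewrite mulnC exprM teich_quartic.
set s := sign_of _; set t := sign_of _; set i := teich g ^+ q.
have i2 : i ^+ 2 = -1 := quartic_root.
have st : s%:~R * t%:~R = 0 :> R by rewrite -intrM sign_quartic_mul.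
have s3 : s%:~R ^+ 3 = s%:~R :> R by rewrite -rmorphXn sign_of_cube.
have t3 : t%:~R ^+ 3 = t%:~R :> R by rewrite -rmorphXn sign_of_cube.
transitivity (s%:~R ^+ 3 + i ^+ 2 * i * t%:~R ^+ 3 + 3 * (s%:~R * t%:~R) * (i * s%:~R + i ^+ 2 * t%:~R)).
  by ring.
by rewrite st i2 s3 t3; ring.
Qed.

Definition jac_re : int := \sum_x sign_of (x ^+ q) * sign_of ((1 - x) ^+ n).
Definition jac_im : int := \sum_x sign_of ((x / g) ^+ q) * sign_of ((1 - x) ^+ n).

Lemma teich_half x : teich x ^+ n = (sign_of (x ^+ n))%:~R.
Proof. by rewrite -teichX teich_sign //; apply: pow_half_sign. Qed.

Lemma jac_half_E : jac_half q = jac_re%:~R - teich g ^+ q * jac_im%:~R.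
Proof.
rewrite /jac_half jacobiC (_ : p - 1 - q = 3 * q)%N; last lia.
rewrite /jac_re /jac_im !rmorph_sum /= mulr_sumr -sumrB; apply: eq_bigr => x _.
by rewrite teich_quartic3 teich_half !intrM; ring.
Qed.

Lemma jac_half_conjE : jacobi n q = jac_re%:~R + teich g ^+ q * jac_im%:~R.
Proof.
rewrite jacobiC /jac_re /jac_im !rmorph_sum /= mulr_sumr -big_split; apply: eq_bigr => x _ /=.
by rewrite teich_quartic teich_half !intrM; ring.
Qed.

Lemma jac_norm_le (f : F -> int) : (forall x, `|f x| <= 1) -> `|\sum_x f x| <= p%:Z.
Proof.
move=> f1; apply: le_trans (ler_norm_sum _ _ _) _.
apply: (le_trans (ler_sum (G := fun => 1) _ (fun x _ => f1 x))).
by rewrite sumr_const card_Fp // natz.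
Qed.

Lemma sign_of_le y z : `|sign_of y * sign_of z| <= 1.
Proof. by case: (sign_of_cases y) => ->; case: (sign_of_cases z) => ->. Qed.

(** The equality holds modulo p^4, and both sides are nonnegative and below p^4, as |A|, |B| <= p
    gives at most 2 p^2. *)
Lemma jac_norm : jac_re ^+ 2 + jac_im ^+ 2 = p%:Z.
Proof.
set A := jac_re; set B := jac_im.
have eR : (A ^+ 2 + B ^+ 2)%:~R = (p%:Z)%:~R :> R.
  transitivity (jac_half q * jacobi n q); last by rewrite jac_conj.
  rewrite jac_half_E jac_half_conjE -/A -/B.
  by rewrite conj_norm quartic_root intrD !(rmorphXn intr) mulN1r opprK.
have leA : `|A| <= p%:Z by apply: jac_norm_le => x; apply: sign_of_le.
have leB : `|B| <= p%:Z by apply: jac_norm_le => x; apply: sign_of_le.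
have eN : A ^+ 2 + B ^+ 2 = (`|A| ^ 2 + `|B| ^ 2)%N%:Z.
  have h (z : int) : z ^+ 2 = (`|z| ^ 2)%N%:Z.
    by rewrite -mulnn PoszM !abszE -normrM -expr2 ger0_norm ?sqr_ge0.
  by rewrite PoszD !h.
rewrite eN; congr Posz.
have e : (`|A| ^ 2 + `|B| ^ 2)%N%:R = p%:R :> R by move: eR; rewrite eN.
have := congr1 (@nat_of_ord _) e; rewrite !val_Zp_nat ?p4_gt1 // !modn_small //.
  by rewrite -{1}(expn1 p) ltn_exp2l // prime_gt1.
move: leA leB; rewrite -!abszE !lez_nat => leA leB.
have p2 : (2 < p)%N by lia.
apply: (@leq_ltn_trans (p ^ 2 + p ^ 2)); first by rewrite leq_add // leq_exp2r.
apply: (@leq_trans (p * p ^ 2)); first by rewrite addnn -mul2n ltn_pmul2r // expn_gt0 prime_gt0.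
by rewrite -expnS leq_exp2l // prime_gt1.
Qed.

Lemma two_square_class (x : F) :
  2 * ((x ^+ n == 1)%:R : nat)%:R = teich x ^+ (p - 1) + teich x ^+ n.
Proof.
have n0 : (0 < n)%N by rewrite nE muln_gt0 q_gt0.
rewrite p1E mulnC exprM teich_half.
case: (pow_half x) => [->|[]->].
- by rewrite (expr0n _ n) (gtn_eqF n0) sign_of0 eq_sym oner_eq0 /= mulr0 addr0 expr0n.
- by rewrite sign_of1 eqxx /=; ring.
- by rewrite sign_ofN1 eq_sym Fp_1N1 /=; ring.
Qed.

Lemma sum_square_class : \sum_(x : F) (x ^+ n == 1)%:R = n :> nat.
Proof.
have n0 : (0 < n)%N by rewrite nE muln_gt0 q_gt0.
set N := \sum_x _.
have N_le : (N <= p)%N.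
  apply: (@leq_trans (\sum_(x : F) 1)); last by rewrite sum1_card card_Fp.
  by apply: leq_sum => x _; case: eqP.
have e : (2 * N)%:R = (2 * n)%:R :> R.
  have := teich_sum n0; rewrite (negPf (ndvd_p1 _)); last by rewrite p1E; lia.
  have p1 : \sum_(x : F) teich x ^+ (p - 1) = (p - 1)%:R.
    by rewrite teich_sum ?dvdnn // p1E muln_gt0.
  rewrite -p1E -p1 => s0; rewrite -[RHS]addr0 -[X in _ + X]s0 -big_split /= natrM natr_sum mulr_sumr.
  by apply: eq_bigr => x _; rewrite two_square_class p1E.
have := congr1 (@nat_of_ord _) e; rewrite !val_Zp_nat ?p4_gt1 // !modn_small; first lia.
  rewrite -p1E; apply: (@leq_ltn_trans p); first by rewrite leq_subr.
  by rewrite -{1}(expn1 p) ltn_exp2l // prime_gt1.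
apply: (@leq_ltn_trans (p ^ 2)); last by rewrite ltn_exp2l // prime_gt1.
by rewrite expnS expn1 leq_mul //; lia.
Qed.

(** Only nonzero squares x other than 1 contribute, each with 1 or -1; there are n - 1 of them, an
    odd number. *)
Lemma jac_re_odd : exists m : int, jac_re = 2 * m + 1.
Proof.
have q0 := q_gt0; have n0 : (0 < n)%N by rewrite nE muln_gt0.
pose d (x : F) : int := ((x ^+ n == 1) && (x != 1))%:R.
have step x : exists m : int, sign_of (x ^+ q) * sign_of ((1 - x) ^+ n) = d x + 2 * m.
  rewrite /d; have [->|x1] := eqVneq x 1.
    by exists 0; rewrite subrr (expr0n _ n) (gtn_eqF n0) sign_of0 andbF mulr0.
  have [->|x0] := eqVneq x 0.
    by exists 0; rewrite !expr0n (gtn_eqF n0) (gtn_eqF q0) sign_of0 mul0r eq_sym oner_eq0.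
  have s1 : sign_of ((1 - x) ^+ n) = 1 \/ sign_of ((1 - x) ^+ n) = -1.
    case: (pow_half (1 - x)) => [/eqP|[->|->]].
    - by rewrite subr_eq0 eq_sym (negPf x1).
    - by left; rewrite sign_of1.
    - by right; rewrite sign_ofN1.
  case: (quartic_cases x0) => [[xn h _]|[xn -> _]].
    rewrite xn eqxx /=.
    by case: (sqr_sign_of h) => ->; rewrite ?sign_of1 ?sign_ofN1; case: s1 => ->; [exists 0|exists (-1)|exists (-1)|exists 0].
  by exists 0; rewrite xn eq_sym Fp_1N1 mul0r.
have [f hf] : exists f : F -> int, forall x, sign_of (x ^+ q) * sign_of ((1 - x) ^+ n) = d x + 2 * f x.
  exists (fun x => ((sign_of (x ^+ q) * sign_of ((1 - x) ^+ n) - d x) %/ 2)%Z) => x.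
  by have [m ->] := step x; rewrite addrAC subrr add0r mulKz.
have sd : \sum_x d x = n%:Z - 1.
  have -> : n%:Z = \sum_(x : F) (x ^+ n == 1)%:R.
    transitivity (((\sum_(x : F) (x ^+ n == 1)%:R)%R : nat)%:R : int).
      by rewrite sum_square_class natz.
    by rewrite natr_sum; apply: eq_bigr => x _; case: (_ == _).
  rewrite (bigD1 1) //= [in RHS](bigD1 1) //= /d expr1n eqxx andbF addrAC subrr !add0r.
  by apply: eq_bigr => x ->; rewrite andbT.
exists (q%:Z - 1 + \sum_x f x).
rewrite /jac_re (eq_bigr _ (fun x _ => hf x)) big_split /= sd -mulr_sumr.
have -> : n%:Z = 2 * q%:Z by rewrite nE PoszM.
by ring.
Qed.

Lemma jac_half_quadratic : jac_half q ^+ 2 - 2 * jac_re%:~R * jac_half q + p%:R = 0.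
Proof.
have := jac_conj; rewrite jac_half_conjE => <-; rewrite jac_half_E.
exact: conj_quadratic.
Qed.

End Quartic.

Lemma jac_half_root : exists A B : int, [/\ (exists m, A = 2 * m + 1),
  A ^+ 2 + B ^+ 2 = p%:Z & jac_half q ^+ 2 - 2 * A%:~R * jac_half q + p%:R = 0].
Proof.
have [|g g0 gn] := @exists_nonroot n; first by rewrite p1E nE; lia.
have gn1 : g ^+ n = -1.
  case: (pow_half g) => [/eqP|[/eqP|//]]; first by rewrite (negPf g0).
  by rewrite (negPf gn).
exists jac_re, (jac_im g); split; first exact: (jac_re_odd gn1).
  exact: (jac_norm gn1).
exact: (jac_half_quadratic gn1).
Qed.

End Teichmuller.

(** * Harmonic sums *)

Definition harm (s m : nat) : rat := \sum_(i < m) i.+1%:R^-1 ^+ s.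

Lemma harm0 s : harm s 0 = 0. Proof. by rewrite /harm big_ord0. Qed.

Lemma harmS s m : harm s m.+1 = harm s m + (1 + m%:R)^-1 ^+ s.
Proof. by rewrite /harm big_ord_recr /= nat1r. Qed.

Lemma nat1_neq0 m : 1 + m%:R != 0 :> rat.
Proof. by rewrite nat1r pnatr_eq0. Qed.

Lemma harm_cat s m k : harm s (m + k) = harm s m + \sum_(i < k) (m + i).+1%:R^-1 ^+ s.
Proof. by rewrite /harm big_split_ord. Qed.

(** Raising c by one adds the sum of 1 / (i (c + 1 - i)) for 0 < i <= c, which partial fractions
    evaluate. *)
Lemma harm_convolution c :
  \sum_(i < c) harm 1 (c - i.+1) / i.+1%:R = harm 1 c ^+ 2 - harm 2 c.
Proof.
elim: c => [|c IHc]; first by rewrite big_ord0 !harm0; ring.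
rewrite big_ord_recr /= subnn harm0 mul0r addr0.
have inv_pair : \sum_(i < c) ((c - i)%:R^-1 / i.+1%:R) = 2 * harm 1 c / (1 + c%:R) :> rat.
  have split_pair (i : 'I_c) :
      (c - i)%:R^-1 / i.+1%:R = ((c - i)%:R^-1 + i.+1%:R^-1) / (1 + c%:R) :> rat.
    have ci : (c - i)%:R != 0 :> rat by rewrite pnatr_eq0 subn_eq0 -ltnNge.
    have i0 := nat1_neq0 i; have c0 := nat1_neq0 c.
    have -> : 1 + c%:R = (c - i)%:R + (1 + i%:R) :> rat.
      by rewrite natrB 1?ltnW //; ring.
    rewrite -(nat1r i); field.
    by rewrite ci i0 -(_ : 1 + c%:R = (c - i)%:R + (1 + i%:R)) ?c0 // natrB 1?ltnW //; ring.
  rewrite (eq_bigr _ (fun i _ => split_pair i)) -mulr_suml big_split /=; congr (_ / _).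
  have -> : \sum_(i < c) (c - i)%:R^-1 = harm 1 c.
    rewrite /harm (reindex_inj rev_ord_inj) /=; apply: eq_bigr => i _.
    by rewrite subKn // expr1.
  by rewrite /harm; under [X in _ = 2 * X]eq_bigr do rewrite expr1; rewrite mulr_natl mulr2n.
transitivity (\sum_(i < c) (harm 1 (c - i.+1) / i.+1%:R + (c - i)%:R^-1 / i.+1%:R)).
  apply: eq_bigr => i _; rewrite subSS (_ : c - i = (c - i.+1).+1)%N; last by have := ltn_ord i; lia.
  by rewrite harmS expr1 nat1r mulrDl.
rewrite big_split /= IHc inv_pair !harmS !expr1.
by have c0 := nat1_neq0 c; field.
Qed.

Lemma harm_self_sum m : \sum_(i < m) harm 1 i.+1 / i.+1%:R = (harm 1 m ^+ 2 + harm 2 m) / 2.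
Proof.
elim: m => [|m IHm]; first by rewrite big_ord0 !harm0; ring.
rewrite big_ord_recr /= IHm !harmS -(nat1r m) expr1.
by have m0 := nat1_neq0 m; field.
Qed.

Section HarmonicMod.

Variables (p : nat) (p_pr : prime p).
Hypothesis p_gt3 : (3 < p)%N.

Local Notation F := 'F_p.

Lemma ndvd_lt k : (0 < k < p)%N -> ~~ (p %| k)%N.
Proof. by move=> /andP [k0 kp]; apply/negP => /(dvdn_leq k0); rewrite leqNgt kp. Qed.

Lemma pint_inv k : (0 < k < p)%N -> pintegral p k%:R^-1.
Proof. by move=> kp; apply: pintegralV; apply: ndvd_lt. Qed.

Lemma pint_harm s m : (m < p)%N -> pintegral p (harm s m).
Proof.
move=> mp; apply: pintegral_sum => // i _; apply: pintegralX => //.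
by apply: pint_inv; rewrite /= (leq_ltn_trans (ltn_ord i) mp).
Qed.

Lemma red_harm s m : (m < p)%N ->
  ratr (harm s m) = \sum_(i < m) (i.+1%:R : F)^-1 ^+ s.
Proof.
move=> mp; have hi (i : 'I_m) : (0 < i.+1 < p)%N by have := ltn_ord i; lia.
have ii (i : 'I_m) := pint_inv (hi i).
rewrite red_sum // => [|i _]; last exact: pintegralX.
by apply: eq_bigr => i _; rewrite (redX p_pr s (ii i)) redV // ndvd_lt.
Qed.

Lemma harm2_p1 : cong p 1 (harm 2 p.-1) 0.
Proof.
have pp : (p.-1 < p)%N by rewrite ltn_predL prime_gt0.
apply/(cong1_red p_pr (pint_harm 2 pp) (pintegral0 p_pr)).
rewrite red_harm // (red_nat p 0).
have := sum_FpV2 p_pr p_gt3; rewrite -(sum_Fp _ p_pr).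
have gen (f : nat -> F) P : (0 < P)%N -> \sum_(i < P) f i = f 0%N + \sum_(i < P.-1) f i.+1.
  by case: P => // P _; rewrite big_ord_recl.
rewrite (gen (fun i => i%:R ^- 2)) ?prime_gt0 // expr0n invr0 add0r => e.
by rewrite -[RHS]e; apply: eq_bigr => i _; rewrite exprVn.
Qed.

(* By 1 / (p - i) = - 1 / i - p / i^2 mod p^2. *)
Lemma harm1_refl m : (m < p)%N ->
  cong p 2 (harm 1 p.-1) (harm 1 (p.-1 - m) - harm 1 m - p%:R * harm 2 m).
Proof.
move=> mp.
have -> : harm 1 p.-1 = harm 1 (p.-1 - m) + \sum_(i < m) (p - i.+1)%:R^-1.
  have := harm_cat 1 (p.-1 - m) m; rewrite subnK ?[harm 1 (_ - _ + _)]/harm; last lia.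
  move=> ->; congr (_ + _); rewrite (reindex_inj rev_ord_inj) /=; apply: eq_bigr => i _.
  by rewrite expr1; congr (_%:R^-1); have := ltn_ord i; lia.
rewrite -addrA -opprD; apply: congD => //; first exact: cong_refl.
rewrite /harm mulr_sumr -big_split -sumrN; apply: cong_sum => // i _ /=.
have hi : (0 < i.+1 < p)%N by have := ltn_ord i; lia.
have hpi : (0 < p - i.+1 < p)%N by have := ltn_ord i; lia.
have ii := pint_inv hi; have ip := pint_inv hpi.
apply: (congP (c := i.+1%:R^-1 ^+ 2 * (p - i.+1)%:R^-1)).
  by apply: pintegralM => //; apply: pintegralX.
have i0 := nat1_neq0 i.
have p0 : (p - i.+1)%:R != 0 :> rat by rewrite pnatr_eq0; lia.
have -> : p%:R = (p - i.+1)%:R + i.+1%:R :> rat by rewrite -natrD subnK //; lia.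
by rewrite -(nat1r i); field; rewrite i0 p0.
Qed.

(** Wolstenholme's congruence: reflection at m = p - 1 gives 2 H = - p H^(2), and H^(2) is divisible
    by p. *)
Lemma harm1_p1 : cong p 2 (harm 1 p.-1) 0.
Proof.
have pp : (p.-1 < p)%N by rewrite ltn_predL prime_gt0.
have := harm1_refl pp; rewrite subnn harm0 => h.
have [c pc hc] := h; have [d pd hd] := harm2_p1.
rewrite add0r expr1 in hd.
have ih : pintegral p 2^-1 by apply: (@pint_inv 2); lia.
apply: (congP (c := 2^-1 * (c - d))); first by apply: pintegralM => //; apply: pintegralB.
rewrite subr0; move: hc; rewrite hd => hc.
apply: (mulfI (_ : 2 != 0 :> rat)) => //.
transitivity (harm 1 p.-1 + harm 1 p.-1); first by ring.
by rewrite {1}hc; field.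
Qed.

Lemma harm1_compl m : (m < p)%N ->
  cong p 2 (harm 1 (p.-1 - m)) (harm 1 m + p%:R * harm 2 m).
Proof.
move=> mp; have [c pc hc] := harm1_refl mp; have [d pd hd] := harm1_p1.
apply: (congP (c := d - c)); first exact: pintegralB.
rewrite hd in hc; have -> : harm 1 (p.-1 - m) = 0 + p%:R ^+ 2 * d + harm 1 m + p%:R * harm 2 m - p%:R ^+ 2 * c.
  by rewrite hc; ring.
by ring.
Qed.

Lemma harm1_compl1 m : (m < p)%N -> cong p 1 (harm 1 (p.-1 - m)) (harm 1 m).
Proof.
move=> mp; have /(@cong_leq _ p_pr 1) := harm1_compl mp => /(_ isT) h.
apply: (cong_trans p_pr h); apply: (congP (c := harm 2 m)); first exact: pint_harm.
by ring.
Qed.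

Lemma harm2_compl m : (m < p)%N -> cong p 1 (harm 2 (p.-1 - m)) (- harm 2 m).
Proof.
move=> mp; have [d pd hd] := harm2_p1.
have ee : harm 2 p.-1 = harm 2 (p.-1 - m) + \sum_(i < m) (p - i.+1)%:R^-1 ^+ 2.
  have := harm_cat 2 (p.-1 - m) m; rewrite subnK ?[harm 2 (_ - _ + _)]/harm; last lia.
  move=> ->; congr (_ + _); rewrite (reindex_inj rev_ord_inj) /=; apply: eq_bigr => i _.
  by congr (_%:R^-1 ^+ _); have := ltn_ord i; lia.
have /cong_sym : cong p 1 (\sum_(i < m) (p - i.+1)%:R^-1 ^+ 2) (harm 2 m).
  apply: cong_sum => // i _.
  have hi : (0 < i.+1 < p)%N by have := ltn_ord i; lia.
  have hpi : (0 < p - i.+1 < p)%N by have := ltn_ord i; lia.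
  have ii := pint_inv hi; have ip := pint_inv hpi.
  have i0 := nat1_neq0 i.
  have p0 : (p - i.+1)%:R != 0 :> rat by rewrite pnatr_eq0; lia.
  apply: (congP (c := (i.+1%:R - (p - i.+1)%:R) * i.+1%:R^-1 ^+ 2 * (p - i.+1)%:R^-1 ^+ 2)).
    apply: pintegralM => //; last exact: pintegralX.
    apply: pintegralM => //; last exact: pintegralX.
    by apply: pintegralB => //; apply: pintegral_nat.
  have -> : p%:R = (p - i.+1)%:R + i.+1%:R :> rat by rewrite -natrD subnK //; lia.
  by rewrite -(nat1r i); field; rewrite i0 p0.
move=> [c pc hc]; apply: (congP (c := d + c)); first exact: pintegralD.
rewrite hc; have -> : harm 2 (p.-1 - m) = 0 + p%:R ^+ 1 * d - \sum_(i < m) (p - i.+1)%:R^-1 ^+ 2.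
  by rewrite -hd ee; ring.
by ring.
Qed.

Definition shift_sum (c : nat) : rat := \sum_(e < p - c) harm 1 (e + c) / e.+1%:R.

(** Induction on c: the step adds 1 / ((e + 1) (e + c + 1)), split by partial fractions, and
    Wolstenholme's congruence removes the full harmonic sums. *)
Lemma shift_sum_cong c : (0 < c < p)%N ->
  cong p 1 (shift_sum c) (harm 1 c.-1 ^+ 2 + harm 2 c.-1).
Proof.
have ih : pintegral p 2^-1 by apply: (@pint_inv 2); lia.
elim: c => // c IHc /andP [_ cp].
case: c IHc cp => [_ _|c IHc cp].
  rewrite /= !harm0 /shift_sum.
  have -> : \sum_(e < p - 1) harm 1 (e + 1) / e.+1%:R = (harm 1 p.-1 ^+ 2 + harm 2 p.-1) / 2.
    by rewrite -harm_self_sum subn1; apply: eq_bigr => e _; rewrite addn1.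
  have [d pd hd] := harm2_p1; have [c pc hc] := harm1_p1.
  apply: (congP (c := 2^-1 * (p%:R ^+ 3 * c ^+ 2 + d))).
    apply: pintegralM => //; apply: pintegralD => //; apply: pintegralM => //; apply: pintegralX => //.
    exact: pintegral_nat.
  by rewrite hc hd; field.
have c1p : (0 < c.+1 < p)%N by lia.
have h1 := IHc c1p.
have c0 := nat1_neq0 c.
have step : shift_sum c.+2 = shift_sum c.+1 - harm 1 p.-1 / (p - c.+1)%:R
    + (harm 1 (p.-1 - c.+1) - harm 1 p.-1 + harm 1 c.+1) / (1 + c%:R).
  rewrite /shift_sum (_ : p - c.+1 = (p - c.+2).+1)%N; last lia.
  rewrite big_ord_recr /= (_ : (p - c.+2 + c.+1 = p.-1)%N); last lia.
  rewrite addrK.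
  have -> : harm 1 (p.-1 - c.+1) - harm 1 p.-1 + harm 1 c.+1 =
      \sum_(e < p - c.+2) (e.+1%:R^-1 - (c.+1 + e).+1%:R^-1).
    rewrite sumrB; have := harm_cat 1 c.+1 (p - c.+2).
    rewrite (_ : (c.+1 + (p - c.+2) = p.-1)%N); last lia.
    move=> ->; rewrite (_ : (p.-1 - c.+1 = p - c.+2)%N); last lia.
    have -> : harm 1 (p - c.+2) = \sum_(e < p - c.+2) e.+1%:R^-1.
      by apply: eq_bigr => e _; rewrite expr1.
    have -> : \sum_(i < p - c.+2) (c.+1 + i).+1%:R^-1 ^+ 1 = \sum_(i < p - c.+2) (c.+1 + i).+1%:R^-1 :> rat.
      by apply: eq_bigr => e _; rewrite expr1.
    by ring.
  rewrite mulr_suml -big_split; apply: eq_bigr => e _ /=.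
  rewrite (_ : (e + c.+2 = (e + c.+1).+1)%N); last lia.
  rewrite harmS expr1 mulrDl; congr (_ + _).
  have e0 := nat1_neq0 e; have s0 : 1 + (e + c.+1)%:R != 0 :> rat := nat1_neq0 _.
  rewrite (_ : (c.+1 + e).+1%:R = 1 + (e + c.+1)%:R) -?(nat1r e); last by rewrite nat1r addnC.
  have ec : (e + c.+1)%:R = e%:R + (1 + c%:R) :> rat by rewrite natrD nat1r.
  by rewrite ec in s0 *; field; rewrite c0 e0 s0.
have -> : harm 1 c.+2.-1 ^+ 2 + harm 2 c.+2.-1 =
   harm 1 c ^+ 2 + harm 2 c + (2 * harm 1 c.+1) / (1 + c%:R).
  by rewrite /= !harmS expr1; field.
rewrite step; apply: congD => //.
  have [d pd hd] := harm1_p1.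
  have [a pa ha] := h1.
  have ip : pintegral p (p - c.+1)%:R^-1 by apply: pint_inv; lia.
  apply: (congP (c := a - p%:R * d * (p - c.+1)%:R^-1)).
    by apply: pintegralB => //; apply: pintegralM => //; apply: pintegralM => //; apply: pintegral_nat.
  by rewrite ha hd /=; ring.
have ic : pintegral p (1 + c%:R)^-1 by rewrite nat1r; apply: pint_inv; lia.
apply: congMr => //.
have [d pd hd] := harm1_p1; have [a pa ha] := harm1_compl1 (ltnW cp).
apply: (congP (c := a - p%:R * d)).
  by apply: pintegralB => //; apply: pintegralM => //; apply: pintegral_nat.
by rewrite ha hd; ring.
Qed.

End HarmonicMod.

(** * Alternating sums of binomial coefficients of p^3 *)

Lemma sum_arith (V : nmodType) (d c N I : nat) (Q : pred nat) (f : nat -> V) :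
  (0 < d)%N ->
  (forall i, (i < I)%N -> (c + d * i < N)%N /\ Q (c + d * i)%N) ->
  (forall k, (k < N)%N -> Q k -> exists2 i, (i < I)%N & k = (c + d * i)%N) ->
  \sum_(k < N | Q k) f k = \sum_(i < I) f (c + d * i)%N.
Proof.
move=> d0 h1 h2.
rewrite -(big_mkord Q f) -(big_mkord predT (fun i => f (c + d * i)%N)).
rewrite -big_filter -(big_map (fun i => c + d * i)%N predT f).
apply: perm_big; apply: uniq_perm.
- exact/filter_uniq/iota_uniq.
- rewrite map_inj_uniq ?iota_uniq // => i j /addnI /eqP.
  by rewrite eqn_pmul2l // => /eqP.
move=> k; rewrite mem_filter mem_index_iota; apply/andP/mapP => [[Qk kN]|[i]].
  by have [i iI ->] := h2 k kN Qk; exists i => //; rewrite mem_index_iota.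
by rewrite mem_index_iota => iI ->; have [] := h1 i iI.
Qed.

Section BinomialProduct.

Variables (p : nat) (p_pr : prime p).
Hypothesis p_gt3 : (3 < p)%N.

Local Notation F := 'F_p.
Local Notation P := (p%:R : rat).

(** This is (-1)^m C(p^r - 1, m); [uprod] keeps the factors with index prime to p. *)
Definition bprod (r m : nat) : rat := \prod_(i < m) (1 - P ^+ r * i.+1%:R^-1).
Definition uprod (r m : nat) : rat :=
  \prod_(i < m | ~~ (p %| i.+1)%N) (1 - P ^+ r * i.+1%:R^-1).

Lemma bprodS r m : bprod r m.+1 = bprod r m * (1 - P ^+ r * m.+1%:R^-1).
Proof. by rewrite /bprod big_ord_recr. Qed.

Lemma uprodS r m : uprod r m.+1 = uprod r m *
  (if (p %| m.+1)%N then 1 else 1 - P ^+ r * m.+1%:R^-1).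
Proof.
rewrite /uprod big_mkcond big_ord_recr /= -big_mkcond /=.
by case: ifP => [/negPf ->|/negbFE ->].
Qed.

(** A factor with index p j is 1 - p^r / j: the indices divisible by p reproduce the product one
    level lower. *)
Lemma bprod_split r m : bprod r.+1 m = uprod r.+1 m * bprod r (m %/ p).
Proof.
have p0 := prime_gt0 p_pr.
elim: m => [|m IHm]; first by rewrite div0n /uprod /bprod !big_ord0 mulr1.
rewrite divnS // bprodS IHm uprodS; case: ifP => pm /=; last by rewrite add0n; ring.
rewrite mulr1 add1n bprodS mulrA; congr (_ * (1 - _)).
have /dvdnP [j ej] := pm; have -> : (m %/ p).+1 = j.
  by have := divnS m p0; rewrite pm ej mulnK //= add1n.
have j0 : j%:R != 0 :> rat by rewrite pnatr_eq0; apply/eqP => j0; move: ej; rewrite j0.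
rewrite ej natrM exprS; have := prime_natq_neq0 p_pr => P0.
by field; rewrite j0 P0.
Qed.

Lemma pintegral_uprod r m : pintegral p (uprod r m).
Proof.
apply: pintegral_prod => // i pi; apply: pintegralB => //; first exact: pintegral1.
by apply: pintegralM => //; [apply/pintegralX/pintegral_nat|apply: pintegralV].
Qed.

Lemma uprod_cong1 r m : cong p r (uprod r m) 1.
Proof.
have e : \prod_(i < m | ~~ (p %| i.+1)%N) 1 = 1 :> rat by rewrite big1.
rewrite -[X in cong p r _ X]e.
apply: cong_prod => // i pi; first exact: pintegral1.
apply: (congP (c := - i.+1%:R^-1)); first by apply: pintegralN; apply: pintegralV.
by ring.
Qed.

Lemma uprod_cong r m : (0 < r)%N ->
  cong p r.+1 (uprod r m) (1 - P ^+ r * \sum_(i < m | ~~ (p %| i.+1)%N) i.+1%:R^-1).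
Proof.
move=> r0; elim: m => [|m IHm].
  by rewrite /uprod !big_ord0; apply: cong_eq => //; ring.
rewrite uprodS big_mkcond big_ord_recr /= -big_mkcond /=.
case: ifP => pm; first by rewrite mulr1 addr0.
set S := \sum_(i < m | _) _ in IHm *.
have iS : pintegral p S by apply: pintegral_sum => // i pi; apply: pintegralV.
have im : pintegral p m.+1%:R^-1 by apply: pintegralV; rewrite pm.
have iP : pintegral p (1 - P ^+ r * m.+1%:R^-1).
  apply: pintegralB => //; first exact: pintegral1.
  by apply: pintegralM => //; apply/pintegralX/pintegral_nat.
apply: (cong_trans p_pr (congMr p_pr iP IHm)).
apply: (congP (c := P ^+ r.-1 * S * m.+1%:R^-1)).
  apply: pintegralM => //; apply: pintegralM => //; exact/pintegralX/pintegral_nat.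
have -> : P ^+ r.+1 = P * P ^+ r by rewrite exprS.
have -> : P ^+ r = P * P ^+ r.-1 by rewrite -exprS prednK.
rewrite /=; ring.
Qed.

Lemma sum_FpV_periods c : \sum_(i < p * c) (i%:R : F)^-1 = 0.
Proof.
elim: c => [|c IHc]; first by rewrite muln0 big_ord0.
rewrite mulnSr big_split_ord /= IHc add0r.
rewrite -[RHS](sum_FpV p_pr); last lia.
rewrite -(sum_Fp _ p_pr); apply: eq_bigr => i _.
have /eqP p0 : p%:R == 0 :> F by rewrite nat_Fp_eq0.
by rewrite natrD natrM p0 mul0r add0r.
Qed.

Lemma unit_sum_periods c : (0 < c)%N ->
  cong p 1 (\sum_(i < (p * c).-1 | ~~ (p %| i.+1)%N) i.+1%:R^-1) 0.
Proof.
move=> c0.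
have iS : pintegral p (\sum_(i < (p * c).-1 | ~~ (p %| i.+1)%N) i.+1%:R^-1).
  by apply: pintegral_sum => // i pi; apply: pintegralV.
apply/(cong1_red p_pr iS (pintegral0 p_pr)); rewrite (red_nat p 0).
rewrite red_sum // => [|i pi]; last exact: pintegralV.
rewrite -[RHS](sum_FpV_periods c).
have gen (f : nat -> F) Q : (0 < Q)%N -> \sum_(i < Q) f i = f 0%N + \sum_(i < Q.-1) f i.+1.
  by case: Q => // Q _; rewrite big_ord_recl.
rewrite (gen (fun i => i%:R^-1)); last by rewrite muln_gt0 prime_gt0.
rewrite invr0 add0r big_mkcond; apply: eq_bigr => i _ /=; case: ifP => pi; first by rewrite redV.
by apply/eqP; rewrite eq_sym invr_eq0 nat_Fp_eq0 //; move/negbFE: pi.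
Qed.

Lemma uprod2_periods c : (0 < c)%N -> cong p 3 (uprod 2 (p * c).-1) 1.
Proof.
move=> c0; apply: (cong_trans p_pr (@uprod_cong 2 _ isT)).
have [d pd ->] := unit_sum_periods c0.
by apply: (congP (c := - d)); [apply: pintegralN|ring].
Qed.

(** The coefficient of P^2 is the second elementary symmetric function of the 1 / i. *)
Lemma bprod1_cong m : (m < p)%N ->
  cong p 3 (bprod 1 m) (1 - P * harm 1 m + P ^+ 2 * ((harm 1 m ^+ 2 - harm 2 m) * 2^-1)).
Proof.
have ih : pintegral p 2^-1 by apply: (@pint_inv p 2); lia.
elim: m => [|m IHm] mp.
  by rewrite /bprod big_ord0 !harm0; apply: cong_eq => //; field.
rewrite bprodS.
have im : pintegral p m.+1%:R^-1 by apply: pint_inv; lia.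
have iP : pintegral p (1 - P ^+ 1 * m.+1%:R^-1).
  apply: pintegralB => //; first exact: pintegral1.
  by apply: pintegralM => //; apply/pintegralX/pintegral_nat.
apply: (cong_trans p_pr (congMr p_pr iP (IHm (ltnW mp)))).
have i1 := pint_harm p_pr 1 (ltnW mp); have i2 := pint_harm p_pr 2 (ltnW mp).
apply: (congP (c := - ((harm 1 m ^+ 2 - harm 2 m) * 2^-1) * m.+1%:R^-1)).
  apply: pintegralM => //; apply: pintegralN; apply: pintegralM => //.
  by apply: pintegralB => //; apply: pintegralX.
by rewrite !harmS -(nat1r m) expr1; have m0 := nat1_neq0 m; field.
Qed.

Lemma pintegral_bprod1 m : (m < p)%N -> pintegral p (bprod 1 m).
Proof.
move=> mp; apply: pintegral_prod => // i _; apply: pintegralB => //; first exact: pintegral1.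
apply: pintegralM => //; first exact/pintegralX/pintegral_nat.
by apply: pint_inv; have := ltn_ord i; lia.
Qed.

Lemma bprod1_cong2 m : (m < p)%N -> cong p 2 (bprod 1 m) (1 - P * harm 1 m).
Proof.
move=> mp; apply: (@cong_trans _ p_pr _ (1 - P * harm 1 m + P ^+ 2 * ((harm 1 m ^+ 2 - harm 2 m) * 2^-1))).
  by apply: (@cong_leq _ p_pr 2 3) => //; apply: bprod1_cong.
have ih : pintegral p 2^-1 by apply: (@pint_inv p 2); lia.
have i1 := pint_harm p_pr 1 mp; have i2 := pint_harm p_pr 2 mp.
apply: (congP (c := (harm 1 m ^+ 2 - harm 2 m) * 2^-1)); last by ring.
by apply: pintegralM => //; apply: pintegralB => //; apply: pintegralX.
Qed.

Lemma bprod1_cong1 m : (m < p)%N -> cong p 1 (bprod 1 m) 1.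
Proof.
move=> mp; apply: (@cong_trans _ p_pr _ (1 - P * harm 1 m)).
  by apply: (@cong_leq _ p_pr 1 2) => //; apply: bprod1_cong2.
apply: (congP (c := - harm 1 m)); last by ring.
by apply: pintegralN; apply: pint_harm.
Qed.

Lemma div_p2_lt m : (m < p ^ 3)%N -> (m %/ p %/ p < p)%N.
Proof.
have p0 := prime_gt0 p_pr.
by move=> mp; rewrite !ltn_divLR // (_ : p * p * p = p ^ 3)%N // !expnS expn0 muln1 mulnA.
Qed.

Lemma bprod3_cong1 m : (m < p ^ 3)%N -> cong p 1 (bprod 3 m) 1.
Proof.
move=> /div_p2_lt mp; rewrite 2!bprod_split.
have iu r k := pintegral_uprod r k; have ib := pintegral_bprod1 mp; have i1 := pintegral1 p_pr.
rewrite -[X in cong p 1 _ X]mulr1; apply: congM => //; first by apply: pintegralM.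
  by apply: (@cong_leq _ p_pr 1 3) => //; apply: uprod_cong1.
rewrite -[X in cong p 1 _ X]mulr1; apply: congM => //; last exact: bprod1_cong1.
by apply: (@cong_leq _ p_pr 1 2) => //; apply: uprod_cong1.
Qed.

(** Splitting twice leaves unit products that are 1 modulo p^2, so only the leading base-p digit of
    m matters. *)
Lemma bprod3_cong2 m : (m < p ^ 3)%N ->
  cong p 2 (bprod 3 m) (1 - P * harm 1 (m %/ p %/ p)).
Proof.
move=> /div_p2_lt mp; rewrite 2!bprod_split.
have iu r k := pintegral_uprod r k; have ib := pintegral_bprod1 mp; have i1 := pintegral1 p_pr.
rewrite -[X in cong p 2 _ X]mul1r; apply: congM => //; first by apply: pintegralM.
  by apply: (@cong_leq _ p_pr 2 3) => //; apply: uprod_cong1.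
rewrite -[X in cong p 2 _ X]mul1r; apply: congM => //; last exact: bprod1_cong2.
exact: uprod_cong1.
Qed.

Lemma bprod3_periods c : (0 < c < p)%N ->
  cong p 3 (bprod 3 (p * (p * c)).-1) (bprod 1 c.-1).
Proof.
move=> /andP [c0 cp]; have p0 := prime_gt0 p_pr.
have pred_div k : (0 < k)%N -> ((p * k).-1 %/ p = k.-1)%N.
  case: k => // k _; have -> : ((p * k.+1).-1 = k * p + p.-1)%N by rewrite mulnS mulnC; lia.
  by rewrite divnMDl // divn_small ?addn0 // prednK.
rewrite 2!bprod_split !pred_div ?muln_gt0 ?p0 //.
have iu r k := pintegral_uprod r k; have i1 := pintegral1 p_pr.
have ib : pintegral p (bprod 1 c.-1) by apply: pintegral_bprod1; lia.
rewrite -[X in cong p 3 _ X]mul1r; apply: congM => //; first by apply: pintegralM.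
  exact: uprod_cong1.
rewrite -[X in cong p 3 _ X]mul1r; apply: congM => //; last exact: cong_refl.
exact: uprod2_periods.
Qed.

Lemma signed_bin r m :
  (-1) ^+ m.+1 * 'C(p ^ r, m.+1)%:R = - (P ^+ r * m.+1%:R^-1) * bprod r m.
Proof.
elim: m => [|m IHm].
  by rewrite bin1 natrX /bprod big_ord0 expr1; field.
have m0 := nat1_neq0 m.+1; have m0' := nat1_neq0 m.
have eC := congr1 (fun n => n%:R : rat) (mul_bin_left (p ^ r) m.+1).
rewrite !natrM in eC.
have eB : ((p ^ r - m.+1)%:R * 'C(p ^ r, m.+1)%:R = (P ^+ r - m.+1%:R) * 'C(p ^ r, m.+1)%:R :> rat).
  case: (leqP m.+1 (p ^ r)) => h; first by rewrite natrB // natrX.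
  by rewrite bin_small // !mulr0.
rewrite eB in eC.
have -> : 'C(p ^ r, m.+2)%:R = (P ^+ r - m.+1%:R) * 'C(p ^ r, m.+1)%:R / (1 + m.+1%:R) :> rat.
  by rewrite -eC -[m.+2%:R]nat1r mulrAC divff ?mul1r.
have -> : (-1) ^+ m.+2 * ((P ^+ r - m.+1%:R) * 'C(p ^ r, m.+1)%:R / (1 + m.+1%:R)) =
  - ((-1) ^+ m.+1 * 'C(p ^ r, m.+1)%:R) * ((P ^+ r - m.+1%:R) / (1 + m.+1%:R)) :> rat.
  by rewrite (exprS _ m.+1); ring.
rewrite -(nat1r m) in m0; rewrite IHm bprodS -[m.+2%:R]nat1r -(nat1r m).
by field; rewrite m0 m0'.
Qed.

Lemma inv_expand (d z h : rat) : d != 0 -> d + P * z != 0 ->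
  pintegral p z -> pintegral p h -> pintegral p d^-1 -> pintegral p (d + P * z)^-1 ->
  cong p 2 ((1 - P * h) * (d + P * z)^-1) (d^-1 - P * (z * d^-1 ^+ 2) - P * (h * d^-1)).
Proof.
move=> d0 x0 iz ih id ix.
have iP := pintegral_nat p_pr p; have i1 := pintegral1 p_pr.
apply: (congP (c := (1 - P * h) * (z ^+ 2 * (d + P * z)^-1 * d^-1 ^+ 2) + h * z * d^-1 ^+ 2)).
  have id2 := pintegralX p_pr 2 id; have iz2 := pintegralX p_pr 2 iz.
  apply: pintegralD => //; apply: pintegralM => //; try apply: pintegralM => //.
    by apply: pintegralB => //; apply: pintegralM.
  by apply: pintegralM.
by field; rewrite d0 x0.
Qed.

(** The residue class of c modulo p - 1. It is stable under multiplication by p, so its multiples of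
    p are the p * [layer c l], and l = c yields p^2 c. *)
Definition layer (c l : nat) : nat := c + (p - 1) * l.

Lemma layer_low c l : (l < c < p)%N ->
  (layer c l = (c - l) + p * l)%N /\ (layer c l %/ p = l)%N.
Proof.
move=> /andP [lc cp]; have e : (layer c l = (c - l) + p * l)%N by rewrite /layer; nia.
by split=> //; rewrite e addnC mulnC divnMDl ?prime_gt0 // divn_small ?addn0 //; lia.
Qed.

Lemma layer_high c e : (0 < c)%N -> (e < p - c)%N ->
  (layer c (c + e.+1) + e.+1 = p * (c + e.+1))%N /\ (layer c (c + e.+1) %/ p = e + c)%N.
Proof.
move=> c0 ec; have h : (layer c (c + e.+1) + e.+1 = p * (c + e.+1))%N by rewrite /layer; nia.
split=> //; have -> : layer c (c + e.+1) = ((e + c) * p + (p - e.+1))%N by nia.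
by rewrite divnMDl ?prime_gt0 // divn_small ?addn0 //; lia.
Qed.

(** Collects the indices p * [layer c l] divisible by p exactly once; each signed binomial
    coefficient is -p^2 times such a summand, modulo p^4. *)
Definition layer_sum (c : nat) : rat :=
  \sum_(l < p.+1 | l != c :> nat) (1 - P * harm 1 (layer c l %/ p)) * (layer c l)%:R^-1.

Lemma layer_sum_split c : (0 < c < p)%N -> layer_sum c =
  \sum_(i < c) (1 - P * harm 1 (c - i.+1)) * (i.+1%:R + P * (c - i.+1)%:R)^-1 +
  \sum_(e < p - c) (1 - P * harm 1 (e + c)) * (- e.+1%:R + P * (c + e.+1)%:R)^-1.
Proof.
move=> /andP [c0 cp]; rewrite /layer_sum.
pose f l := if l != c then (1 - P * harm 1 (layer c l %/ p)) * (layer c l)%:R^-1 else 0.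
transitivity (\sum_(l < c + (p - c).+1) f l).
  rewrite (_ : (c + (p - c).+1 = p.+1)%N); last lia.
  by rewrite big_mkcond; apply: eq_bigr.
rewrite big_split_ord big_ord_recl /= {2}/f addn0 eqxx add0r; congr (_ + _).
  rewrite (reindex_inj rev_ord_inj) /=; apply: eq_bigr => i _.
  have -> : f (c - i.+1)%N = (1 - P * harm 1 (layer c (c - i.+1) %/ p)) * (layer c (c - i.+1))%:R^-1.
    by rewrite /f ifT //; apply/eqP; lia.
  have [|-> ->] := @layer_low c (c - i.+1); first lia.
  by rewrite subKn // natrD natrM.
apply: eq_bigr => e _; have ec := ltn_ord e; rewrite /bump /= add1n.
have -> : f (c + e.+1)%N = (1 - P * harm 1 (layer c (c + e.+1) %/ p)) * (layer c (c + e.+1))%:R^-1.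
  by rewrite /f ifT //; apply/eqP; lia.
have [h ->] := layer_high c0 ec; congr (_ * _^-1).
have := congr1 (fun m => m%:R : rat) h; rewrite natrD natrM => <-.
by ring.
Qed.

Lemma layer_sum_cong c : (0 < c < p)%N -> cong p 2 (layer_sum c)
  (c%:R^-1 + P * harm 2 c.-1 - P * (2 * harm 1 c.-1 * c%:R^-1)).
Proof.
move=> hc; have /andP [c0 cp] := hc.
have iinv k : (0 < k < p)%N -> pintegral p k%:R^-1 by apply: pint_inv.
have icN k : pintegral p k%:R by apply: pintegral_nat.
have iharm s m : (m < p)%N -> pintegral p (harm s m) by apply: pint_harm.
have nz k : (0 < k)%N -> k%:R != 0 :> rat by move=> k0; rewrite pnatr_eq0 -lt0n.
(* First-order expansions given by [inv_expand]: [T1] for l < c, [T2] for l > c. *)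
pose T1 i : rat := i.+1%:R^-1 - P * ((c - i.+1)%:R * i.+1%:R^-1 ^+ 2) - P * (harm 1 (c - i.+1) * i.+1%:R^-1).
pose T2 e : rat := (- e.+1%:R)^-1 - P * ((c + e.+1)%:R * (- e.+1%:R)^-1 ^+ 2) - P * (harm 1 (e + c) * (- e.+1%:R)^-1).
apply: (@cong_trans _ p_pr _ (\sum_(i < c) T1 i + \sum_(e < p - c) T2 e)).
  rewrite layer_sum_split //; apply: congD => //; apply: cong_sum => // i _; have hi := ltn_ord i.
    have [lE _] := @layer_low c (c - i.+1) ltac:(lia).
    rewrite subKn // in lE.
    apply: inv_expand => //; first exact: nz.
    - by rewrite -natrM -natrD nz.
    - by apply: iharm; lia.
    - by apply: iinv; lia.
    rewrite -natrM -natrD; apply: pintegralV.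
    by rewrite dvdn_addl ?dvdn_mulr // ndvd_lt //; lia.
  have [h _] := layer_high c0 hi.
  have hk : - i.+1%:R + P * (c + i.+1)%:R = (layer c (c + i.+1))%:R.
    by rewrite -natrM -h natrD; ring.
  have pk : ~~ (p %| layer c (c + i.+1))%N.
    have : ~~ (p %| i.+1)%N by apply: ndvd_lt; lia.
    by apply: contra => pk; rewrite -(dvdn_addr _ pk) h dvdn_mulr.
  have k0 : (0 < layer c (c + i.+1))%N by rewrite lt0n; apply: contraNneq pk => ->.
  apply: inv_expand => //.
  - by rewrite oppr_eq0 nz.
  - by rewrite hk nz.
  - by apply: iharm; lia.
  - by rewrite invrN; apply: pintegralN; apply: iinv; lia.
  by rewrite hk; apply: pintegralV.
have eT1 : \sum_(i < c) T1 i = harm 1 c - P * (c%:R * harm 2 c - harm 1 c) - P * (harm 1 c ^+ 2 - harm 2 c).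
  rewrite -harm_convolution {1 3}/harm {1}/harm !mulr_sumr -!sumrB mulr_sumr -!sumrB; apply: eq_bigr => i _.
  rewrite /T1 natrB ?ltn_ord // expr1; have i0 : i.+1%:R != 0 :> rat by apply: nz.
  by rewrite -(nat1r i) in i0 *; field.
have eT2 : \sum_(e < p - c) T2 e = - harm 1 (p - c) - P * (c%:R * harm 2 (p - c) + harm 1 (p - c)) + P * shift_sum p c.
  rewrite /shift_sum /harm !mulr_sumr -sumrN -big_split mulr_sumr -sumrB -big_split; apply: eq_bigr => e _ /=.
  rewrite /T2 natrD expr1 -/(harm 1 _); have e0 : e.+1%:R != 0 :> rat by apply: nz.
  by rewrite -(nat1r e) in e0 *; field.
rewrite eT1 eT2.
have cp' : (c.-1 < p)%N by lia.
have [a pa ha] := harm1_compl p_pr p_gt3 cp'.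
have [b pb hb] := harm2_compl p_pr p_gt3 cp'.
have [d pd hd] := shift_sum_cong p_pr p_gt3 hc.
have ecp : (p.-1 - c.-1 = p - c)%N by lia.
rewrite ecp in ha hb; rewrite ha hb hd.
have -> : harm 1 c = harm 1 c.-1 + c%:R^-1 by rewrite -{1}(prednK c0) harmS nat1r prednK // expr1.
have -> : harm 2 c = harm 2 c.-1 + c%:R^-1 ^+ 2 by rewrite -{1}(prednK c0) harmS nat1r prednK.
have ih2 := iharm 2 _ cp'.
apply: (congP (c := - a - c%:R * b - harm 2 c.-1 - P * a + d)).
  apply: pintegralD => //; apply: pintegralB => //; last by apply: pintegralM.
  apply: pintegralB => //; apply: pintegralB => //; [exact: pintegralN|exact: pintegralM].
by have c0' := nz _ c0; field.
Qed.

Lemma sum_Fp_periods (f : F -> F) m : \sum_x f x = 0 -> \sum_(i < p * m) f i%:R = 0.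
Proof.
move=> f0; elim: m => [|m IHm]; first by rewrite muln0 big_ord0.
rewrite mulnSr big_split_ord /= IHm add0r -[RHS]f0 -(sum_Fp _ p_pr).
have /eqP p0 : p%:R == 0 :> F by rewrite nat_Fp_eq0.
by apply: eq_bigr => i _; rewrite natrD natrM p0 mul0r add0r.
Qed.

(** The last index is p^3 - p + c, so for 1 < c < p this exhausts the class up to p^3. For c = 1 the
    index p^3 itself would be missing. *)
Definition residue_sum (c : nat) : rat :=
  \sum_(i < p ^ 2 + p + 1) (-1) ^+ layer c i * 'C(p ^ 3, layer c i)%:R.

Lemma unit_layer_sum c : (0 < c < p)%N ->
  cong p 1 (\sum_(i < p ^ 2 + p + 1 | ~~ (p %| layer c i)%N) (layer c i)%:R^-1) c%:R^-1.
Proof.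
move=> hc; have ic := pint_inv hc.
have iS : pintegral p (\sum_(i < p ^ 2 + p + 1 | ~~ (p %| layer c i)%N) (layer c i)%:R^-1).
  by apply: pintegral_sum => // i pi; apply: pintegralV.
apply/(cong1_red p_pr iS ic); rewrite redV ?ndvd_lt //.
rewrite red_sum // => [|i pi]; last exact: pintegralV.
have /eqP p0 : p%:R == 0 :> F by rewrite nat_Fp_eq0.
have eF i : (layer c i)%:R = c%:R - i%:R :> F.
  by rewrite /layer natrD natrM natrB ?prime_gt0 // p0; ring.
transitivity (\sum_(i < p * p.+1 + 1) (c%:R - i%:R : F)^-1).
  rewrite (_ : (p * p.+1 + 1 = p ^ 2 + p + 1)%N); last by rewrite mulnS -mulnn; lia.
  rewrite big_mkcond; apply: eq_bigr => i _ /=; case: ifP => pi; first by rewrite redV // eF.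
  by apply/eqP; rewrite -eF eq_sym invr_eq0 nat_Fp_eq0 //; move/negbFE: pi.
rewrite addn1 big_ord_recr /= (@sum_Fp_periods (fun x => (c%:R - x)^-1)).
  by rewrite natrM p0 mul0r subr0 add0r.
rewrite -[RHS](sum_FpV p_pr); last lia.
have inj : injective (fun x : F => c%:R - x) by move=> x y /addrI /oppr_inj.
by rewrite [RHS](reindex_inj inj).
Qed.

(** Stratify the indices k by the power of p in them, as C(p^3, k) carries the factor p^3 / k. The
    three terms come from k = p^2 c, from k divisible by p once, and from k prime to p. *)
Lemma residue_sum_layers c : (1 < c < p)%N ->
  cong p 4 (residue_sum c)
    (- P * (bprod 1 c.-1 * c%:R^-1 + P * layer_sum c + P ^+ 2 * c%:R^-1)).
Proof.
move=> /andP [c1 cp]; have c0 : (0 < c)%N by lia.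
have p0 := prime_gt0 p_pr; have P0 := prime_natq_neq0 p_pr.
have nz k : (0 < k)%N -> k%:R != 0 :> rat by move=> k0; rewrite pnatr_eq0 -lt0n.
have lay0 i : (0 < layer c i)%N by rewrite /layer addn_gt0 c0.
have lay_le i : (i < p ^ 2 + p + 1)%N -> (layer c i <= p ^ 3)%N.
  move=> hi; rewrite /layer; have e3 : (p ^ 3 = (p - 1) * (p ^ 2 + p) + p)%N.
    by rewrite !expnS expn0; nia.
  have : ((p - 1) * i <= (p - 1) * (p ^ 2 + p))%N by rewrite leq_mul2l; lia.
  lia.
have term k : (0 < k)%N -> (-1) ^+ k * 'C(p ^ 3, k)%:R = - (P ^+ 3 * k%:R^-1) * bprod 3 k.-1.
  by case: k => // k _; rewrite signed_bin.
rewrite /residue_sum (bigID (fun i : 'I__ => ~~ (p %| layer c i)%N)) /=.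
have -> : - P * (bprod 1 c.-1 * c%:R^-1 + P * layer_sum c + P ^+ 2 * c%:R^-1) =
  - (P ^+ 3 * c%:R^-1) - P * (bprod 1 c.-1 * c%:R^-1 + P * layer_sum c) by ring.
apply: congD => //.
  apply: (@cong_trans _ p_pr _ (- (P ^+ 3 * \sum_(i < p ^ 2 + p + 1 | ~~ (p %| layer c i)%N) (layer c i)%:R^-1))).
    rewrite mulr_sumr -sumrN; apply: cong_sum => // i pi.
    have hi := lay_le i (ltn_ord i).
    rewrite term // mulNr; apply: congN => //; rewrite -mulrA.
    apply: (@congMp _ 1 3); rewrite -[X in cong p 1 _ X]mulr1.
    apply: congMl => //; first exact: pintegralV.
    by apply: bprod3_cong1; lia.
  by apply: congN => //; apply: (@congMp _ 1 3); apply: unit_layer_sum; rewrite c0.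
under eq_bigl => i do rewrite negbK.
rewrite (@sum_arith _ p c _ p.+1 (fun i => p %| layer c i)%N (fun i => (-1) ^+ layer c i * 'C(p ^ 3, layer c i)%:R)) //; first last.
- move=> k kN; rewrite /layer => pk.
  have : (p %| k + (p - c))%N.
    have : (p %| c + (p - 1) * k + (k + (p - c)))%N.
      by rewrite (_ : c + (p - 1) * k + (k + (p - c)) = p * k.+1)%N ?dvdn_mulr //; nia.
    by rewrite dvdn_addr.
  move=> /dvdnP [[|j] ej]; first by lia.
  exists j; last by move: ej; rewrite mulSn; lia.
  rewrite ltnS leqNgt; apply/negP => jp.
  have : (p * p.+1 <= j * p)%N by rewrite mulnC leq_mul2r; lia.
  by move: ej; rewrite mulSn => ej; rewrite mulnS -mulnn in kN *; lia.
- move=> l lp; split.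
    have : (p * l <= p * p)%N by rewrite leq_mul2l; lia.
    by rewrite -mulnn; lia.
  by rewrite (_ : layer c (c + p * l) = p * layer c l)%N ?dvdn_mulr // /layer; nia.
have lay_p l : layer c (c + p * l) = (p * layer c l)%N by rewrite /layer; nia.
rewrite (bigD1 (Ordinal (ltnW cp : c < p.+1)%N)) //= mulrDr opprD; apply: congD => //.
  rewrite lay_p (_ : layer c c = p * c)%N; last by rewrite /layer; nia.
  rewrite term ?muln_gt0 ?p0 //.
  have -> : - (P ^+ 3 * (p * (p * c))%:R^-1) * bprod 3 (p * (p * c)).-1 =
    - (P ^+ 1 * (c%:R^-1 * bprod 3 (p * (p * c)).-1)).
    by rewrite !natrM; have cn := nz c c0; field; rewrite P0 cn.
  have -> : - (P * (bprod 1 c.-1 * c%:R^-1)) = - (P ^+ 1 * (c%:R^-1 * bprod 1 c.-1)) by ring.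
  apply: congN => //; apply: (@congMp _ 3 1); apply: congMl => //; first by apply: pint_inv; rewrite c0.
  by apply: bprod3_periods; rewrite c0.
have -> : - (P * (P * layer_sum c)) = - (P ^+ 2 * layer_sum c) by ring.
rewrite /layer_sum mulr_sumr -sumrN.
rewrite (eq_bigl (fun l : 'I_p.+1 => (l : nat) != c)) => [|l]; last by rewrite -val_eqE.
apply: cong_sum => // l lc; have hl := ltn_ord l.
rewrite lay_p term ?muln_gt0 ?p0 ?lay0 //.
have k0 := lay0 l.
have -> : - (P ^+ 3 * (p * layer c l)%:R^-1) * bprod 3 (p * layer c l).-1 =
  - (P ^+ 2 * (bprod 3 (p * layer c l).-1 * (layer c l)%:R^-1)).
  by rewrite !natrM; have kn := nz _ k0; field; rewrite P0 kn.
apply: congN => //; apply: (@congMp _ 2 2).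
have pk : ~~ (p %| layer c l)%N.
  case: (ltngtP l c) lc => // lc _.
    have [-> _] := @layer_low c l ltac:(lia).
    by rewrite dvdn_addl ?dvdn_mulr // ndvd_lt //; lia.
  have [h _] := @layer_high c (l - c.+1) c0 ltac:(lia).
  rewrite (_ : c + (l - c.+1).+1 = l)%N in h; last lia.
  have : ~~ (p %| (l - c.+1).+1)%N by apply: ndvd_lt; lia.
  by apply: contra => pk; rewrite -(dvdn_addr _ pk) h dvdn_mulr.
apply: congMr => //; first exact: pintegralV.
have le3 : (p * layer c l <= p ^ 3)%N.
  rewrite !expnS expn0 muln1 leq_mul2l; apply/orP; right.
  rewrite /layer; have : ((p - 1) * l <= (p - 1) * p)%N by rewrite leq_mul2l; lia.
  by nia.
have := @bprod3_cong2 (p * layer c l).-1; have -> : ((p * layer c l).-1 %/ p %/ p = layer c l %/ p)%N.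
  case: (layer c l) k0 pk => // k _ pk.
  have -> : ((p * k.+1).-1 = k * p + p.-1)%N by rewrite mulnS mulnC; lia.
  rewrite divnMDl // [(p.-1 %/ p)%N]divn_small ?addn0 ?prednK //.
  by rewrite divnS // (negPf pk).
by apply; lia.
Qed.

Definition gauss_unit (c : nat) : rat :=
  c%:R^-1 * (1 + P * (1 - harm 1 c.-1) + P ^+ 2 * ((harm 1 c.-1 ^+ 2 - harm 2 c.-1) / 2
    + 1 + c%:R * harm 2 c.-1 - 2 * harm 1 c.-1)).

Lemma residue_sum_cong c : (1 < c < p)%N ->
  cong p 4 (residue_sum c) (- P * gauss_unit c).
Proof.
move=> hc; have hc' : (0 < c < p)%N by lia.
apply: (cong_trans p_pr (residue_sum_layers hc)).
have c0 : c%:R != 0 :> rat by rewrite pnatr_eq0; lia.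
have cp : (c.-1 < p)%N by lia.
have ic := pint_inv hc'.
have [a pa ->] := layer_sum_cong hc'; have [b pb ->] := bprod1_cong cp.
apply: (congP (c := - a - b * c%:R^-1)); last by rewrite /gauss_unit; field.
by apply: pintegralB => //; [apply: pintegralN|apply: pintegralM].
Qed.

Lemma pintegral_gauss_unit c : (0 < c < p)%N -> pintegral p (gauss_unit c).
Proof.
move=> hc; have ic := pint_inv hc; have cp : (c.-1 < p)%N by lia.
have i1 := pint_harm p_pr 1 cp; have i2 := pint_harm p_pr 2 cp.
have ih : pintegral p 2^-1 by apply: (@pint_inv p 2); lia.
have iN k : pintegral p k%:R by apply: pintegral_nat.
have j1 := pintegral1 p_pr; have jP := pintegralX p_pr 2 (iN p).
apply: pintegralM => //; apply: pintegralD => //; first apply: pintegralD => //.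
  by apply: pintegralM => //; apply: pintegralB.
apply: pintegralM => //; apply: pintegralB => //; last exact: pintegralM.
apply: pintegralD => //; last exact: pintegralM.
apply: pintegralD => //; apply: pintegralM => //.
by apply: pintegralB => //; apply: pintegralX.
Qed.

End BinomialProduct.

(** * Jacobi sums modulo the cube of p *)

Section Lift.

Variables (p : nat) (p_pr : prime p).
Hypothesis p_gt3 : (3 < p)%N.

Local Notation F := 'F_p.
Local Notation R := ('Z_(expn p 4)).
Local Notation P := (p%:R : rat).

(** Expand (1 - [teich x])^(p^3) by the binomial formula; orthogonality keeps the exponents k
    congruent to c modulo p - 1. *)
Lemma jac_oneE c : (1 < c < p - 1)%N -> jac_one p c =
  (p - 1)%:R * \sum_(i < p ^ 2 + p + 1) (-1) ^+ layer p c i * 'C(p ^ 3, layer p c i)%:R.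
Proof.
move=> /andP [c1 cp]; rewrite /jac_one jacobiC; set A := (p - 1 - c)%N.
have A0 : (0 < A)%N by rewrite /A; lia.
transitivity (\sum_(x : F) \sum_(k < (p ^ 3).+1)
    ((-1) ^+ k * 'C(p ^ 3, k)%:R) * teich x ^+ (A + k)).
  apply: eq_bigr => x _; rewrite expr1 (teichB p_pr) exprDn mulr_sumr.
  apply: eq_bigr => k _; rewrite expr1n mul1r (exprNn (teich x)) exprD -mulr_natl.
  by ring.
rewrite exchange_big /= mulr_sumr.
transitivity (\sum_(k < (p ^ 3).+1 | (p - 1 %| A + k)%N)
    (p - 1)%:R * ((-1) ^+ k * 'C(p ^ 3, k)%:R) : R).
  rewrite [RHS]big_mkcond; apply: eq_bigr => k _; rewrite -mulr_sumr teich_sum //; last by rewrite addn_gt0 A0.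
  by case: ifP => _; rewrite ?mulr0 // mulrC.
rewrite (@sum_arith _ (p - 1) c _ (p ^ 2 + p + 1) (fun k => p - 1 %| A + k)%N
  (fun k => (p - 1)%:R * ((-1) ^+ k * 'C(p ^ 3, k)%:R))) //; first lia.
- move=> i hi; split.
    have : ((p - 1) * i <= (p - 1) * (p ^ 2 + p))%N by rewrite leq_mul2l; lia.
    by lia.
  by rewrite addnA dvdn_addl ?dvdn_mulr // /A subnK //; lia.
move=> k kN /dvdnP [[|j] ej]; first by lia.
exists j; last by move: ej; rewrite mulSn /A; lia.
rewrite ltnNge; apply/negP => jp.
have : ((p ^ 2 + p + 1) * (p - 1) <= j * (p - 1))%N by rewrite leq_mul2r jp orbT.
by move: ej; rewrite mulSn /A; nia.
Qed.

(** A common integer links a residue modulo p^4 to a p-integral rational, so identities of Jacobi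
    sums transfer to rationals. *)
Definition lifts (z : R) (r : rat) := exists2 m : int, z = m%:~R & cong p 4 r m%:~R.

Lemma lifts_int (m : int) : lifts m%:~R m%:~R.
Proof. by exists m => //; apply: cong_refl. Qed.

Lemma lifts_nat (m : nat) : lifts m%:R m%:R.
Proof. exact: (lifts_int m). Qed.

Lemma liftsM z w r s : lifts z r -> lifts w s -> lifts (z * w) (r * s).
Proof.
move=> [m -> rm] [k -> sk]; exists (m * k); first by rewrite intrM.
rewrite intrM; apply: congM => //; first exact: pintegral_int.
by apply: cong_pint sk _ => //; apply: pintegral_int.
Qed.

Lemma liftsD z w r s : lifts z r -> lifts w s -> lifts (z + w) (r + s).
Proof.
move=> [m -> rm] [k -> sk]; exists (m + k); first by rewrite intrD.
by rewrite intrD; apply: congD.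
Qed.

Lemma liftsN z r : lifts z r -> lifts (- z) (- r).
Proof.
move=> [m -> rm]; exists (- m); first by rewrite rmorphN.
by rewrite rmorphN; apply: congN.
Qed.

Lemma lifts_cong z r s : cong p 4 s r -> lifts z r -> lifts z s.
Proof. by move=> sr [m -> rm]; exists m => //; apply: cong_trans rm. Qed.

Lemma Zp4_int_eq0 (m : int) : m%:~R = 0 :> R -> ((p ^ 4)%N%:Z %| m)%Z.
Proof.
have g1 := p4_gt1 p_pr.
have nat0 (k : nat) : k%:R = 0 :> R -> (p ^ 4 %| k)%N.
  by move=> /(congr1 (@nat_of_ord _)); rewrite val_Zp_nat // => /eqP.
rewrite dvdzE /=; case: m => k /=; first exact: nat0.
by rewrite NegzE rmorphN /= => /eqP; rewrite oppr_eq0 => /eqP /nat0.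
Qed.

Lemma lifts_inj z r s : lifts z r -> lifts z s -> cong p 4 r s.
Proof.
move=> [m -> rm] [k mk sk]; apply: (cong_trans p_pr rm); apply: (@cong_trans _ p_pr _ k%:~R); last exact: cong_sym.
have : (m - k)%:~R = 0 :> R by rewrite intrB mk subrr.
move=> /Zp4_int_eq0 /dvdzP [t et]; apply: (congP (c := t%:~R)); first exact: pintegral_int.
by rewrite -intrB et intrM -natrX mulrC.
Qed.

Lemma lifts_sum I (r : seq I) (Q : pred I) (f : I -> R) (g : I -> rat) :
  (forall i, Q i -> lifts (f i) (g i)) -> lifts (\sum_(i <- r | Q i) f i) (\sum_(i <- r | Q i) g i).
Proof.
move=> fg; apply: (big_ind2 lifts) => //; first exact: (lifts_nat 0).
by move=> *; apply: liftsD.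
Qed.

Lemma lifts_jac_one c : (1 < c < p - 1)%N ->
  lifts (jac_one p c) (P * (1 - P) * gauss_unit p c).
Proof.
move=> hc; rewrite jac_oneE //.
have hc' : (1 < c < p)%N by lia.
apply: (@lifts_cong _ ((p - 1)%:R * residue_sum p c)).
  have -> : (p - 1)%:R = P - 1 by rewrite natrB ?prime_gt0.
  have -> : P * (1 - P) * gauss_unit p c = (P - 1) * (- P * gauss_unit p c) by ring.
  apply: congMl => //; last exact/cong_sym/residue_sum_cong.
  by apply: pintegralB => //; [apply: pintegral_nat|apply: pintegral1].
apply: liftsM; first exact: lifts_nat.
apply: lifts_sum => i _; apply: liftsM; last exact: lifts_nat.
by have := lifts_int ((-1) ^+ layer p c i); rewrite !rmorphXn /= !rmorphN1.
Qed.

Definition tri (x0 x1 x2 : rat) : rat := x0 + P * x1 + P ^+ 2 * x2.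

Lemma triM x0 x1 x2 y0 y1 y2 :
  pintegral p x1 -> pintegral p x2 -> pintegral p y1 -> pintegral p y2 ->
  cong p 3 (tri x0 x1 x2 * tri y0 y1 y2)
    (tri (x0 * y0) (x0 * y1 + x1 * y0) (x0 * y2 + x1 * y1 + x2 * y0)).
Proof.
move=> hx1 hx2 hy1 hy2; have hP := pintegral_nat p_pr p.
apply: (congP (c := x1 * y2 + x2 * y1 + P * (x2 * y2))); last by rewrite /tri; ring.
apply: pintegralD => //; first by apply: pintegralD => //; apply: pintegralM.
by apply: pintegralM => //; apply: pintegralM.
Qed.

Lemma pint_tri x0 x1 x2 : pintegral p x0 -> pintegral p x1 -> pintegral p x2 ->
  pintegral p (tri x0 x1 x2).
Proof.
move=> h0 h1 h2; have hP := pintegral_nat p_pr p.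
apply: pintegralD => //; first by apply: pintegralD => //; apply: pintegralM.
by apply: pintegralM => //; apply: pintegralX.
Qed.

Lemma cong3_cancel y a b : pintegral p y -> pintegral p a -> pintegral p b ->
  cong p 3 ((1 + P * y) * a) ((1 + P * y) * b) -> cong p 3 a b.
Proof.
move=> hy ha hb hab; have hP := pintegral_nat p_pr p; have h1 := pintegral1 p_pr.
have hy2 := pintegralX p_pr 2 hy; have hP2 := pintegralX p_pr 2 hP.
have hy3 := pintegralX p_pr 3 hy.
(* Inverse of 1 + P y modulo p^3. *)
have hu : pintegral p (1 - P * y + P ^+ 2 * y ^+ 2).
  apply: pintegralD => //; last exact: pintegralM.
  by apply: pintegralB => //; apply: pintegralM.
have [t ht et] := congMl p_pr hu hab.
apply: (congP (c := t - y ^+ 3 * a + y ^+ 3 * b)).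
  by apply: pintegralD => //; [apply: pintegralB => //; apply: pintegralM|apply: pintegralM].
transitivity ((1 - P * y + P ^+ 2 * y ^+ 2) * ((1 + P * y) * a) - P ^+ 3 * (y ^+ 3 * a) - b); first by ring.
by rewrite et; ring.
Qed.

(** Expansion modulo p^3 of a! divided by the product of the i + eps for 1 <= i <= a, with eps = a
    (p + p^2). Here a + eps is a / (1 - p) modulo p^3, the kind of argument met in the Gross-Koblitz
    formula. *)
Definition fact_unit (a : nat) : rat := tri 1 (- (a%:R * harm 1 a))
  (- (a%:R * harm 1 a) + a%:R ^+ 2 * (harm 1 a ^+ 2 + harm 2 a) / 2).

Definition gamma_rep (a : nat) : rat := a`!%:R^-1 * fact_unit a.

Lemma pint_half : pintegral p 2^-1.
Proof. by apply: (@pint_inv p 2); lia. Qed.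

Lemma pint_fact_unit a : (a < p)%N -> pintegral p (fact_unit a).
Proof.
move=> ap; have i1 := pint_harm p_pr 1 ap; have i2 := pint_harm p_pr 2 ap.
have ia := pintegral_nat p_pr a; have i12 := pintegralX p_pr 2 i1; have ia2 := pintegralX p_pr 2 ia.
have h1 := pintegralN (pintegralM p_pr ia i1); have j1 := pintegral1 p_pr; have ih := pint_half.
apply: pint_tri => //; apply: pintegralD => //; apply: pintegralM => //.
by apply: pintegralM => //; apply: pintegralD.
Qed.

Lemma pint_factV a : (a < p)%N -> pintegral p a`!%:R^-1.
Proof.
move=> ap; apply: pintegralV; elim: a ap => [|a IHa] ap; first by rewrite dvdn1; lia.
by rewrite factS Euclid_dvdM // negb_or IHa ?ndvd_lt //; lia.
Qed.

Lemma pint_gamma_rep a : (a < p)%N -> pintegral p (gamma_rep a).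
Proof. by move=> ap; apply: pintegralM => //; [apply: pint_factV|apply: pint_fact_unit]. Qed.

Lemma gauss_unit_tri c : gauss_unit p c = c%:R^-1 * tri 1 (1 - harm 1 c.-1)
  ((harm 1 c.-1 ^+ 2 - harm 2 c.-1) / 2 + 1 + c%:R * harm 2 c.-1 - 2 * harm 1 c.-1).
Proof. by []. Qed.

(* gamma_rep plays the role of a Gauss sum: consecutive values differ by the
   factor gauss_unit, up to the constant 1 + 2 p + 3 p^2. *)
Lemma gamma_rep_rec c : (0 < c < p)%N ->
  cong p 3 (gauss_unit p c * gamma_rep c.-1) ((1 + P * tri 2 3 0) * gamma_rep c).
Proof.
move=> hc; have /andP [c0 cp] := hc; have cp' : (c.-1 < p)%N by lia.
have i1 := pint_harm p_pr 1 cp'; have i2 := pint_harm p_pr 2 cp'.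
have j1 := pint_harm p_pr 1 cp; have j2 := pint_harm p_pr 2 cp.
have h1 := pintegral1 p_pr; have iN k := pintegral_nat p_pr k; have ih := pint_half.
have sq x (hx : pintegral p x) := pintegralX p_pr 2 hx.
have e1 : harm 1 c = harm 1 c.-1 + c%:R^-1 by rewrite -{1}(prednK c0) harmS nat1r prednK // expr1.
have e2 : harm 2 c = harm 2 c.-1 + c%:R^-1 ^+ 2 by rewrite -{1}(prednK c0) harmS nat1r prednK.
have efact : c`!%:R = c%:R * (c.-1)`!%:R :> rat by rewrite -{1}(prednK c0) factS prednK // natrM.
have cn : c%:R != 0 :> rat by rewrite pnatr_eq0; lia.
have epred : (c.-1)%:R = c%:R - 1 :> rat by rewrite -{2}(prednK c0) -natr1 addrK.
rewrite gauss_unit_tri /gamma_rep.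
have eK : 1 + P * tri 2 3 0 = tri 1 2 3 by rewrite /tri; ring.
rewrite eK mulrACA -invfM -efact [X in cong p 3 _ X]mulrCA.
apply: congMl => //; first exact: pint_factV.
have p1 : pintegral p (1 - harm 1 c.-1) by apply: pintegralB.
have p2 : pintegral p ((harm 1 c.-1 ^+ 2 - harm 2 c.-1) / 2 + 1 + c%:R * harm 2 c.-1 - 2 * harm 1 c.-1).
  apply: pintegralB => //; last by apply: pintegralM => //; apply: (iN 2).
  apply: pintegralD => //; last exact: pintegralM.
  apply: pintegralD => //; apply: pintegralM => //.
  by apply: pintegralB => //; apply: sq.
have q1 k x : pintegral p x -> pintegral p (- (k%:R * x)) by move=> hx; apply: pintegralN; apply: pintegralM.
have q2 k x y : pintegral p x -> pintegral p y ->
    pintegral p (- (k%:R * x) + k%:R ^+ 2 * (x ^+ 2 + y) / 2).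
  move=> hx hy; apply: pintegralD => //; first exact: q1.
  apply: pintegralM => //; apply: pintegralM => //; first exact: sq.
  by apply: pintegralD => //; apply: sq.
apply: (cong_trans p_pr (triM _ _ p1 p2 (q1 _ _ i1) (q2 _ _ _ i1 i2))).
apply: cong_sym => //; apply: (cong_trans p_pr (triM _ _ (iN 2) (iN 3) (q1 _ _ j1) (q2 _ _ _ j1 j2))).
apply: cong_eq => //; rewrite e1 e2 epred; congr (tri _ _ _); first [by ring|by field; rewrite cn].
Qed.

Variable n : nat.
Hypothesis pE : p = (2 * n + 1)%N.

Definition jac_rep (a : nat) : rat := (nat_of_ord (jac_half p n a))%:R.

Lemma lifts_jac_rep a : lifts (jac_half p n a) (jac_rep a).
Proof. by rewrite -{1}(natr_Zp (jac_half p n a)); apply: lifts_nat. Qed.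

Lemma pint_jac_rep a : pintegral p (jac_rep a).
Proof. exact: pintegral_nat. Qed.

(** Both sides of [jac_rec] carry p (1 - p): cancelling p lowers the modulus from p^4 to p^3, and 1
    - p is a unit. *)
Lemma jac_rep_rec a : (1 < a < n)%N ->
  cong p 3 (jac_rep a * gauss_unit p (a + n)) (jac_rep a.-1 * gauss_unit p a).
Proof.
move=> an; have h1 : (1 < a + n < p - 1)%N by lia.
have h2 : (1 < a < p - 1)%N by lia.
have eq := jac_rec p_pr p_gt3 pE an.
have l1 := liftsM (lifts_jac_rep a) (lifts_jac_one h1).
have l2 := liftsM (lifts_jac_rep a.-1) (lifts_jac_one h2).
rewrite eq in l1; have := lifts_inj l1 l2.
have -> : jac_rep a * (P * (1 - P) * gauss_unit p (a + n)) =
  P ^+ 1 * ((1 + P * -1) * (jac_rep a * gauss_unit p (a + n))) by ring.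
have -> : jac_rep a.-1 * (P * (1 - P) * gauss_unit p a) =
  P ^+ 1 * ((1 + P * -1) * (jac_rep a.-1 * gauss_unit p a)) by ring.
move=> /(congMp_inv p_pr (k := 1) (e := 3)); apply: cong3_cancel.
- by apply: pintegralN; apply: pintegral1.
- by apply: pintegralM => //; [apply: pint_jac_rep|apply: pintegral_gauss_unit => //; lia].
- by apply: pintegralM => //; [apply: pint_jac_rep|apply: pintegral_gauss_unit => //; lia].
Qed.

Lemma jac_rep1 : (1 < n)%N ->
  cong p 3 ((1 - P) * (jac_rep 1 * gauss_unit p (1 + n))) (-1).
Proof.
move=> n1; have h1 : (1 < 1 + n < p - 1)%N by lia.
have eq := jac_rec1 p_pr p_gt3 pE.
have l1 := liftsM (lifts_jac_rep 1) (lifts_jac_one h1).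
have l2 := liftsN (lifts_nat p).
rewrite eq in l1; have := lifts_inj l1 l2.
have -> : jac_rep 1 * (P * (1 - P) * gauss_unit p (1 + n)) =
  P ^+ 1 * ((1 - P) * (jac_rep 1 * gauss_unit p (1 + n))) by ring.
have -> : - P = P ^+ 1 * -1 by ring.
by move=> /(congMp_inv p_pr (k := 1) (e := 3)).
Qed.

(** The analogue of a Jacobi sum as a quotient of Gauss sums. The constant in [gamma_rep_rec] enters
    both sides of the induction and cancels. *)
Lemma jac_rep_gamma a : (0 < a < n)%N ->
  cong p 3 (jac_rep a * gamma_rep (a + n)) (- (gamma_rep a * gamma_rep n)).
Proof.
elim: a => // a IHa /andP [_ an].
have h1 := pintegral1 p_pr; have iN k := pintegral_nat p_pr k.
have ij k := pint_jac_rep k.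
have ig k (hk : (k < p)%N) := pint_gamma_rep hk.
have iu k (hk : (0 < k < p)%N) := pintegral_gauss_unit p_pr p_gt3 hk.
have iK : pintegral p (tri 2 3 0) by apply: pint_tri => //; apply: pintegral0.
have iKK : pintegral p (1 + P * tri 2 3 0) by apply: pintegralD => //; apply: pintegralM.
have hn : (n < p)%N by lia.
have hr : (0 < a.+1 + n < p)%N by lia.
have hr' : (a.+1 + n < p)%N by lia.
have hs : (0 < a.+1 < p)%N by lia.
have hs' : (a.+1 < p)%N by lia.
have r1 := gamma_rep_rec hr; rewrite addSn /= in r1.
have k1 := congMl p_pr (ij a.+1) r1.
apply: (cong3_cancel iK).
- by apply: pintegralM => //; apply: ig.
- by apply: pintegralN; apply: pintegralM => //; apply: ig.
have {k1} k1 : cong p 3 ((1 + P * tri 2 3 0) * (jac_rep a.+1 * gamma_rep (a.+1 + n)))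
    (jac_rep a.+1 * gauss_unit p (a.+1 + n) * gamma_rep (a + n)).
  apply: cong_sym => //; rewrite -mulrA [X in cong p 3 _ X]mulrCA; exact: k1.
apply: (cong_trans p_pr k1).
have ian : pintegral p (gamma_rep (a + n)) by apply: ig; lia.
case: a IHa an hr hr' hs hs' r1 k1 ian => [_|a IHa] an hr hr' hs hs' r1 k1 ian.
  rewrite add0n in ian *.
  have n1 : (1 < n)%N by lia.
  have im1 : pintegral p (-1) by apply: pintegralN.
  apply: (cong3_cancel im1).
  - by apply: pintegralM => //; apply: pintegralM => //; apply: iu.
  - by apply: pintegralM => //; apply: pintegralN; apply: pintegralM => //; apply: ig.
  have -> : (1 + P * -1) * (jac_rep 1 * gauss_unit p (1 + n) * gamma_rep n) =
    ((1 - P) * (jac_rep 1 * gauss_unit p (1 + n))) * gamma_rep n by ring.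
  apply: (cong_trans p_pr (congMr p_pr ian (jac_rep1 n1))).
  have -> : gamma_rep 1 = 1 - P.
    by rewrite /gamma_rep /fact_unit /tri !harmS !harm0 factS fact0 muln1 expr1 invr1; field.
  (* Here (1 - p)^2 (1 + 2p + 3p^2) = 1 - 4 p^3 + 3 p^4: the constant is (1 - p)^(-2) modulo p^3. *)
  apply: (congP (c := - (4 - 3 * P) * gamma_rep n)).
    by apply: pintegralM => //; apply: pintegralN; apply: pintegralB => //; apply: pintegralM.
  by rewrite /tri; ring.
have ha : (1 < a.+2 < n)%N by lia.
apply: (cong_trans p_pr (congMr p_pr ian (jac_rep_rec ha))) => /=.
have hb : (0 < a.+1 < n)%N by lia.
have ius := iu _ hs.
have := congMl p_pr ius (IHa hb).
have r2 := gamma_rep_rec hs; rewrite /= in r2.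
rewrite -[jac_rep a.+1 * _ * _]mulrA [X in cong p 3 X _ -> _]mulrCA => k2.
apply: (cong_trans p_pr k2).
have -> : gauss_unit p a.+2 * - (gamma_rep a.+1 * gamma_rep n) =
  - (gauss_unit p a.+2 * gamma_rep a.+1 * gamma_rep n) by ring.
rewrite mulrN; apply: congN => //. rewrite (mulrA (1 + _) (gamma_rep a.+2)). apply: congMr => //; exact: ig.
Qed.

End Lift.

(** * Evaluation of the Jacobi sum at a quarter of p - 1 *)

Definition odd_harm (s m : nat) : rat := \sum_(i < m) (2 * i%:R + 1)^-1 ^+ s.

Section QuarterEvaluation.

Variables (p : nat) (p_pr : prime p).
Hypothesis p_gt3 : (3 < p)%N.
Variable q : nat.
Hypothesis pq : p = (4 * q + 1)%N.

Local Notation P := (p%:R : rat).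
Local Notation b := (cbin rat).
Local Notation n := (2 * q)%N.
Local Notation H := (harm 1 q).
Local Notation G := (harm 2 q).
Local Notation O1 := (odd_harm 1 q).
Local Notation O2 := (odd_harm 2 q).

Lemma pE_quarter : p = (2 * n + 1)%N. Proof. lia. Qed.
Lemma n_gt1 : (1 < n)%N. Proof. lia. Qed.

Lemma PE : P = 4 * q%:R + 1.
Proof. by rewrite pq natrD natrM. Qed.

Lemma qE : q%:R = (P - 1) / 4 :> rat.
Proof. by rewrite PE; field. Qed.

Lemma oddE i : 2 * i%:R + 1 = (2 * i + 1)%:R :> rat.
Proof. by rewrite natrD natrM. Qed.

Lemma odd_neq0 i : 2 * i%:R + 1 != 0 :> rat.
Proof. by rewrite oddE pnatr_eq0; lia. Qed.

Lemma pint_odd_inv i : (i < q)%N -> pintegral p (2 * i%:R + 1)^-1.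
Proof. by move=> iq; rewrite oddE; apply: pint_inv; lia. Qed.

Lemma pint_odd_harm s : pintegral p (odd_harm s q).
Proof.
by apply: pintegral_sum => // i _; apply: pintegralX => //; apply: pint_odd_inv.
Qed.

(** Each new factor (2q + i + 1) / (i + 1) is (p + 2i + 1) / (2 (i + 1)), the ratio of consecutive
    b_i times 1 + p / (2i + 1). *)
Lemma fact_ratio m : (n + m)`!%:R / (n`!%:R * m`!%:R) =
  b m * \prod_(i < m) (1 + P * (2 * i%:R + 1)^-1).
Proof.
have f0 k : k`!%:R != 0 :> rat by rewrite pnatr_eq0 -lt0n fact_gt0.
elim: m => [|m IHm].
  by rewrite addn0 fact0 mulr1 divff // big_ord0 cbin0 mulr1.
rewrite big_ord_recr /= (cbinS (K := m.+1)) //; last by move=> i /andP [i0 _]; rewrite pnatr_eq0; lia.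
rewrite addnS !factS !natrM -(nat1r m) -(nat1r (n + m)) natrD natrM.
have o0 := odd_neq0 m; have m0 := nat1_neq0 m.
transitivity (((n + m)`!%:R / (n`!%:R * m`!%:R)) * ((1 + (2 * q%:R + m%:R)) / (1 + m%:R)) : rat).
  by field; rewrite m0 !f0.
by rewrite IHm PE; field; rewrite m0 o0.
Qed.

Lemma odd_prod_cong m : (m <= q)%N ->
  cong p 3 (\prod_(i < m) (1 + P * (2 * i%:R + 1)^-1))
    (tri p 1 (odd_harm 1 m) ((odd_harm 1 m ^+ 2 - odd_harm 2 m) / 2)).
Proof.
have ih := pint_half p_pr p_gt3.
elim: m => [|m IHm] mq.
  by rewrite big_ord0 /odd_harm !big_ord0; apply: cong_eq => //; rewrite /tri; field.
have io := pint_odd_inv mq.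
have iodd s : pintegral p (odd_harm s m).
  apply: pintegral_sum => // i _; apply: pintegralX => //; apply: pint_odd_inv.
  by have := ltn_ord i; lia.
have iP := pintegral_nat p_pr p; have i1 := pintegral1 p_pr.
have iF : pintegral p (1 + P * (2 * m%:R + 1)^-1) by apply: pintegralD => //; apply: pintegralM.
rewrite big_ord_recr /=; apply: (cong_trans p_pr (congMr p_pr iF (IHm (ltnW mq)))).
apply: (congP (c := (odd_harm 1 m ^+ 2 - odd_harm 2 m) / 2 * (2 * m%:R + 1)^-1)).
  by apply: pintegralM => //; apply: pintegralM => //; apply: pintegralB => //; apply: pintegralX.
have eS s : odd_harm s m.+1 = odd_harm s m + (2 * m%:R + 1)^-1 ^+ s by rewrite /odd_harm big_ord_recr.
by rewrite !eS /tri; have o0 := odd_neq0 m; field.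
Qed.

Lemma pred3q : (p.-1 - q = n + q)%N. Proof. lia. Qed.

Lemma harm1_3q : cong p 2 (harm 1 (n + q)) (H + P * G).
Proof. by rewrite -pred3q; apply: harm1_compl => //; lia. Qed.

Lemma harm2_3q : cong p 1 (harm 2 (n + q)) (- G).
Proof. by rewrite -pred3q; apply: harm2_compl => //; lia. Qed.

Lemma harm2_n : cong p 1 (harm 2 n) 0.
Proof.
have np : (n < p)%N by lia.
have [c pc hc] := harm2_compl p_pr p_gt3 np.
rewrite (_ : (p.-1 - n = n)%N) in hc; last lia.
apply: (congP (c := c / 2)); first by apply: pintegralM => //; apply: pint_half.
rewrite subr0; transitivity ((harm 2 n + harm 2 n) / 2); first by field.
by rewrite {1}hc; field.
Qed.

Lemma harm1_n : cong p 2 (harm 1 n) (H - 2 * O1 + P * (G + 2 * O2)).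
Proof.
have e : cong p 2 (\sum_(i < q) (n + i).+1%:R^-1 ^+ 1) (2 * O1 - 2 * P * O2).
  rewrite /odd_harm !mulr_sumr -sumrB; apply: cong_sum => // i _; have iq := ltn_ord i.
  have io := pint_odd_inv iq; have o0 := odd_neq0 i.
  have in0 : (n + i).+1%:R != 0 :> rat by rewrite pnatr_eq0.
  have ini : pintegral p (n + i).+1%:R^-1 by apply: pint_inv; lia.
  have eN : P = 2 * (n + i).+1%:R - (2 * i%:R + 1).
    by rewrite PE -(nat1r (n + i)) natrD natrM; ring.
  have iN := pintegral_nat p_pr (n + i).+1.
  move: in0 ini eN iN; move: ((n + i).+1%:R : rat) => M in0 ini eN iN.
  apply: (congP (c := M^-1 * (2 * i%:R + 1)^-1 ^+ 2)).
    by apply: pintegralM => //; apply: pintegralX.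
  by rewrite eN; field; rewrite in0 o0.
have [a pa ha] := harm1_3q; have [c pc hc] := e.
rewrite harm_cat hc in ha.
apply: (congP (c := a - c)); first exact: pintegralB.
by transitivity (harm 1 n + (2 * O1 - 2 * P * O2 + P ^+ 2 * c) - (2 * O1 - 2 * P * O2 + P ^+ 2 * c) -
  (H - 2 * O1 + P * (G + 2 * O2))); [ring|rewrite ha; ring].
Qed.

Lemma odd_harm2 : cong p 1 O2 (- (G / 4)).
Proof.
have i4 : pintegral p 4^-1 by apply: (@pint_inv p 4); lia.
have e : cong p 1 (\sum_(i < q) (n + i).+1%:R^-1 ^+ 2) (4 * O2).
  rewrite /odd_harm !mulr_sumr; apply: cong_sum => // i _; have iq := ltn_ord i.
  have io := pint_odd_inv iq; have o0 := odd_neq0 i.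
  have in0 : (n + i).+1%:R != 0 :> rat by rewrite pnatr_eq0.
  have ini : pintegral p (n + i).+1%:R^-1 by apply: pint_inv; lia.
  have eN : P = 2 * (n + i).+1%:R - (2 * i%:R + 1).
    by rewrite PE -(nat1r (n + i)) natrD natrM; ring.
  have iN := pintegral_nat p_pr (n + i).+1.
  move: in0 ini eN iN; move: ((n + i).+1%:R : rat) => M in0 ini eN iN.
  apply: (congP (c := - (M^-1 ^+ 2 * (2 * i%:R + 1)^-1 ^+ 2 * (2 * M + (2 * i%:R + 1))))).
    apply: pintegralN; apply: pintegralM => //; first by apply: pintegralM => //; apply: pintegralX.
    rewrite oddE; apply: pintegralD => //; last exact: pintegral_nat.
    by apply: pintegralM => //; apply: (pintegral_nat p_pr 2).
  by rewrite eN; field; rewrite in0 o0.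
have [a pa ha] := harm2_3q; have [c pc hc] := e; have [d pd hd] := harm2_n.
rewrite harm_cat hc hd in ha.
apply: (congP (c := (a - c - d) * 4^-1)).
  by apply: pintegralM => //; apply: pintegralB => //; apply: pintegralB.
transitivity ((0 + P ^+ 1 * d + (4 * O2 + P ^+ 1 * c) - P ^+ 1 * d - P ^+ 1 * c + G) / 4); first by field.
by rewrite ha; field.
Qed.

(** After reversing the order, 4 (q - i - 1) + 3 = p - 2 (2i + 1). *)
Lemma c3_odd_harm : cong p 1 (\sum_(i < q) (c3 rat i)^-1) (O2 / 4).
Proof.
rewrite (reindex_inj rev_ord_inj) /= /odd_harm mulr_suml; apply: cong_sum => // i _.
have iq := ltn_ord i; have io := pint_odd_inv iq; have o0 := odd_neq0 i.
have i4 : pintegral p 4^-1 by apply: (@pint_inv p 4); lia.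
set m := (4 * (q - i.+1) + 3)%N.
have mp : (0 < m < p)%N by rewrite /m; lia.
have m0 : m%:R != 0 :> rat by rewrite pnatr_eq0; lia.
have im := pint_inv mp.
rewrite c3E -/m; have eP : P = m%:R + 2 * (2 * i%:R + 1).
  by rewrite oddE -natrM -natrD; congr _%:R; rewrite /m; lia.
apply: (congP (c := (2 * (2 * i%:R + 1) - m%:R) * (m%:R^-1 ^+ 2 * ((2 * i%:R + 1)^-1 ^+ 2 * 4^-1)))).
  apply: pintegralM => //.
    apply: pintegralB => //; last exact: pintegral_nat.
    by rewrite oddE -natrM; apply: pintegral_nat.
  by apply: pintegralM => //; [apply: pintegralX|apply: pintegralM => //; apply: pintegralX].
by rewrite eP; field; rewrite m0 o0.
Qed.

(** The part of the first coefficient divisible by p is carried into the second. *)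
Lemma tri_cong x1 x2 y1 z y2 : cong p 2 x1 (y1 + P * z) -> cong p 1 x2 y2 ->
  cong p 3 (tri p 1 x1 x2) (tri p 1 y1 (z + y2)).
Proof.
move=> [a pa ->] [c pc ->]; apply: (congP (c := a + c)); first exact: pintegralD.
by rewrite /tri; ring.
Qed.

Lemma pint_H : pintegral p H. Proof. by apply: pint_harm => //; lia. Qed.
Lemma pint_G : pintegral p G. Proof. by apply: pint_harm => //; lia. Qed.
Lemma pint_inv_pow2 k : pintegral p (2 ^+ k)^-1.
Proof. by rewrite -exprVn; apply: pintegralX => //; apply: pint_half. Qed.

Lemma fact_unit_q : cong p 3 (fact_unit p q) (tri p 1 (H / 4) ((H ^+ 2 + G) / 32)).
Proof.
have iH := pint_H; have iG := pint_G.
have i2 := pint_inv_pow2 2; have i5 := pint_inv_pow2 5.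
have e2 : 2 ^+ 2 = 4 :> rat by ring.
have e5 : 2 ^+ 5 = 32 :> rat by ring.
rewrite e2 in i2; rewrite e5 in i5.
have -> : (H ^+ 2 + G) / 32 = - (H / 4) + (H / 4 + (H ^+ 2 + G) / 32) by ring.
rewrite /fact_unit; apply: tri_cong; first by apply: (cong_eq p_pr); rewrite qE; field.
apply: (congP (c := - (H * 4^-1) + (P - 2) * ((H ^+ 2 + G) * 32^-1))); first by pint.
by rewrite qE; field.
Qed.

Lemma nE_half : n%:R = (P - 1) / 2 :> rat.
Proof. by rewrite natrM qE; field. Qed.

Lemma fact_unit_n : cong p 3 (fact_unit p n)
  (tri p 1 ((H - 2 * O1) / 2) ((G + 2 * O2) / 2 + (H - 2 * O1) ^+ 2 / 8)).
Proof.
have np : (n < p)%N by lia.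
have iX := pint_harm p_pr 1 np; have iX2 := pint_harm p_pr 2 np.
have iH := pint_H; have iG := pint_G; have hc := harm2_n.
have iO1 := pint_odd_harm 1; have iO2 := pint_odd_harm 2.
have [a pa ha] := harm1_n.
have i1 := pint_inv_pow2 1; rewrite expr1 in i1.
have -> : (G + 2 * O2) / 2 + (H - 2 * O1) ^+ 2 / 8 =
  ((G + 2 * O2) / 2 - (H - 2 * O1) / 2 - P * ((G + 2 * O2) / 2)) +
  ((H - 2 * O1) / 2 + P * ((G + 2 * O2) / 2) + (H - 2 * O1) ^+ 2 / 8) by ring.
rewrite /fact_unit; apply: tri_cong.
  apply: (congP (c := (1 - P) / 2 * a)); first by pint.
  by rewrite nE_half ha; field.
have h1 : cong p 1 (harm 1 n) (H - 2 * O1).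
  apply: (congP (c := G + 2 * O2 + P * a)); first by pint.
  by rewrite ha; ring.
have hn : cong p 1 n%:R (- (1 / 2)).
  by rewrite nE_half; apply: (congP (c := 2^-1)); [pint|field].
apply: (@cong_trans _ p_pr _ (- (- (1 / 2) * (H - 2 * O1)) + (- (1 / 2)) ^+ 2 * ((H - 2 * O1) ^+ 2 + 0) / 2)).
  by congs.
apply: (congP (c := - ((G + 2 * O2) / 2))); first by pint.
by field.
Qed.

Lemma fact_unit_3q : cong p 3 (fact_unit p (n + q))
  (tri p 1 (3 * H / 4) (3 * G / 4 + 9 * (H ^+ 2 - G) / 32)).
Proof.
have np : (n + q < p)%N by lia.
have iX := pint_harm p_pr 1 np; have iX2 := pint_harm p_pr 2 np.
have iH := pint_H; have iG := pint_G; have hc := harm2_3q.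
have [a pa ha] := harm1_3q.
have i2 := pint_inv_pow2 2; have i1 := pint_inv_pow2 1.
have e2 : 2 ^+ 2 = 4 :> rat by ring.
rewrite e2 in i2; rewrite expr1 in i1.
have E3 : (n + q)%:R = 3 * (P - 1) / 4 :> rat by rewrite natrD nE_half qE; field.
have -> : 3 * G / 4 + 9 * (H ^+ 2 - G) / 32 =
  (3 * G / 4 - 3 * H / 4 - P * (3 * G / 4)) +
  (3 * H / 4 + P * (3 * G / 4) + 9 * (H ^+ 2 - G) / 32) by ring.
rewrite /fact_unit; apply: tri_cong.
  apply: (congP (c := 3 * (1 - P) / 4 * a)); first by pint.
  by rewrite E3 ha; field.
have h1 : cong p 1 (harm 1 (n + q)) H.
  apply: (congP (c := G + P * a)); first by pint.
  by rewrite ha; ring.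
have hn : cong p 1 (n + q)%:R (- (3 / 4)).
  by rewrite E3; apply: (congP (c := 3 * 4^-1)); [pint|field].
apply: (@cong_trans _ p_pr _ (- (- (3 / 4) * H) + (- (3 / 4)) ^+ 2 * (H ^+ 2 + - G) / 2)).
  by congs.
apply: (congP (c := - (3 * G / 4))); first by pint.
by field.
Qed.

(** At first order, H/4 + (H - 2 O1)/2 + O1 = 3H/4. At second order the two sides differ by G/16 +
    O2/4, which [odd_harm2] makes divisible by p. *)
Lemma unit_relation :
  cong p 3 (fact_unit p q * fact_unit p n * \prod_(i < q) (1 + P * (2 * i%:R + 1)^-1))
    ((1 + P ^+ 2 * (O2 / 4)) * fact_unit p (n + q)).
Proof.
have in' : pintegral p (fact_unit p n) by apply: (pint_fact_unit p_pr p_gt3); lia.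
have iprod : pintegral p (\prod_(i < q) (1 + P * (2 * i%:R + 1)^-1)).
  by apply: (pintegral_prod p_pr) => i _; have io := pint_odd_inv (ltn_ord i); pint.
have [d pd hd] := odd_harm2.
have iH := pint_H; have iG := pint_G.
have iO1 := pint_odd_harm 1; have iO2 := pint_odd_harm 2.
have i1 := pint_inv_pow2 1; have i2 := pint_inv_pow2 2; have i3 := pint_inv_pow2 3; have i5 := pint_inv_pow2 5.
have e2 : 2 ^+ 2 = 4 :> rat by ring.
have e3 : 2 ^+ 3 = 8 :> rat by ring.
have e5 : 2 ^+ 5 = 32 :> rat by ring.
rewrite expr1 in i1; rewrite e2 in i2; rewrite e3 in i3; rewrite e5 in i5.
have tx : pintegral p (tri p 1 (H / 4) ((H ^+ 2 + G) / 32)) by rewrite /tri; pint.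
have step1 := cong_trans p_pr (congM p_pr tx in' fact_unit_q fact_unit_n)
  (triM p_pr _ _ (_ : pintegral p (H / 4)) (_ : pintegral p ((H ^+ 2 + G) / 32))
   (_ : pintegral p ((H - 2 * O1) / 2)) (_ : pintegral p ((G + 2 * O2) / 2 + (H - 2 * O1) ^+ 2 / 8))).
have {}step1 := step1 ltac:(pint) ltac:(pint) ltac:(pint) ltac:(pint).
set y1 := 1 * _ + _ in step1; set y2 := _ + _ * 1 in step1.
have iy1 : pintegral p y1 by rewrite /y1; pint.
have iy2 : pintegral p y2 by rewrite /y2; pint.
have ty : pintegral p (tri p (1 * 1) y1 y2) by rewrite /tri; pint.
have iz : pintegral p ((O1 ^+ 2 - O2) / 2) by pint.
have step2 := cong_trans p_pr (congM p_pr ty iprod step1 (odd_prod_cong (leqnn q)))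
  (triM p_pr _ _ iy1 iy2 iO1 iz).
apply: (cong_trans p_pr step2); apply: cong_sym.
have -> : 1 + P ^+ 2 * (O2 / 4) = tri p 1 0 (O2 / 4) by rewrite /tri; ring.
have t0 : pintegral p (tri p 1 0 (O2 / 4)) by rewrite /tri; pint.
apply: (cong_trans p_pr (congMl p_pr t0 fact_unit_3q)).
have j0 := pintegral0 p_pr.
have v2 : pintegral p (O2 / 4) by pint.
have w1 : pintegral p (3 * H / 4) by pint.
have w2 : pintegral p (3 * G / 4 + 9 * (H ^+ 2 - G) / 32) by pint.
apply: (cong_trans p_pr (triM p_pr _ _ j0 v2 w1 w2)).
apply: (congP (c := - (d / 4))); first by pint.
by rewrite /y1 /y2 /tri hd; field.
Qed.

Lemma jac_rep_quarter :
  cong p 3 (jac_rep p n q) (- (b q * (1 + P ^+ 2 * \sum_(i < q) (c3 rat i)^-1))).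
Proof.
have hq : (0 < q < n)%N by lia.
have rec := jac_rep_gamma p_pr p_gt3 pE_quarter hq.
have f0 k : k`!%:R != 0 :> rat by rewrite pnatr_eq0 -lt0n fact_gt0.
have np : (n + q < p)%N by lia.
have iN k := pintegral_nat p_pr k.
have ib := pintegral_cbin p_pr pE_quarter n_gt1 q.
have i2 := pint_inv_pow2 2; have e2 : 2 ^+ 2 = 4 :> rat by ring.
rewrite e2 in i2.
have iO2 := pint_odd_harm 2.
have hs : cong p 3 (jac_rep p n q) (- (b q * (1 + P ^+ 2 * (O2 / 4)))).
  have np' : (n + q < p)%N := np.
  have iX := pint_harm p_pr 1 np; have iX2 := pint_harm p_pr 2 np.
  have ih := pint_half p_pr p_gt3.
  have iY : pintegral p (- ((n + q)%:R * harm 1 (n + q)) + P * (- ((n + q)%:R * harm 1 (n + q))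
      + (n + q)%:R ^+ 2 * (harm 1 (n + q) ^+ 2 + harm 2 (n + q)) / 2)).
    by pint.
  apply: (cong3_cancel p_pr iY).
  - exact: pintegral_nat.
  - by pint.
  have -> : 1 + P * (- ((n + q)%:R * harm 1 (n + q)) + P * (- ((n + q)%:R * harm 1 (n + q))
      + (n + q)%:R ^+ 2 * (harm 1 (n + q) ^+ 2 + harm 2 (n + q)) / 2)) = fact_unit p (n + q).
    by rewrite /fact_unit /tri; ring.
  have := congMl p_pr (iN (n + q)`!) rec.
  rewrite [(q + n)%N]addnC /gamma_rep.
  have -> : (n + q)`!%:R * (jac_rep p n q * ((n + q)`!%:R^-1 * fact_unit p (n + q))) =
    fact_unit p (n + q) * jac_rep p n q by field; rewrite f0.
  move=> h; apply: (cong_trans p_pr h).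
  have -> : (n + q)`!%:R * - (q`!%:R^-1 * fact_unit p q * (n`!%:R^-1 * fact_unit p n)) =
    - ((n + q)`!%:R / (n`!%:R * q`!%:R) * (fact_unit p q * fact_unit p n)) by field; rewrite !f0.
  rewrite fact_ratio.
  have -> : - (b q * (\prod_(i < q) (1 + P * (2 * i%:R + 1)^-1)) * (fact_unit p q * fact_unit p n)) =
    - (b q * (fact_unit p q * fact_unit p n * \prod_(i < q) (1 + P * (2 * i%:R + 1)^-1))) by ring.
  have -> : fact_unit p (n + q) * - (b q * (1 + P ^+ 2 * (O2 / 4))) =
    - (b q * ((1 + P ^+ 2 * (O2 / 4)) * fact_unit p (n + q))) by ring.
  by apply: congN; apply: (congMl p_pr ib); apply: unit_relation.
apply: (cong_trans p_pr hs); apply: congN; apply: (congMl p_pr ib).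
apply: (congD p_pr (cong_refl p_pr _ _)).
exact: (@congMp _ 1 2 _ _ (cong_sym c3_odd_harm)).
Qed.

End QuarterEvaluation.

(** * The case p = 1 mod 4 *)

(* From p (a^2 - c^2) = (a d - b c) (a d + b c) and
   p^2 = (a c + b d)^2 + (a d - b c)^2. *)
Lemma two_squares_uniq (p : nat) (a b c d : int) : prime p ->
  p%:Z = a ^+ 2 + b ^+ 2 -> p%:Z = c ^+ 2 + d ^+ 2 ->
  (exists m, a = 2 * m + 1) -> (exists m, c = 2 * m + 1) -> (exists m, d = 2 * m) ->
  a ^+ 2 = c ^+ 2.
Proof.
move=> p_pr pab pcd [k ak] [l cl] [m dm].
have p0 : 0 < p%:Z :> int by rewrite ltz_nat prime_gt0.
have main e : (p%:Z %| a * d - e * b * c)%Z -> e ^+ 2 = 1 -> a ^+ 2 = c ^+ 2.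
  move=> /dvdzP [t et] e1.
  have sq : (a * c + e * b * d) ^+ 2 + (a * d - e * b * c) ^+ 2 = p%:Z ^+ 2.
    transitivity (a ^+ 2 * c ^+ 2 + a ^+ 2 * d ^+ 2 + e ^+ 2 * b ^+ 2 * (c ^+ 2 + d ^+ 2)); first by ring.
    rewrite e1; transitivity ((a ^+ 2 + b ^+ 2) * (c ^+ 2 + d ^+ 2)); first by ring.
    by rewrite -pab -pcd expr2.
  (* Odd because a and c are odd and d is even. Hence (a d - e b c)^2 < p^2 although p^2 divides it,
     and it vanishes. *)
  have odd_ac : a * c + e * b * d != 0.
    by apply/eqP; rewrite ak cl dm => h; have : 2 * (2 * k * l + k + l + e * b * m) = -1 by [lia|rewrite -[RHS]add0r -h; ring]; lia.
  have t0 : t = 0.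
    have s0 : 0 < (a * c + e * b * d) ^+ 2 by rewrite exprn_even_gt0.
    have : t ^+ 2 * p%:Z ^+ 2 < p%:Z ^+ 2 by rewrite -{2}sq et exprMn; lia.
    rewrite gtr_pMl ?exprn_gt0 // => t1.
    by apply/eqP; rewrite -sqrf_eq0; apply/eqP; have := sqr_ge0 t; lia.
  move: et; rewrite t0 mul0r => /eqP; rewrite subr_eq0 => /eqP ad.
  have : a ^+ 2 * d ^+ 2 = b ^+ 2 * c ^+ 2.
    by rewrite -exprMn ad -[RHS]mul1r -e1; ring.
  have -> : d ^+ 2 = p%:Z - c ^+ 2 by rewrite pcd; ring.
  have -> : b ^+ 2 = p%:Z - a ^+ 2 by rewrite pab; ring.
  move=> h; apply: (mulfI (lt0r_neq0 p0)).
  by apply/eqP; rewrite -subr_eq0; apply/eqP; move/eqP: h; rewrite -subr_eq0 => /eqP <-; ring.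
have : (p%:Z %| (a * d - b * c) * (a * d + b * c))%Z.
  apply/dvdzP; exists (a ^+ 2 - c ^+ 2).
  transitivity (a ^+ 2 * d ^+ 2 - b ^+ 2 * c ^+ 2); first by ring.
  have -> : d ^+ 2 = p%:Z - c ^+ 2 by rewrite pcd; ring.
  have -> : b ^+ 2 = p%:Z - a ^+ 2 by rewrite pab; ring.
  by ring.
rewrite Euclid_dvdzM // => /orP [h|h].
  by apply: (main 1) => //; rewrite mul1r.
by apply: (main (-1)) => //; rewrite mulN1r mulNr opprK.
Qed.

Lemma sun_sum_1mod4 p q (x y : int) : prime p -> (3 < p)%N -> p = (4 * q + 1)%N ->
  p%:Z = x ^+ 2 + 4 * y ^+ 2 ->
  eqmodq p 3 (\sum_(0 <= k < p) sun_term k)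
    (- 2 * x%:~R ^+ 2 + p%:R + p%:R ^+ 2 / (4 * x%:~R ^+ 2)).
Proof.
move=> p_pr p3 pq pxy; pose n := (2 * q)%N.
have pE : p = (2 * n + 1)%N by rewrite /n; lia.
have n1 : (1 < n)%N by rewrite /n; lia.
have [A [B [[m Am] AB quad]]] := jac_half_root p_pr p3 pE (erefl n).
have x_odd : exists k, x = 2 * k + 1.
  have [k [xk|xk]] : exists k, x = 2 * k \/ x = 2 * k + 1.
    exists (x %/ 2)%Z; have := divz_eq x 2; have := ltz_pmod x (isT : 0 < 2 :> int).
    have := modz_ge0 x (isT : 2 != 0 :> int).
    by move: (x %% 2)%Z (x %/ 2)%Z => r t; lia.
    have : p%:Z = 2 * (2 * k ^+ 2 + 2 * y ^+ 2) by rewrite pxy xk; ring.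
    by move: (2 * k ^+ 2 + 2 * y ^+ 2) => z; lia.
  by exists k.
have A2 : A ^+ 2 = x ^+ 2.
  apply: (@two_squares_uniq p A B x (2 * y)) => //; last by exists y.
  - by rewrite pxy; ring.
  - by exists m.
have [X [XE X0 Xp]] : exists X : nat, [/\ x%:~R ^+ 2 = X%:R ^+ 2 :> rat, (0 < X)%N & (X < p)%N].
  exists `|x|%N; split.
  - have e : `|x|%N%:Z ^+ 2 = x ^+ 2 by rewrite abszE real_normK ?num_real.
    by rewrite pmulrn !expr2 -!intrM -!expr2 e.
  - by case: x_odd => k ->; lia.
  - have : (`|x|%N%:Z) ^+ 2 <= p%:Z by rewrite pxy abszE; have := sqr_ge0 y; rewrite real_normK ?num_real //; lia.
    by move: `|x|%N => m' h; rewrite ltnNge; apply/negP => h'; nia.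
have iX : pintegral p X%:R^-1 by apply: pint_inv; lia.
have i4 : pintegral p 4^-1 by apply: (@pint_inv p 4); lia.
have X0' : X%:R != 0 :> rat by rewrite pnatr_eq0; lia.
have A2X : A%:~R ^+ 2 = X%:R ^+ 2 :> rat by rewrite -XE !expr2 -!intrM -!expr2 A2.
rewrite {}XE.
clear Am x_odd pxy A2 AB.
set b := cbin rat q.
have b0 : b != 0 by exact: cbin_neq0.
set a := jac_rep p n q.
have q2p : (2 * q < p)%N by lia.
have s0 : n = (2 * q)%N by [].
have sund := sun_sum_even p_pr pE n1 s0; rewrite -/b in sund.
set s := \sum_(i < q) _ in sund.
have ha : cong p 3 a (- (b * (1 + p%:R ^+ 2 * s))) := jac_rep_quarter p_pr p3 pq.
have ib : pintegral p b := pintegral_cbin p_pr pE n1 q.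
have ibV : pintegral p b^-1 := pintegral_cbinV p_pr pE n1 q2p.
have ih := pint_half p_pr p3.
have is3 : pintegral p s.
  have io := pint_odd_harm p_pr p3 pq 2.
  by apply: (cong_pint p_pr (c3_odd_harm p_pr p3 pq)); pint.
have ia : pintegral p a := pintegral_nat p_pr _.
have aquad : cong p 3 (a ^+ 2 - 2 * A%:~R * a + p%:R) 0.
  apply: (@cong_leq _ p_pr 3 4); first by [].
  apply: (@lifts_inj _ p_pr 0); last exact: (lifts_nat p_pr 0).
  rewrite -quad; have la := lifts_jac_rep p_pr n q.
  apply: liftsD; [exact: p_pr| |exact: lifts_nat].
  apply: liftsD; [exact: p_pr|by rewrite !expr2; apply: liftsM|].
  apply: liftsN; apply: liftsM; [exact: p_pr| |exact: la].
  by apply: liftsM; [exact: p_pr|apply: lifts_nat|apply: lifts_int].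
have [t it ht] := aquad; have [r ir hr] := ha.
(* The other root of the quadratic equation. *)
pose beta := 2 * A%:~R - a.
have aD : a + beta = 2 * A%:~R by rewrite /beta; ring.
have ibeta : pintegral p beta by rewrite /beta; pint.
have hab : a * beta = p%:R - p%:R ^+ 3 * t.
  by rewrite -[p%:R ^+ 3 * t]add0r -ht /beta; ring.
have Z4 : 4 * X%:R ^+ 2 = (a + beta) ^+ 2 by rewrite aD -A2X; ring.
have ibet : b * beta = - p%:R + p%:R ^+ 3 * t - p%:R ^+ 2 * b * s * beta + p%:R ^+ 3 * r * beta.
  transitivity (- (a * beta) + (a + b) * beta); first by ring.
  by rewrite hab hr; ring.
clear ht hab aquad aD quad A2X.
move: ibeta ibet Z4; move: beta => beta ibeta ibet Z4.
(* g is beta / p. Knowing that beta is divisible by p, one feeds this back into the term p^2 b s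
   beta, which becomes negligible modulo p^3. *)
pose g := b^-1 * (-1 + p%:R ^+ 2 * t - p%:R * b * s * beta + p%:R ^+ 2 * r * beta).
have ig : pintegral p g by rewrite /g; pint.
have bg : beta = p%:R * g.
  by rewrite -[beta](mulKf b0) ibet /g; ring.
have hbeta : cong p 3 beta (- (p%:R * b^-1)).
  apply: (congP (c := b^-1 * (t - b * s * g + r * beta))); first by pint.
  by rewrite -[beta in beta - _](mulKf b0) ibet {1}bg; ring.
pose k := - (b * p%:R * s) + p%:R ^+ 2 * r + g.
have ik : pintegral p k by rewrite /k; pint.
have hk : a + beta = - b + p%:R * k by rewrite bg hr /k; ring.
(* Modulo p is enough here, as p^2 multiplies this inverse. *)
have inv4 : cong p 1 (4 * X%:R ^+ 2)^-1 (b^-1 ^+ 2).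
  apply: (congP (c := (2 * b * k - p%:R * k ^+ 2) * (b^-1 ^+ 2 * (X%:R^-1 ^+ 2 * 4^-1)))); first by pint.
  transitivity ((b ^+ 2 - 4 * X%:R ^+ 2) * (b^-1 ^+ 2 * (X%:R^-1 ^+ 2 * 4^-1))).
    by field; rewrite X0' b0.
  by rewrite Z4 hk; ring.
apply: (eqmodq_cong p_pr).
  by rewrite invfM -exprVn; pint.
apply: (cong_trans p_pr sund); apply: cong_sym.
have -> : - 2 * X%:R ^+ 2 + p%:R + p%:R ^+ 2 / (4 * X%:R ^+ 2) =
  - (2^-1 * (4 * X%:R ^+ 2)) + p%:R + p%:R ^+ 2 / (4 * X%:R ^+ 2) :> rat by field.
rewrite Z4.
have inv4' := @congMp _ 1 2 _ _ inv4.
rewrite -Z4 {1}Z4.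
have sq : cong p 3 ((a + beta) ^+ 2) ((- (b * (1 + p%:R ^+ 2 * s)) + - (p%:R * b^-1)) ^+ 2).
  by congs.
apply: (cong_trans p_pr (congD p_pr (congD p_pr (congN (congMl p_pr ih sq)) (cong_refl p_pr 3 _)) inv4')).
apply: (congP (c := - (s + 2^-1 * (p%:R * b ^+ 2 * s ^+ 2)))); first by pint.
by field.
Qed.

Unset Implicit Arguments.

Theorem theorem2p2 (p : nat) (p_prime : prime p) (p_gt3 : (3 < p)%N) :
  ((p = 1 %[mod 4])%N ->
    forall x y : int, p%:Z = x ^+ 2 + 4 * y ^+ 2 ->
    eqmodq p 3
      (\sum_(0 <= k < p)
         ('C(2 * k, k))%:R ^+ 3 / (64 ^+ k * (2 * k%:R - 1)))
      (- 2 * x%:~R ^+ 2 + p%:R + p%:R ^+ 2 / (4 * x%:~R ^+ 2)))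
  /\
  ((p = 3 %[mod 4])%N ->
    eqmodq p 3
      (\sum_(0 <= k < p)
         ('C(2 * k, k))%:R ^+ 3 / (64 ^+ k * (2 * k%:R - 1)))
      (- (1 / 4) * (2 + p%:R ^+ 2 * (euler (p - 3))%:~R)
         * ((p%:R + 1) ^+ 2 / 2 ^+ (p - 1))
         * ('C((p - 1) %/ 2, (p - 3) %/ 4))%:R ^+ 2
       + p%:R ^+ 2 / (2 * ('C((p - 1) %/ 2, (p - 3) %/ 4))%:R ^+ 2))).

Proof.
split=> [p4 x y pxy | p4].
  by apply: (@sun_sum_1mod4 p (p %/ 4) x y) => //; lia.
have -> : ((p - 1) %/ 2 = 2 * (p %/ 4) + 1)%N by lia.
have -> : ((p - 3) %/ 4 = p %/ 4)%N by lia.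
by apply: sun_sum_3mod4 => //; lia.
Qed.
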